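(* Let $p,q$ be relatively prime positive integers and let $G=\langle a,b\mid a^p=b^q\rangle$ be the knot group of the $(p,q)$ torus knot. Then $G$ is rigid: whenever $G$ acts geometrically on two CAT(0) spaces $X_1$ and $X_2$, the visual boundaries $\partial X_1$ and $\partial X_2$ are homeomorphic.
   Context: CAT(0) spaces are taken to be proper geodesic spaces. A geometric action is a properly discontinuous, cocompact action by isometries. For a CAT(0) space $X$, $\partial X$ denotes the visual boundary with the cone topology. A group that acts geometrically on some CAT(0) space is called rigid if it has only one visual boundary up to homeomorphism. *)

(* Defs.v *)
From HB Require Import structures.
From mathcomp Require Import all_boot all_order all_algebra.
From mathcomp Require Import all_classical all_reals all_analysis.

Set Implicit Arguments.
Unset Strict Implicit.
Unset Printing Implicit Defensive.

Import Order.TTheory GRing.Theory Num.Theory.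

Local Open Scope quotient_scope.
Local Open Scope classical_set_scope.
Local Open Scope ring_scope.

(* The letter (x, false) stands for the generator x, (x, true) for its inverse;
   the relation (u, v) stands for the equation u = v. *)
Definition word (A : Type) := seq (A * bool).

Definition inv_letter (A : Type) (x : A * bool) : A * bool := (x.1, ~~ x.2).

Definition inv_word (A : Type) (w : word A) : word A :=
  rev (map (@inv_letter A) w).

Inductive word_equiv (A : Type) (rels : set (word A * word A)) :
    word A -> word A -> Prop :=
| WordRefl u : word_equiv rels u u
| WordSym u v : word_equiv rels u v -> word_equiv rels v u
| WordTrans v u w :
    word_equiv rels u v -> word_equiv rels v w -> word_equiv rels u w
| WordCancel u v x :
    word_equiv rels (u ++ [:: x; inv_letter x] ++ v) (u ++ v)
| WordRel u v l r :
    rels (l, r) -> word_equiv rels (u ++ l ++ v) (u ++ r ++ v).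

Section PresentedGroup.
Variables (A : choiceType) (rels : set (word A * word A)).
Local Notation equiv := (word_equiv rels).

Definition word_equivb (u v : word A) : bool := `[< equiv u v >].

Lemma word_equivb_refl : reflexive word_equivb.
Proof. by move=> u; apply/asboolP; exact: WordRefl. Qed.

Lemma word_equivb_sym : symmetric word_equivb.
Proof. by move=> u v; apply/asboolP/asboolP => /WordSym. Qed.

Lemma word_equivb_trans : transitive word_equivb.
Proof.
by move=> v u w /asboolP uv /asboolP vw; apply/asboolP; exact: WordTrans vw.
Qed.

Canonical word_equiv_rel :=
  EquivRel word_equivb word_equivb_refl word_equivb_sym word_equivb_trans.

Definition presented_group : Type := {eq_quot word_equiv_rel}.

HB.instance Definition _ := Choice.copy presented_group
  {eq_quot word_equiv_rel}.

Definition word_class (w : word A) : presented_group :=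
  \pi_{eq_quot word_equiv_rel} w.

Lemma word_classP u v : word_class u = word_class v <-> equiv u v.
Proof.
rewrite /word_class; split.
  by move/eqP; rewrite eqmodE => /asboolP.
by move=> uv; apply/eqP; rewrite eqmodE; apply/asboolP.
Qed.

Let word_repr (g : presented_group) : word A :=
  repr (g : {eq_quot word_equiv_rel}).

Let word_reprK g : word_class (word_repr g) = g.
Proof. exact: reprK. Qed.

Lemma word_equiv_cat u u' v v' :
  equiv u u' -> equiv v v' -> equiv (u ++ v) (u' ++ v').
Proof.
have catl s t w : equiv s t -> equiv (w ++ s) (w ++ t).
  elim=> {s t} [s|s t _|s t r _ st _|s t x|s t l r lr].
  - exact: WordRefl.
  - exact: WordSym.
  - exact: WordTrans.
  - by rewrite !(catA w); exact: WordCancel.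
  - by rewrite !(catA w); exact: WordRel.
have catr s t w : equiv s t -> equiv (s ++ w) (t ++ w).
  elim=> {s t} [s|s t _|s t r _ st _|s t x|s t l r lr].
  - exact: WordRefl.
  - exact: WordSym.
  - exact: WordTrans.
  - by rewrite -!catA; exact: WordCancel.
  - by rewrite -!catA; exact: WordRel.
by move=> uu' vv'; apply: (@WordTrans _ _ (u' ++ v)); [exact: catr|exact: catl].
Qed.

Lemma inv_letterK : involutive (@inv_letter A).
Proof. by move=> [x b]; rewrite /inv_letter /= negbK. Qed.

Lemma inv_wordK : involutive (@inv_word A).
Proof.
move=> w; rewrite /inv_word map_rev revK -map_comp -[RHS]map_id.
by apply: eq_map => x; exact: inv_letterK.
Qed.

Lemma word_equiv_mulV w : equiv (w ++ inv_word w) [::].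
Proof.
elim: w => [|x w IHw]; first exact: WordRefl.
rewrite /inv_word /= rev_cons -/(inv_word w) -cats1 catA.
apply: (@WordTrans _ _ [:: x; inv_letter x]); last first.
  exact: (@WordCancel _ rels [::] [::] x).
apply: (@word_equiv_cat (x :: w ++ inv_word w) [:: x] [:: _]).
  exact: (@word_equiv_cat [:: x] [:: x] _ [::] (WordRefl _ _) IHw).
exact: WordRefl.
Qed.

Lemma word_equiv_mulVl w : equiv (inv_word w ++ w) [::].
Proof. by rewrite -{2}(inv_wordK w); exact: word_equiv_mulV. Qed.

Lemma word_equiv_inv u v : equiv u v -> equiv (inv_word u) (inv_word v).
Proof.
move=> uv; apply: (@WordTrans _ _ (inv_word u ++ v ++ inv_word v)).
  rewrite -{1}[inv_word u]cats0; apply: word_equiv_cat; first exact: WordRefl.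
  exact/WordSym/word_equiv_mulV.
rewrite catA -[X in equiv _ X]cat0s.
apply: word_equiv_cat; last exact: WordRefl.
apply: WordTrans (word_equiv_mulVl u).
by apply: word_equiv_cat; [exact: WordRefl|exact: WordSym].
Qed.

Definition pg_one : presented_group := word_class [::].
Definition pg_mul (g h : presented_group) : presented_group :=
  word_class (word_repr g ++ word_repr h).
Definition pg_inv (g : presented_group) : presented_group :=
  word_class (inv_word (word_repr g)).

Let pg_mulE u v : pg_mul (word_class u) (word_class v) = word_class (u ++ v).
Proof.
apply/word_classP; apply: word_equiv_cat;
  by apply/word_classP; rewrite word_reprK.
Qed.

Let pg_invE u : pg_inv (word_class u) = word_class (inv_word u).
Proof.
by apply/word_classP; apply: word_equiv_inv; apply/word_classP;
  rewrite word_reprK.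
Qed.

Let pg_mulA : associative pg_mul.
Proof.
move=> g h k; rewrite -(word_reprK g) -(word_reprK h) -(word_reprK k).
by rewrite !pg_mulE catA.
Qed.

Let pg_mul1 : left_id pg_one pg_mul.
Proof. by move=> g; rewrite -(word_reprK g) pg_mulE. Qed.

Let pg_1mul : right_id pg_one pg_mul.
Proof. by move=> g; rewrite -(word_reprK g) pg_mulE cats0. Qed.

Let pg_mulVg : left_inverse pg_one pg_inv pg_mul.
Proof.
move=> g; rewrite -(word_reprK g) pg_invE pg_mulE.
exact/word_classP/word_equiv_mulVl.
Qed.

Let pg_mulgV : right_inverse pg_one pg_inv pg_mul.
Proof.
move=> g; rewrite -(word_reprK g) pg_invE pg_mulE.
exact/word_classP/word_equiv_mulV.
Qed.

HB.instance Definition _ := isGroup.Build presented_group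
  pg_mulA pg_mul1 pg_1mul pg_mulVg pg_mulgV.

Lemma word_class_nil : word_class [::] = 1%g.
Proof. by []. Qed.

Lemma word_class_cat u v :
  word_class (u ++ v) = (word_class u * word_class v)%g.
Proof. by rewrite -pg_mulE. Qed.

Lemma word_class_inv u : word_class (inv_word u) = (word_class u)^-1%g.
Proof. by rewrite -pg_invE. Qed.

Definition word_eval (H : groupType) (f : A -> H) (w : word A) : H :=
  (\prod_(x <- w) if x.2 then (f x.1)^-1 else f x.1)%g.

Lemma presented_group_universal (H : groupType) (f : A -> H) :
  (forall l r, rels (l, r) -> word_eval f l = word_eval f r) ->
  exists! phi : presented_group -> H,
    {morph phi : g h / (g * h)%g >-> (g * h)%g} /\
    forall x, phi (word_class [:: (x, false)]) = f x.
Proof.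
move=> frel.
have ecat u v : word_eval f (u ++ v) = (word_eval f u * word_eval f v)%g.
  by rewrite /word_eval big_cat.
have eequiv u v : equiv u v -> word_eval f u = word_eval f v.
  elim=> {u v} [//|//|v u w _ -> _ //|u v [x b]|u v l r lr].
    rewrite !ecat; congr (_ * _)%g; rewrite -[RHS]mul1g; congr (_ * _)%g.
    by rewrite /word_eval !big_cons big_nil mulg1; case: b => /=;
      rewrite ?mulVg ?mulgV.
  by rewrite !ecat (frel l r).
exists (fun g => word_eval f (word_repr g)); split.
  split=> [g h|x]; last first.
    rewrite (eequiv _ [:: (x, false)]); last by apply/word_classP/word_reprK.
    by rewrite /word_eval big_seq1.
  rewrite -ecat; apply/eequiv/word_classP.
  by rewrite word_reprK word_class_cat !word_reprK.
move=> psi [psiM psif]; apply/funext => g; rewrite -{2}(word_reprK g).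
have psi1 : psi 1%g = 1%g.
  by apply: (@mulgI _ (psi 1%g)); rewrite -psiM !mulg1.
have psiV h : psi (h^-1)%g = (psi h)^-1%g.
  by apply: (@mulgI _ (psi h)); rewrite -psiM !mulgV.
elim: (word_repr g) => [|[x b] w IHw].
  by rewrite word_class_nil psi1 /word_eval big_nil.
rewrite -cat1s word_class_cat psiM ecat IHw; congr (_ * _)%g.
rewrite /word_eval big_seq1 /=; case: b; last by rewrite psif.
by rewrite -psif -psiV -word_class_inv.
Qed.

End PresentedGroup.

(* < a, b | a ^ p = b ^ q >, with generators a = true and b = false. *)
Definition torus_knot_rels (p q : nat) : set (word bool * word bool) :=
  [set (nseq p (true, false), nseq q (false, false))].

Definition torus_knot_group (p q : nat) : groupType :=
  presented_group (torus_knot_rels p q).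

Section CAT0.
Variable R : realType.

(* A map is a geodesic segment only through its values on [0, d x y]. *)
Definition geodesic_segment (T : Type) (d : T -> T -> R) (x y : T)
    (c : R -> T) : Prop :=
  [/\ c 0 = x, c (d x y) = y &
      forall s t, 0 <= s <= d x y -> 0 <= t <= d x y ->
        d (c s) (c t) = `|s - t| ].

(* The library's norm on pairs is the sup norm, hence this definition. *)
Definition plane_dist (u v : R * R) : R :=
  Num.sqrt ((u.1 - v.1) ^+ 2 + (u.2 - v.2) ^+ 2).

(* A geodesic triangle with vertices v 0, v 1, v 2; side i joins v i to
   v (i + 1 mod 3). *)
Definition geodesic_triangle (T : Type) (d : T -> T -> R) (v : 'I_3 -> T)
    (c : 'I_3 -> R -> T) : Prop :=
  forall i, geodesic_segment d (v i) (v (ordS i)) (c i).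

Definition geodesic_space (X : metricType R) : Prop :=
  forall x y : X, exists c, geodesic_segment mdist x y c.

Definition proper_space (X : metricType R) : Prop :=
  forall (x : X) (r : R), compact [set y | mdist x y <= r].

(* The point of the comparison triangle that corresponds to c i s is c' i s:
   sides are parametrized by arc length and have equal length. *)
Definition cat0_inequality (X : metricType R) : Prop :=
  forall (v : 'I_3 -> X) (c : 'I_3 -> R -> X)
         (v' : 'I_3 -> R * R) (c' : 'I_3 -> R -> R * R),
    geodesic_triangle mdist v c ->
    geodesic_triangle plane_dist v' c' ->
    (forall i, plane_dist (v' i) (v' (ordS i)) = mdist (v i) (v (ordS i))) ->
    forall (i j : 'I_3) (s t : R),
      0 <= s <= mdist (v i) (v (ordS i)) ->
      0 <= t <= mdist (v j) (v (ordS j)) ->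
      mdist (c i s) (c j t) <= plane_dist (c' i s) (c' j t).

(* The empty space is excluded: every group would act geometrically on it. *)
Definition cat0_space (X : metricType R) : Prop :=
  [/\ [set: X] !=set0, proper_space X, geodesic_space X & cat0_inequality X].

Definition is_group_action (G : groupType) (X : Type) (act : G -> X -> X) :=
  (forall x, act 1%g x = x) /\
  (forall g h x, act (g * h)%g x = act g (act h x)).

Definition acts_by_isometries (G : groupType) (X : metricType R)
    (act : G -> X -> X) : Prop :=
  forall g x y, mdist (act g x) (act g y) = mdist x y.

Definition properly_discontinuous (G : groupType) (X : metricType R)
    (act : G -> X -> X) : Prop :=
  forall K : set X, compact K ->
    finite_set [set g | (act g @` K) `&` K !=set0].

Definition cocompact (G : groupType) (X : metricType R)
    (act : G -> X -> X) : Prop :=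
  exists2 K : set X, compact K & \bigcup_g (act g @` K) = [set: X].

Definition geometric_action (G : groupType) (X : metricType R)
    (act : G -> X -> X) : Prop :=
  [/\ is_group_action act, acts_by_isometries act,
      properly_discontinuous act & cocompact act].

(* Only the values of a ray on [0, +oo[ matter; rays that agree there are
   asymptotic, hence define the same boundary point. *)
Record geodesic_ray (X : metricType R) := GeodesicRay {
  ray_fun :> R -> X ;
  ray_isometry : forall s t, 0 <= s -> 0 <= t ->
    mdist (ray_fun s) (ray_fun t) = `|s - t| }.

HB.instance Definition _ (X : metricType R) := gen_eqMixin (geodesic_ray X).
HB.instance Definition _ (X : metricType R) := gen_choiceMixin (geodesic_ray X).

Section Boundary.
Variable X : metricType R.

Definition asymptotic (c c' : geodesic_ray X) : Prop :=
  exists K : R, forall t, 0 <= t -> mdist (c t) (c' t) <= K.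

Definition asymptoticb (c c' : geodesic_ray X) : bool := `[< asymptotic c c' >].

Lemma asymptoticb_refl : reflexive asymptoticb.
Proof. by move=> c; apply/asboolP; exists 0 => t _; rewrite mdistxx. Qed.

Lemma asymptoticb_sym : symmetric asymptoticb.
Proof.
by move=> c c'; apply/asboolP/asboolP => -[K cK];
  exists K => t t0; rewrite metric_sym; exact: cK.
Qed.

Lemma asymptoticb_trans : transitive asymptoticb.
Proof.
move=> c2 c1 c3 /asboolP[K cK] /asboolP[L cL]; apply/asboolP.
exists (K + L) => t t0; apply: le_trans (metric_triangle _ (c2 t) _) _.
by rewrite lerD ?cK ?cL.
Qed.

Canonical asymptotic_equiv :=
  EquivRel asymptoticb asymptoticb_refl asymptoticb_sym asymptoticb_trans.

(* The points do not depend on x0; the base point only serves to define the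
   cone topology, which for a complete CAT(0) space does not depend on it. *)
Definition visual_boundary (x0 : X) : Type := {eq_quot asymptotic_equiv}.

HB.instance Definition _ (x0 : X) := Choice.copy (visual_boundary x0)
  {eq_quot asymptotic_equiv}.

Definition endpoint (x0 : X) (c : geodesic_ray X) : visual_boundary x0 :=
  \pi_{eq_quot asymptotic_equiv} c.

(* U(c, r, e), the boundary points whose ray from x0 is e-close to c at time r.
   In a CAT(0) space the U(c, r, e) form a base; they are taken as a subbase so
   that the topology makes sense for every metric space. *)
Definition cone_nbhd (x0 : X) (c : geodesic_ray X) (r e : R) :
    set (visual_boundary x0) :=
  [set endpoint x0 c' | c' in
    [set c' : geodesic_ray X | c' 0 = x0 /\ mdist (c r) (c' r) < e]].
Arguments cone_nbhd : clear implicits.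

Definition cone_subbase (x0 : X) : set (set (visual_boundary x0)) :=
  [set U | exists (c : geodesic_ray X) (r e : R),
    [/\ c 0 = x0, 0 < r, 0 < e & U = cone_nbhd x0 c r e]].
Arguments cone_subbase : clear implicits.

HB.instance Definition _ (x0 : X) :=
  isSubBaseTopological.Build (visual_boundary x0) (cone_subbase x0) id.

End Boundary.

Definition homeomorphic (T U : topologicalType) : Prop :=
  exists (f : T -> U) (g : U -> T),
    [/\ cancel f g, cancel g f, continuous f & continuous g].

Definition acts_geometrically (G : groupType) (X : metricType R) : Prop :=
  exists act : G -> X -> X, geometric_action act.

(* Rigidity is a property of groups that do act geometrically on some CAT(0)
   space, hence the first conjunct. *)
Definition rigid (G : groupType) : Prop :=
  (exists2 X : metricType R, cat0_space X & acts_geometrically G X) /\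
  (forall X1 X2 : metricType R,
     cat0_space X1 -> acts_geometrically G X1 ->
     cat0_space X2 -> acts_geometrically G X2 ->
     forall (x1 : X1) (x2 : X2),
       homeomorphic (visual_boundary x1) (visual_boundary x2)).

End CAT0.

Arguments cone_nbhd {R X} x0 c r e.
Arguments cone_subbase {R X} x0.

(* Main.v *)
(* The element [z = a ^ p = b ^ q] is central of infinite order. If [G] acts
   geometrically on a CAT(0) space [X], then [z] is a hyperbolic isometry, and the
   set [M] on which its displacement is minimal is convex and [G]-invariant; metrically
   [M] is a product [Y * R] on which [z] translates the factor [R]. Only the
   Pythagorean identity [d ^ 2 = rho ^ 2 + h ^ 2] is needed: the height difference
   [h] is a Busemann cocycle, and [rho] is, up to a bounded error, the distance in
   the quotient of [M] by [z]. A ray that starts in [M] stays in [M]. It has a slope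
   [s] in [-1, 1] and, if [`|s| < 1], its projection to [Y] follows a sequence of
   elements of [G / <z>], the free product [Z/p * Z/q], whose normal forms converge to an end [e].
   Bounded steps change normal forms boundedly, so every ray with end [e] passes
   close to the prefixes of [e]. Hence [(s, e)] determines the boundary point, every
   pair occurs, and closeness in the cone topology is closeness of the pairs. So all
   boundaries are the same suspension of the space of ends of [Z/p * Z/q].

   An action exists on the product of the Bass-Serre tree of [Z/p * Z/q] with a
   line; the tree is CAT(0) because its Gromov products are ultrametric. *)

Require Import Defs.
From HB Require Import structures.
From mathcomp Require Import all_boot all_order all_algebra.
From mathcomp Require Import all_classical all_reals all_analysis.
From mathcomp Require Import zify ring lra.

Set Implicit Arguments.
Unset Strict Implicit.
Unset Printing Implicit Defensive.

Import Order.TTheory GRing.Theory Num.Theory.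
Import numFieldNormedType.Exports.

Local Open Scope quotient_scope.
Local Open Scope classical_set_scope.
Local Open Scope ring_scope.

(** * A normal form modulo the centre *)

(** An equivariant quasi-isometry between two CAT(0) spaces need not extend to their boundaries, so
    no map from [X1] to [X2] is used. Each boundary is coded on its own by slopes and ends, and the
    valid codes are defined from the normal form alone; translation lengths and constants may differ
    between the spaces. A boundary point is sent to the point with the same code. The CAT(0)
    inequality is used only as Stewart's inequality between a point and a geodesic. It implies
    convexity by algebra, and it passes to products because it is additive in squared distances. *)

Section PresentedGroupAction.
Variables (A : choiceType) (rels : set (word A * word A)).

Lemma word_class_surj (g : presented_group rels) : exists u, g = word_class rels u.
Proof.
exists (repr (g : {eq_quot (word_equiv_rel rels)})).
by rewrite /word_class reprK.
Qed.

Variables (T : Type) (lact : A * bool -> T -> T) (inv : T -> Prop).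
Hypothesis lact_inv : forall x t, inv t -> inv (lact x t).
Hypothesis lactK : forall x t, inv t -> lact x (lact (inv_letter x) t) = t.
Let wact (u : word A) (t : T) := foldr lact t u.
Hypothesis wact_rels : forall l r, rels (l, r) ->
  forall t, inv t -> wact l t = wact r t.

Let wact_inv u t : inv t -> inv (wact u t).
Proof. by move=> it; elim: u => //= x u; exact: lact_inv. Qed.

Let wact_equiv u v : word_equiv rels u v ->
  forall t, inv t -> wact u t = wact v t.
Proof.
elim=> {u v} [//|u v _ h t it|v u w _ h1 _ h2 t it|u v x t it|u v l r lr t it].
- by rewrite h.
- by rewrite h1// h2.
- by rewrite /wact !foldr_cat /= lactK//; exact: wact_inv.
- rewrite /wact !foldr_cat -!/(wact _ _); congr (wact u _).
  by apply: wact_rels => //; exact: wact_inv.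
Qed.

(** The group laws are required on [inv] only, so a letter may act by a total function on lists that
    is invertible just on the reduced ones. *)
Definition group_act (g : presented_group rels) (t : T) : T :=
  foldr lact t (repr (g : {eq_quot (word_equiv_rel rels)})).

Lemma group_act_class u t : inv t ->
  group_act (word_class rels u) t = foldr lact t u.
Proof.
move=> it; apply: wact_equiv => //; apply/word_classP.
by rewrite /word_class reprK.
Qed.

Lemma group_act_inv g t : inv t -> inv (group_act g t).
Proof. exact: wact_inv. Qed.

Lemma group_act1 t : inv t -> group_act 1%g t = t.
Proof. by move=> it; rewrite -word_class_nil group_act_class. Qed.

Lemma group_actM g h t : inv t ->
  group_act (g * h)%g t = group_act g (group_act h t).
Proof.
have [u ->] := word_class_surj g; have [v ->] := word_class_surj h.
move=> it; rewrite -word_class_cat !group_act_class ?foldr_cat//.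
exact: wact_inv.
Qed.

End PresentedGroupAction.

Section StackGroup.
Variables (G : groupType) (S : Type) (z : G) (nf : G -> seq S).

(** The head of a list is the top of the stack; the entries kept here are those that right
    multiplications reach last. *)
Definition bot N (w : seq S) := drop (size w - N) w.

Definition zeq (g h : G) := exists m k : nat, (z ^+ m * g = z ^+ k * h)%g.

(* [G] is a tree of stacks up to the infinite cyclic central subgroup generated
   by [z]: right multiplication by a fixed element only changes boundedly many
   entries at the top of [nf g], and each entry can be popped by one of finitely
   many right multiplications. *)
Record stack_group : Prop := StackGroup {
  sg_central : forall g, (z * g = g * z)%g ;
  sg_infinite : forall n : nat, (z ^+ n.+1 != 1)%g ;
  sg_nf1 : nf 1%g = [::] ;
  sg_nfz : forall g, nf (z * g)%g = nf g ;
  sg_zeq : forall g h, nf g = nf h -> zeq g h ;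
  sg_bot : forall f, exists L, forall g N, (N + L <= size (nf g))%N ->
    bot N (nf (g * f)%g) = bot N (nf g) ;
  sg_pop : exists E : seq G, forall g x w, nf g = x :: w ->
    exists2 f, f \in E & nf (g * f)%g = w }.

End StackGroup.

(** * The action of the torus knot group on stacks of syllables *)

Section TorusKnotNormalForm.
Variables p q : nat.
Hypotheses (p_gt0 : (0 < p)%N) (q_gt0 : (0 < q)%N).

Local Notation G := (torus_knot_group p q).
Implicit Types (x y : bool) (i j k : nat) (w : seq (bool * nat)).

Definition gen_period x := if x then p else q.

Lemma gen_period_gt0 x : (0 < gen_period x)%N.
Proof. by case: x. Qed.

Definition starts x w := if w is (y, _) :: _ then y == x else false.

Fixpoint reduced w := if w is (x, i) :: w' then
  [&& (0 < i < gen_period x)%N, ~~ starts x w' & reduced w'] else true.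

Definition top_exp x w := if w is (y, i) :: _ then if y == x then i else 0%N else 0%N.

Definition untop x w := if w is (y, i) :: w' then if y == x then w' else w else w.

Definition addtop x i w := if i == 0%N then w else (x, i) :: w.

(** Left multiplication by the [k]-th power of the generator [x], modulo the centre: a syllable
    whose exponent becomes zero disappears. *)
Definition turn x k w := addtop x ((top_exp x w + k) %% gen_period x)%N (untop x w).

Lemma addtopK x w : addtop x (top_exp x w) (untop x w) = w \/ ~ reduced w.
Proof.
case: w => [|[y i] w] /=; first by left.
case: (y =P x) => [->|_]; last by left.
rewrite /addtop; case: eqP => [->|_]; last by left.
by right; rewrite ltnn.
Qed.

Lemma starts_untop x w : reduced w -> ~~ starts x (untop x w).
Proof.
case: w => [|[y i] w] //=; case: eqP => [->|]; last by move/eqP.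
by case/and3P.
Qed.

Lemma reduced_untop x w : reduced w -> reduced (untop x w).
Proof. by case: w => [|[y i] w] //=; case: eqP => // _ /and3P[]. Qed.

Lemma top_exp_lt x w : reduced w -> (top_exp x w < gen_period x)%N.
Proof.
case: w => [|[y i] w] //=; rewrite ?gen_period_gt0//.
by case: eqP => [->|_]; rewrite ?gen_period_gt0// => /and3P[/andP[]].
Qed.

Lemma top_exp_addtop x i w : ~~ starts x w -> top_exp x (addtop x i w) = i.
Proof.
rewrite /addtop; have [->|_] /= := eqVneq i 0%N; last by rewrite eqxx.
by case: w => [|[y j] w] //= /negbTE ->.
Qed.

Lemma untop_addtop x i w : ~~ starts x w -> untop x (addtop x i w) = w.
Proof.
rewrite /addtop; have [_|_] /= := eqVneq i 0%N; last by rewrite eqxx.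
by case: w => [|[y j] w] //= /negbTE ->.
Qed.

Lemma top_exp_turn x k w : reduced w ->
  top_exp x (turn x k w) = ((top_exp x w + k) %% gen_period x)%N.
Proof. by move=> rw; rewrite top_exp_addtop// starts_untop. Qed.

Lemma untop_turn x k w : reduced w -> untop x (turn x k w) = untop x w.
Proof. by move=> rw; rewrite untop_addtop// starts_untop. Qed.

Lemma reduced_turn x k w : reduced w -> reduced (turn x k w).
Proof.
move=> rw; rewrite /turn /addtop; case: eqP => [_|/eqP].
  exact: reduced_untop.
rewrite -lt0n => h /=; rewrite h starts_untop// reduced_untop// ltn_mod.
by rewrite gen_period_gt0.
Qed.

Lemma turnD x k l w : reduced w -> turn x k (turn x l w) = turn x (k + l) w.
Proof.
move=> rw; rewrite {1}/turn top_exp_turn// untop_turn// /turn modnDml.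
by congr (addtop _ (_ %% _) _); rewrite addnAC addnA.
Qed.

Lemma turn_period x w : reduced w -> turn x (gen_period x) w = w.
Proof.
move=> rw; rewrite /turn modnDr modn_small ?top_exp_lt//.
by have [|/(_ rw)] := addtopK x w.
Qed.

Lemma turn0 x w : reduced w -> turn x 0 w = w.
Proof.
by move=> rw; rewrite -[RHS](turn_period x)// /turn addn0 modnDr.
Qed.

(** Modulo the centre an inverse generator is a positive power, so exponents remain natural
    numbers. *)
Definition letter_act (l : bool * bool) w :=
  turn l.1 (if l.2 then (gen_period l.1).-1 else 1%N) w.

Let letter_act_reduced l w : reduced w -> reduced (letter_act l w).
Proof. exact: reduced_turn. Qed.

Let letter_actK l w : reduced w -> letter_act l (letter_act (inv_letter l) w) = w.
Proof.
move=> rw; rewrite /letter_act turnD// -[RHS](turn_period l.1)//.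
congr turn; have := gen_period_gt0 l.1.
by rewrite /inv_letter /=; case: l.2 => /=; lia.
Qed.

Let foldr_nseq x k w : reduced w ->
  foldr letter_act w (nseq k (x, false)) = turn x k w.
Proof.
move=> rw; elim: k => [|k IHk]; first by rewrite turn0.
by rewrite /= IHk /letter_act/= turnD// add1n.
Qed.

(** Both words act as full turns, hence trivially; so stacks see the group only modulo the
    centre. *)
Let letter_act_rels l r : torus_knot_rels p q (l, r) ->
  forall w, reduced w -> foldr letter_act w l = foldr letter_act w r.
Proof.
by case=> -> -> w rw; rewrite !foldr_nseq// !(@turn_period true, @turn_period false).
Qed.

Definition stack_act (g : G) w : seq (bool * nat) := group_act letter_act g w.

Lemma stack_act_class u w : reduced w ->
  stack_act (word_class _ u) w = foldr letter_act w u.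
Proof. exact: (group_act_class letter_act_reduced letter_actK). Qed.

Lemma stack_act_reduced g w : reduced w -> reduced (stack_act g w).
Proof. exact: (group_act_inv letter_act_reduced). Qed.

Lemma stack_act1 w : reduced w -> stack_act 1%g w = w.
Proof. exact: (group_act1 letter_act_reduced letter_actK). Qed.

Lemma stack_actM g h w : reduced w ->
  stack_act (g * h)%g w = stack_act g (stack_act h w).
Proof. exact: (group_actM letter_act_reduced letter_actK). Qed.

Definition gen x : G := word_class (torus_knot_rels p q) [:: (x, false)].

Lemma word_class_nseq x k :
  word_class (torus_knot_rels p q) (nseq k (x, false)) = (gen x ^+ k)%g.
Proof.
by elim: k => //= k IHk; rewrite -cat1s word_class_cat IHk -expgS.
Qed.

Lemma stack_act_gen x k w : reduced w -> stack_act (gen x ^+ k)%g w = turn x k w.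
Proof. by move=> rw; rewrite -word_class_nseq stack_act_class// foldr_nseq. Qed.

Definition knot_center : G := (gen true ^+ p)%g.

Lemma gen_center x : (gen x ^+ gen_period x)%g = knot_center.
Proof.
case: x => //; rewrite /knot_center -!word_class_nseq; apply/word_classP.
have := @WordRel _ (torus_knot_rels p q) [::] [::] (nseq p (true,
  false)) (nseq q (false, false)).
by rewrite /= !cats0 => h; apply: WordSym; apply: h.
Qed.

Lemma knot_ind (P : G -> Prop) : P 1%g ->
  (forall x g, P g -> P (gen x * g)%g) -> (forall x g, P g -> P ((gen x)^-1 * g)%g) ->
  forall g, P g.
Proof.
move=> P1 Pg PV g; have [u ->] := word_class_surj g.
elim: u => [//|[x b] u IHu]; rewrite -cat1s word_class_cat; case: b; last exact: Pg.
have -> : word_class (torus_knot_rels p q) [:: (x, true)] = ((gen x)^-1)%g.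
  by rewrite -word_class_inv.
exact: PV.
Qed.

Lemma knot_center_central g : (knot_center * g = g * knot_center)%g.
Proof.
have com x : commute knot_center (gen x).
  by rewrite -(gen_center x); exact/commute_sym/commuteX.
elim/knot_ind: g => [|x g IHg|x g IHg]; first by rewrite mulg1 mul1g.
  by rewrite mulgA com -!mulgA IHg.
by rewrite mulgA (commuteV (com x)) -!mulgA IHg.
Qed.

Lemma stack_act_center w : reduced w -> stack_act knot_center w = w.
Proof. by move=> rw; rewrite -(gen_center true) stack_act_gen// turn_period. Qed.

Local Notation zeq := (zeq knot_center).

Lemma zeq_refl g : zeq g g.
Proof. by exists 0%N, 0%N. Qed.

Lemma zeq_sym g h : zeq g h -> zeq h g.
Proof. by move=> [m [k e]]; exists k, m. Qed.

Lemma zeq_trans g h f : zeq g h -> zeq h f -> zeq g f.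
Proof.
move=> [m [k e]] [m' [k' e']]; exists (m' + m)%N, (k + k')%N.
by rewrite !expgnDr -!mulgA e -e' !mulgA -!expgnDr addnC.
Qed.

Let comX n g : commute (knot_center ^+ n)%g g.
Proof. apply/commute_sym/commuteX/commute_sym; exact: knot_center_central. Qed.

Lemma zeq_mull f g h : zeq g h -> zeq (f * g)%g (f * h)%g.
Proof.
move=> [m [k e]]; exists m, k.
by rewrite !mulgA !(comX _ f) -!mulgA e.
Qed.

Lemma zeq_mulr f g h : zeq g h -> zeq (g * f)%g (h * f)%g.
Proof. by move=> [m [k e]]; exists m, k; rewrite mulgA e -mulgA. Qed.

Lemma zeq_center k g : zeq (knot_center ^+ k * g)%g g.
Proof. by exists 0%N, k; rewrite mul1g. Qed.

Fixpoint stack_eval w : G :=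
  if w is (x, i) :: w' then (gen x ^+ i * stack_eval w')%g else 1%g.

Lemma stack_eval_addtop x i w : stack_eval (addtop x i w) = (gen x ^+ i * stack_eval w)%g.
Proof. by rewrite /addtop; case: eqP => // ->; rewrite mul1g. Qed.

Lemma stack_eval_untop x w :
  stack_eval w = (gen x ^+ top_exp x w * stack_eval (untop x w))%g.
Proof.
case: w => [|[y i] w] /=; first by rewrite mulg1.
by case: eqP => [->//|_]; rewrite mul1g.
Qed.

Lemma zeq_turn x k w : zeq (gen x ^+ k * stack_eval w)%g (stack_eval (turn x k w)).
Proof.
rewrite /turn stack_eval_addtop (stack_eval_untop x w) mulgA -expgnDr.
rewrite addnC {1}(divn_eq (top_exp x w + k) (gen_period x)) expgnDr.
rewrite mulnC expgnA gen_center -mulgA; exact: zeq_center.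
Qed.

(** This makes the stack a complete invariant modulo the centre. In the induction an inverse
    generator is replaced by a positive power. *)
Lemma zeq_stack_act g : zeq g (stack_eval (stack_act g [::])).
Proof.
elim/knot_ind: g => [|x g IHg|x g IHg]; first by rewrite stack_act1//; exact: zeq_refl.
  rewrite stack_actM// -[gen x]expg1 stack_act_gen; last exact: stack_act_reduced.
  by apply: zeq_trans (zeq_turn _ _ _); exact: zeq_mull.
have e : zeq ((gen x)^-1)%g (gen x ^+ (gen_period x).-1)%g.
  exists 1%N, 0%N; rewrite expg0 mul1g expg1 -(gen_center x).
  by rewrite -{1}(prednK (gen_period_gt0 x)) expgSr -mulgA mulgV mulg1.
have -> : stack_act ((gen x)^-1 * g)%g [::] = turn x (gen_period x).-1 (stack_act g [::]).
  have rg : reduced (stack_act g [::]) by exact: stack_act_reduced.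
  rewrite stack_actM// -{1}(turn_period x rg) -{1}(prednK (gen_period_gt0 x)).
  rewrite -add1n -turnD// -stack_act_gen ?reduced_turn// -stack_actM ?reduced_turn//.
  by rewrite mulVg stack_act1 ?reduced_turn.
apply: zeq_trans (zeq_turn _ _ _).
exact: zeq_trans (zeq_mulr _ e) (zeq_mull _ IHg).
Qed.

Lemma stack_act_eval w : reduced w -> stack_act (stack_eval w) [::] = w.
Proof.
elim: w => [|[x i] w IHw] /=; first by rewrite stack_act1.
move=> /and3P[/andP[i0 ix] sw rw].
rewrite stack_actM// IHw// stack_act_gen// /turn /addtop.
have -> : top_exp x w = 0%N by case: w sw {IHw rw} => [|[y j] w] //= /negbTE ->.
have -> : untop x w = w by case: w sw {IHw rw} => [|[y j] w] //= /negbTE ->.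
by rewrite add0n modn_small// -[_ == 0%N]negbK -lt0n i0.
Qed.

(** Weights of the homomorphism to the integers with [a] sent to [q] and [b] to [p], so that both
    sides of the relation have height [p * q]. It shows that the centre is infinite and later
    translates the line factor. *)
Definition letter_height (l : bool * bool) : int :=
  let n := gen_period (~~ l.1) in if l.2 then - n%:Z else n%:Z.

Let height_act (l : bool * bool) (n : int) : int := letter_height l + n.

Let height_actK l n : True -> height_act l (height_act (inv_letter l) n) = n.
Proof.
move=> _; rewrite /height_act addrA /letter_height /inv_letter/=.
by case: l.2; rewrite /= ?addNr ?subrr add0r.
Qed.

Let foldr_height u n : foldr height_act n u = foldr height_act 0 u + n.
Proof. by elim: u => [|l u IHu] /=; rewrite ?add0r// IHu /height_act addrA. Qed.

Let height_nseq x k : foldr height_act 0 (nseq k (x, false)) = (k * gen_period (~~ x))%:Z.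
Proof. by elim: k => //= k ->; rewrite mulSn PoszD. Qed.

Definition height (g : G) : int := group_act height_act g 0.

Let height_rels l r : torus_knot_rels p q (l, r) ->
  forall n, True -> foldr height_act n l = foldr height_act n r.
Proof.
case=> -> -> n _; rewrite [LHS]foldr_height [RHS]foldr_height; congr (_ + _).
by rewrite !height_nseq /= mulnC.
Qed.

Let height_class u : height (word_class _ u) = foldr height_act 0 u.
Proof.
exact: (@group_act_class _ _ _ height_act (fun=> True) (fun _ _ _ => I) height_actK
  height_rels u 0 I).
Qed.

Lemma heightM g h : height (g * h)%g = height g + height h.
Proof.
have [u ->] := word_class_surj g; have [v ->] := word_class_surj h.
by rewrite -word_class_cat !height_class foldr_cat foldr_height.
Qed.

Lemma height_center : height knot_center = (p * q)%:Z.
Proof. by rewrite /knot_center -word_class_nseq height_class height_nseq. Qed.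

Lemma height1 : height 1%g = 0.
Proof. by apply: (addrI (height 1%g)); rewrite -heightM mulg1 addr0. Qed.

Lemma heightX g n : height (g ^+ n)%g = height g *+ n.
Proof. by elim: n => [|n IHn]; rewrite ?height1// expgS heightM IHn mulrS. Qed.

Lemma knot_center_infinite n : (knot_center ^+ n.+1 != 1)%g.
Proof.
apply/eqP => /(congr1 height); rewrite heightX height_center height1.
by move/eqP; rewrite mulrn_eq0 /= eqz_nat muln_eq0; move: p_gt0 q_gt0; lia.
Qed.

(* The inverse turns the left action on stacks into a normal form that reacts to
   right multiplications by a change of its top. *)
Definition knot_nf (g : G) := stack_act (g^-1)%g [::].

Lemma bot_turn x k w N : (N < size w)%N -> bot N (turn x k w) = bot N w.
Proof.
case: w => [|[y i] w] //; rewrite ltnS => Nw.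
rewrite /bot [RHS]/= subSn//= /turn /=.
case: eqP => _; rewrite /addtop; case: ifP => _ //=; rewrite ?subSn//=.
by rewrite (leq_trans Nw).
Qed.

Lemma size_turn x k w : (size w <= (size (turn x k w)).+1)%N.
Proof.
case: w => [|[y i] w] //=; rewrite /turn /=.
by case: eqP => _; rewrite /addtop; case: ifP => _ //=; lia.
Qed.

Lemma knot_stack_group : stack_group knot_center knot_nf.
Proof.
split.
- exact: knot_center_central.
- exact: knot_center_infinite.
- by rewrite /knot_nf invg1 stack_act1.
- move=> g; rewrite /knot_nf invgM stack_actM//; congr (stack_act _ _).
  by rewrite -{1}(@stack_act_center [::])// -stack_actM// mulVg stack_act1.
- move=> g h e; have {e} : zeq (g^-1)%g (h^-1)%g.
    by apply: zeq_trans (zeq_stack_act _) (zeq_sym _); rewrite -/(knot_nf g) e;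
      exact: zeq_stack_act.
  move=> /(zeq_mull g)/(zeq_mulr h); rewrite mulgV mul1g -mulgA mulVg mulg1.
  exact: zeq_sym.
(* Each letter of a word for the inverse of [f] disturbs one entry at the top, so its length serves
   as [L]. The size bound carried along leaves enough entries for the next letter. *)
- move=> f; have [u fu] := word_class_surj (f^-1)%g.
  exists (size u) => g N; rewrite /knot_nf invgM stack_actM// fu.
  move: (stack_act _ _) (stack_act_reduced g^-1%g (isT : reduced [::])) => w rw.
  rewrite stack_act_class//.
  suff : (N + size u <= size w)%N ->
    bot N (foldr letter_act w u) = bot N w /\
      (size w <= size (foldr letter_act w u) + size u)%N.
    by move=> h Nu; have [] := h Nu.
  elim: u {fu} => [|l u IHu] /=; first by rewrite !addn0.
  rewrite addnS => h; have [e1 e2] := IHu (ltnW h); split.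
    rewrite /letter_act bot_turn ?e1//.
    by rewrite -(ltn_add2r (size u)); apply: leq_trans e2.
  apply: (leq_trans e2); rewrite addnS -addSn leq_add2r; exact: size_turn.
(* Completing the top exponent to a full period deletes the syllable; the inverse occurs because
   [knot_nf] inverts its argument. *)
- exists [seq ((gen x ^+ k)^-1)%g | x <- [:: true; false], k <- iota 0 (p + q)].
  move=> g [x i] w e.
  have /and3P[/andP[i0 ix] sw rw] : reduced ((x, i) :: w) by rewrite -e stack_act_reduced.
  exists ((gen x ^+ (gen_period x - i))^-1)%g.
    apply/allpairsP; exists (x, (gen_period x - i)%N); split => //=.
      by case: (x); rewrite !inE.
    rewrite mem_iota /= add0n; case: (x) ix i0 => /=; move: p_gt0 q_gt0; lia.
  rewrite /knot_nf invgM invgK stack_actM// -/(knot_nf g) e stack_act_gen; last first.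
    by rewrite -e stack_act_reduced.
  by rewrite /turn /= eqxx /= subnKC ?modnn// ltnW.
Qed.

End TorusKnotNormalForm.

(** * CAT(0) spaces and Stewart's inequality *)

Section RealFacts.
Variable R : realType.
Implicit Types (x y : R).

Lemma sqr_le x y : 0 <= y -> x ^+ 2 <= y ^+ 2 -> x <= y.
Proof.
move=> y0 xy; rewrite leNgt; apply/negP => yx.
suff : y ^+ 2 < x ^+ 2 by rewrite ltNge xy.
by rewrite ltrXn2r// (le_trans y0)// ltW.
Qed.

Lemma sqr_inj x y : 0 <= x -> 0 <= y -> x ^+ 2 = y ^+ 2 -> x = y.
Proof. by move=> x0 y0 /eqP; rewrite eqrXn2// => /eqP. Qed.

Lemma nat_above x : exists N : nat, forall n, (N <= n)%N -> x < n%:R.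
Proof.
exists (Num.truncn x).+1 => n xn; apply: lt_le_trans (truncnS_gt x) _.
by rewrite ler_nat.
Qed.

End RealFacts.

Section Lipschitz.
Variables (R : realType) (X : metricType R).

Lemma lipschitz_continuous (phi : X -> R) (k : R) :
  (forall x y : X, `|phi x - phi y| <= k * mdist x y) -> continuous phi.
Proof.
move=> h x; apply/cvgrPdist_lt => e e0.
apply/metricType_numDomainType.nbhs_mdistP.
have k0 : 0 < `|k| + 1 by rewrite ltr_pwDr.
exists (e / (`|k| + 1)) => /= [|y /= hy]; first by rewrite divr_gt0.
move: hy; rewrite ltr_pdivlMr// => hy; apply: le_lt_trans hy.
apply: (le_trans (h x y)); rewrite mulrC ler_wpM2l ?mdist_ge0//.
by have := ler_norm k; lra.
Qed.

End Lipschitz.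

(** * Stewart's identity and comparison triangles in the plane *)

Section PlaneStewart.
Variable R : realType.
Implicit Types (u v p : R * R) (s t : R).

Lemma plane_dist_sqr u v :
  plane_dist u v ^+ 2 = (u.1 - v.1) ^+ 2 + (u.2 - v.2) ^+ 2.
Proof. by rewrite sqr_sqrtr// addr_ge0// sqr_ge0. Qed.

Lemma plane_dist_ge0 u v : 0 <= plane_dist u v.
Proof. exact: sqrtr_ge0. Qed.

Lemma plane_distC u v : plane_dist u v = plane_dist v u.
Proof. by rewrite /plane_dist -(sqrrN (u.1 - _)) -(sqrrN (u.2 - _)) !opprB. Qed.

Definition plane_pt u v s : R * R :=
  (u.1 + s * (v.1 - u.1), u.2 + s * (v.2 - u.2)).

Lemma plane_pt0 u v : plane_pt u v 0 = u.
Proof. by rewrite /plane_pt !mul0r !addr0 -surjective_pairing. Qed.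

Lemma plane_stewart p u v s : plane_dist p (plane_pt u v s) ^+ 2 =
  (1 - s) * plane_dist p u ^+ 2 + s * plane_dist p v ^+ 2
  - s * (1 - s) * plane_dist u v ^+ 2.
Proof. by rewrite !plane_dist_sqr /=; ring. Qed.

Lemma plane_dist_pt u v s t :
  plane_dist (plane_pt u v s) (plane_pt u v t) = `|s - t| * plane_dist u v.
Proof.
apply: sqr_inj; rewrite ?mulr_ge0 ?plane_dist_ge0//.
rewrite exprMn real_normK ?num_real// !plane_dist_sqr /=; ring.
Qed.

Lemma plane_dist_eq0 u v : plane_dist u v = 0 -> u = v.
Proof.
move=> /(congr1 (fun a => a ^+ 2)); rewrite plane_dist_sqr expr0n/=.
case: u v => [u1 u2] [v1 v2] /= /eqP.
rewrite paddr_eq0 ?sqr_ge0// !sqrf_eq0 !subr_eq0 => /andP[/eqP -> /eqP ->//].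
Qed.

Lemma plane_segment u v : geodesic_segment (@plane_dist R) u v
  (fun t => plane_pt u v (t / plane_dist u v)).
Proof.
have [e|l0] := eqVneq (plane_dist u v) 0.
  have -> := plane_dist_eq0 e; have d0 (w : R * R) : plane_dist w w = 0.
    by apply: sqr_inj; rewrite ?lexx ?plane_dist_ge0// plane_dist_sqr; ring.
  rewrite /geodesic_segment !d0; split.
  - by rewrite /plane_pt invr0 !mulr0 !mul0r !addr0 -surjective_pairing.
  - by rewrite /plane_pt invr0 !mulr0 !mul0r !addr0 -surjective_pairing.
  - move=> s t; rewrite -!eq_le => /eqP <- /eqP <-.
    by rewrite plane_dist_pt subrr subrr normr0 mul0r.
split.
- by rewrite /plane_pt !mul0r !addr0 -surjective_pairing.
- by rewrite /plane_pt divff// !mul1r !subrKC -surjective_pairing.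
- move=> s t _ _; rewrite plane_dist_pt -mulrBl normrM normfV.
  by rewrite [`|plane_dist u v|]ger0_norm ?plane_dist_ge0// mulfVK.
Qed.

Lemma plane_segment_unique u v (c : R -> R * R) t :
  geodesic_segment (@plane_dist R) u v c -> 0 <= t <= plane_dist u v ->
  c t = plane_pt u v (t / plane_dist u v).
Proof.
move=> [c0 c1 cd] tl; apply: plane_dist_eq0; apply: sqr_inj => //.
  exact: plane_dist_ge0.
have l0 := plane_dist_ge0 u v.
have /andP[t0 t1] := tl.
have hu : plane_dist (c t) u = t by rewrite -{1}c0 cd ?lexx ?l0// subr0 ger0_norm.
have hv : plane_dist (c t) v = plane_dist u v - t.
  by rewrite -{1}c1 cd ?lexx ?l0// distrC ger0_norm// subr_ge0.
rewrite plane_stewart hu hv expr0n/=.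
have [e|ln0] := eqVneq (plane_dist u v) 0.
  have -> : t = 0 by apply/eqP; rewrite eq_le t0 andbT -e.
  by rewrite e; ring.
by field.
Qed.

Lemma comparison_point (l a b : R) : 0 <= l -> 0 <= a -> 0 <= b ->
  l <= a + b -> a <= l + b -> b <= l + a ->
  exists u : R * R, plane_dist (0, 0) u = a /\ plane_dist (l, 0) u = b.
Proof.
move=> l0 a0 b0 lab alb bla.
have [e|ln0] := eqVneq l 0.
  exists (a, 0); split; apply: sqr_inj; rewrite ?plane_dist_ge0// plane_dist_sqr/=.
    by ring.
  have -> : a = b by lra.
  by rewrite e; ring.
have lp : 0 < l by rewrite lt_neqAle eq_sym ln0.
(* The abscissa comes from the law of cosines; the square of the ordinate is nonnegative by the
   factorization in Heron's formula. *)
pose u1 := (a ^+ 2 + l ^+ 2 - b ^+ 2) / (2 * l).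
have u1E : u1 * (2 * l) = a ^+ 2 + l ^+ 2 - b ^+ 2.
  by rewrite mulfVK// mulf_neq0// pnatr_eq0.
have h : 0 <= a ^+ 2 - u1 ^+ 2.
  suff : 0 <= (a ^+ 2 - u1 ^+ 2) * (2 * l) ^+ 2.
    by rewrite pmulr_lge0// exprn_gt0// mulr_gt0.
  rewrite mulrBl -[u1 ^+ 2 * _]exprMn u1E.
  have -> : a ^+ 2 * (2 * l) ^+ 2 - (a ^+ 2 + l ^+ 2 - b ^+ 2) ^+ 2 =
     ((l + a) - b) * (b + (l + a)) * (b - (a - l)) * (b - (l - a)) by ring.
  by rewrite !mulr_ge0//; lra.
exists (u1, Num.sqrt (a ^+ 2 - u1 ^+ 2)).
split; apply: sqr_inj;
  rewrite ?plane_dist_ge0// plane_dist_sqr/= !sub0r !sqrrN sqr_sqrtr//.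
  by rewrite subrKC.
have -> : (l - u1) ^+ 2 + (a ^+ 2 - u1 ^+ 2) = l ^+ 2 - u1 * (2 * l) + a ^+ 2 by ring.
by rewrite u1E; ring.
Qed.

End PlaneStewart.

Section Stewart.
Variables (R : realType) (X : metricType R).
Implicit Types (x y m p : X) (s t : R).

(* [m] divides the segment from [x] to [y] in the ratio [s : 1 - s], with the
   CAT(0) form of Stewart's theorem for all triangles over that segment. *)
Definition stewart_point m x y s := forall p, mdist p m ^+ 2 <=
  (1 - s) * mdist p x ^+ 2 + s * mdist p y ^+ 2 - s * (1 - s) * mdist x y ^+ 2.

Definition stewart_space :=
  forall x y s, 0 <= s <= 1 -> exists m, stewart_point m x y s.

Definition side3 T (a b c : T) (i : 'I_3) : T :=
  if val i == 0%N then a else if val i == 1%N then b else c.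

(** The comparison is made between a point of the side from [x] to [y] and the opposite vertex [p],
    taken as the point at time 0 of the side from [p] to [x]. *)
Lemma cat0_stewart x y (c : R -> X) s : geodesic_space X -> cat0_inequality X ->
  geodesic_segment mdist x y c -> 0 <= s <= 1 ->
  stewart_point (c (s * mdist x y)) x y s.
Proof.
move=> geo cat xyc s01 p.
have [cy ycp] := geo y p; have [cp pcx] := geo p x.
have dxy := mdist_ge0 x y; have dyp := mdist_ge0 y p; have dpx := mdist_ge0 p x.
have sx := metric_sym x p; have sy := metric_sym y p.
have [||| u [u0 u1]] :=
  @comparison_point R (mdist x y) (mdist p x) (mdist y p) dxy dpx dyp.
- by have := metric_triangle x p y; lra.
- by have := metric_triangle x y p; lra.
- by have := metric_triangle y x p; have := metric_sym x y; lra.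
pose v := side3 x y p; pose cc := side3 c cy cp.
pose v' := side3 (0, 0) (mdist x y, 0) u.
pose cc' i t := plane_pt (v' i) (v' (ordS i)) (t / plane_dist (v' i) (v' (ordS i))).
have tri : geodesic_triangle mdist v cc.
  by case=> [[|[|[|//]]] ilt].
have tri' : geodesic_triangle (@plane_dist R) v' cc'.
  move=> i; exact: plane_segment.
have d01 : plane_dist (0, 0) (mdist x y, 0) = mdist x y.
  by apply: sqr_inj; rewrite ?plane_dist_ge0// plane_dist_sqr/=; ring.
have dd i : plane_dist (v' i) (v' (ordS i)) = mdist (v i) (v (ordS i)).
  by case: i => [[|[|[|//]]] ilt] //; rewrite /v' /v /side3 /= ?u1// plane_distC u0.
have i0 : (0 < 3)%N by []. have i2 : (2 < 3)%N by [].
have := cat v cc v' cc' tri tri' dd (Ordinal i0) (Ordinal i2) (s * mdist x y) 0.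
rewrite /v /v' /cc /cc' /side3 /= d01 mul0r.
have -> : cp 0 = p by case: pcx.
have sl : 0 <= s * mdist x y <= mdist x y.
  by move: s01 => /andP[s0 s1]; rewrite mulr_ge0// ler_piMl.
move=> /(_ sl); rewrite lexx dpx => /(_ isT) h.
rewrite metric_sym; apply: (le_trans (y :=
  plane_dist u (plane_pt (0, 0) (mdist x y, 0) s) ^+ 2)).
  rewrite ler_pXn2r ?nnegrE ?mdist_ge0 ?plane_dist_ge0//.
  apply: (le_trans h); rewrite plane_pt0 plane_distC /v' /side3 /=.
  have [->|l0] := eqVneq (mdist x y) 0; first by rewrite /plane_pt !(subrr, mulr0).
  by rewrite mulfK.
by rewrite plane_stewart ![plane_dist u _]plane_distC u0 u1 [mdist y p]metric_sym d01.
Qed.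

Lemma geodesic_stewart : geodesic_space X -> cat0_inequality X -> stewart_space.
Proof.
move=> geo cat x y s s01; have [c xyc] := geo x y.
by exists (c (s * mdist x y)); exact: cat0_stewart.
Qed.

End Stewart.

(** * Geodesics and convexity from Stewart's inequality *)

Section StewartSpace.
Variables (R : realType) (X : metricType R).
Implicit Types (x y m p : X) (s t : R).

Definition geo_pt x y s : X := xget x [set m | stewart_point m x y s].

Hypothesis stX : stewart_space X.

Let d0 x y : 0 <= mdist x y.
Proof. exact: mdist_ge0. Qed.
Hint Resolve d0 : core.

Lemma geo_ptP x y s : 0 <= s <= 1 -> stewart_point (geo_pt x y s) x y s.
Proof. by move=> s01; apply: (@xgetPex _ x [set m | stewart_point m x y s]);
  exact: stX. Qed.

Lemma stewart_distl m x y s : 0 <= s <= 1 -> stewart_point m x y s ->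
  mdist x m <= s * mdist x y.
Proof.
move=> /andP[s0 s1] /(_ x); rewrite mdistxx => h.
by apply: sqr_le; [exact: mulr_ge0|nra].
Qed.

Lemma stewart_distr m x y s : 0 <= s <= 1 -> stewart_point m x y s ->
  mdist m y <= (1 - s) * mdist x y.
Proof.
move=> /andP[s0 s1] /(_ y);
  rewrite mdistxx [mdist y x]metric_sym [mdist y m]metric_sym => h.
by apply: sqr_le; [rewrite mulr_ge0// subr_ge0|nra].
Qed.

Lemma geo_pt_distl x y s : 0 <= s <= 1 -> mdist x (geo_pt x y s) = s * mdist x y.
Proof.
move=> s01; apply/eqP; rewrite eq_le (stewart_distl s01 (geo_ptP x y s01))/=.
have := stewart_distr s01 (geo_ptP x y s01).
have := metric_triangle x (geo_pt x y s) y; lra.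
Qed.

Lemma geo_pt_distr x y s : 0 <= s <= 1 -> mdist (geo_pt x y s) y = (1 - s) * mdist x y.
Proof.
move=> s01; apply/eqP; rewrite eq_le (stewart_distr s01 (geo_ptP x y s01))/=.
have := stewart_distl s01 (geo_ptP x y s01).
have := metric_triangle x (geo_pt x y s) y; lra.
Qed.

(** In Stewart's inequality for [geo_pt x y s], read at [m], the two bounds make the right-hand side
    nonpositive. *)
Lemma geo_pt_unique m x y s : 0 <= s <= 1 ->
  mdist x m <= s * mdist x y -> mdist m y <= (1 - s) * mdist x y ->
  m = geo_pt x y s.
Proof.
move=> s01 hx hy; have /andP[s0 s1] := s01.
apply: mdist_positivity; apply: sqr_inj; rewrite ?lexx//.
apply/eqP; rewrite expr0n/= eq_le sqr_ge0 andbT.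
apply: (le_trans (geo_ptP x y s01 m)); rewrite [mdist m x]metric_sym.
have e1 : mdist x m ^+ 2 <= (s * mdist x y) ^+ 2.
  by rewrite ler_pXn2r ?nnegrE// mulr_ge0.
have e2 : mdist m y ^+ 2 <= ((1 - s) * mdist x y) ^+ 2.
  by rewrite ler_pXn2r ?nnegrE// mulr_ge0// subr_ge0.
have h1 : (1 - s) * mdist x m ^+ 2 <= (1 - s) * (s * mdist x y) ^+ 2.
  by rewrite ler_wpM2l// subr_ge0.
have h2 : s * mdist m y ^+ 2 <= s * ((1 - s) * mdist x y) ^+ 2.
  by rewrite ler_wpM2l.
nra.
Qed.

Lemma geo_pt0 x y : geo_pt x y 0 = x.
Proof.
by apply/esym/geo_pt_unique; rewrite ?lexx ?ler01// ?mdistxx ?mul0r ?subr0 ?mul1r.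
Qed.

Lemma geo_pt1 x y : geo_pt x y 1 = y.
Proof.
by apply/esym/geo_pt_unique; rewrite ?lexx ?ler01// ?mdistxx ?subrr ?mul0r ?mul1r.
Qed.

Lemma geo_pt_sym x y s : 0 <= s <= 1 -> geo_pt x y s = geo_pt y x (1 - s).
Proof.
move=> s01; have s01' : 0 <= 1 - s <= 1 by lra.
apply: geo_pt_unique => //.
  by rewrite metric_sym geo_pt_distr// [mdist y x]metric_sym.
by rewrite metric_sym geo_pt_distl// [mdist y x]metric_sym subKr.
Qed.

(** Stewart's inequality is used from [geo_pt x y s] to the segment [x y'] and from [y'] to the
    segment [x y]; the squared lengths of both segments cancel. *)
Lemma geo_pt_fan x y y' s : 0 <= s <= 1 ->
  mdist (geo_pt x y s) (geo_pt x y' s) <= s * mdist y y'.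
Proof.
move=> s01; have /andP[s0 s1] := s01.
apply: sqr_le; first exact: mulr_ge0.
have h1 := geo_ptP x y' s01 (geo_pt x y s).
have h2 := geo_ptP x y s01 y'.
rewrite [mdist (geo_pt x y s) x]metric_sym geo_pt_distl// in h1.
rewrite [mdist y' (geo_pt x y s)]metric_sym [mdist y' x]metric_sym [mdist y' y]metric_sym in h2.
have h3 := ler_wpM2l s0 h2.
apply: (le_trans h1); nra.
Qed.

Lemma geo_pt_convex x x' y y' s : 0 <= s <= 1 ->
  mdist (geo_pt x y s) (geo_pt x' y' s) <= (1 - s) * mdist x x' + s * mdist y y'.
Proof.
move=> s01; have s01' : 0 <= 1 - s <= 1 by lra.
have h1 := geo_pt_fan x y y' s01.
have h2 := geo_pt_fan y' x x' s01'.
rewrite [geo_pt y' x _]geo_pt_sym// [geo_pt y' x' _]geo_pt_sym// subKr in h2.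
have := metric_triangle (geo_pt x y s) (geo_pt x y' s) (geo_pt x' y' s).
by lra.
Qed.

Lemma geo_pt_pt x y s t : 0 <= s <= 1 -> 0 <= t <= 1 ->
  geo_pt x (geo_pt x y s) t = geo_pt x y (s * t).
Proof.
move=> s01 t01; have /andP[s0 s1] := s01; have /andP[t0 t1] := t01.
have st01 : 0 <= s * t <= 1 by rewrite mulr_ge0// mulr_ile1.
apply: geo_pt_unique => //; first by rewrite !geo_pt_distl// mulrCA mulrA.
apply: (le_trans (metric_triangle _ (geo_pt x y s) _)).
by rewrite !geo_pt_distr// geo_pt_distl//; lra.
Qed.

Lemma midpoint_ineq p m x y l : mdist x m = l -> mdist m y = l -> mdist x y = 2 * l ->
  mdist p m ^+ 2 <= (mdist p x ^+ 2 + mdist p y ^+ 2) / 2 - l ^+ 2.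
Proof.
move=> xm my xy; have h01 : 0 <= (2^-1 : R) <= 1 by lra.
have -> : m = geo_pt x y 2^-1.
  by apply: geo_pt_unique => //; rewrite ?xm ?my xy; lra.
apply: (le_trans (geo_ptP x y h01 p)); rewrite xy; lra.
Qed.

(** Medians from [x2] and [x4] to the midpoint of [x1 x3] bound the other diagonal, with
    [(a + b) ^ 2 <= 2 * a ^ 2 + 2 * b ^ 2]. *)
Lemma quadrilateral_ineq x1 x2 x3 x4 : mdist x1 x3 ^+ 2 + mdist x2 x4 ^+ 2 <=
  mdist x1 x2 ^+ 2 + mdist x2 x3 ^+ 2 + mdist x3 x4 ^+ 2 + mdist x1 x4 ^+ 2.
Proof.
have h01 : 0 <= (2^-1 : R) <= 1 by lra.
pose m := geo_pt x1 x3 2^-1.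
have h2 := geo_ptP x1 x3 h01 x2; have h4 := geo_ptP x1 x3 h01 x4.
rewrite -/m in h2 h4.
have t := metric_triangle x2 m x4.
rewrite [mdist m x4]metric_sym in t.
rewrite [mdist x1 x2]metric_sym [mdist x1 x4]metric_sym [mdist x3 x4]metric_sym.
have a := d0 x2 m; have b := d0 x4 m; have c := d0 x2 x4.
have : mdist x2 x4 ^+ 2 <= (mdist x2 m + mdist x4 m) ^+ 2.
  by rewrite ler_pXn2r ?nnegrE// addr_ge0.
have := sqr_ge0 (mdist x2 m - mdist x4 m); lra.
Qed.

Lemma geo_pt_isometry (f : X -> X) x y s : 0 <= s <= 1 ->
  (forall x y, mdist (f x) (f y) = mdist x y) ->
  f (geo_pt x y s) = geo_pt (f x) (f y) s.
Proof.
move=> s01 fi; apply: geo_pt_unique => //.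
  by rewrite !fi geo_pt_distl.
by rewrite !fi geo_pt_distr.
Qed.

Lemma geo_pt_dist x y s t : 0 <= s <= 1 -> 0 <= t <= 1 ->
  mdist (geo_pt x y s) (geo_pt x y t) = `|s - t| * mdist x y.
Proof.
suff H s' t' : 0 <= s' -> s' <= t' -> t' <= 1 ->
    mdist (geo_pt x y s') (geo_pt x y t') = (t' - s') * mdist x y.
  move=> /andP[s0 s1] /andP[t0 t1]; have [st|/ltW ts] := leP s t.
    by rewrite H// ler0_norm ?opprB// subr_le0.
  by rewrite metric_sym H// ger0_norm// subr_ge0.
move=> s0 st t1; have t0 := le_trans s0 st.
have [e|tn0] := eqVneq t' 0.
  have -> : s' = 0 by apply/eqP; rewrite eq_le s0 -e st.
  by rewrite e mdistxx subrr mul0r.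
have tp : 0 < t' by rewrite lt_neqAle eq_sym tn0.
have u01 : 0 <= s' / t' <= 1 by rewrite divr_ge0//= ler_pdivrMr// mul1r.
have t01 : 0 <= t' <= 1 by rewrite t0.
have -> : s' = t' * (s' / t') by rewrite mulrC divfK.
rewrite -geo_pt_pt// geo_pt_distr// geo_pt_distl//; field.
by [].
Qed.

Lemma stewart_geodesic_segment x y :
  geodesic_segment mdist x y (fun t => geo_pt x y (t / mdist x y)).
Proof.
have [e|l0] := eqVneq (mdist x y) 0.
  have xy := mdist_positivity _ _ e; rewrite /geodesic_segment e xy; split.
  - by rewrite invr0 mulr0 geo_pt0.
  - by rewrite invr0 mulr0 geo_pt0.
  - by move=> s t; rewrite -!eq_le => /eqP <- /eqP <-; rewrite subrr normr0 mdistxx.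
have lp : 0 < mdist x y by rewrite lt_neqAle eq_sym l0 d0.
have in01 s : 0 <= s <= mdist x y -> 0 <= s / mdist x y <= 1.
  by move=> /andP[s0 s1]; rewrite divr_ge0//= ler_pdivrMr// mul1r.
split.
- by rewrite mul0r geo_pt0.
- by rewrite divff// geo_pt1.
- move=> s t /in01 hs /in01 ht; rewrite geo_pt_dist// -mulrBl normrM normfV.
  by rewrite [`|mdist x y|]ger0_norm// mulfVK.
Qed.

Lemma stewart_geodesic_space : geodesic_space X.
Proof.
by move=> x y; exists (fun t => geo_pt x y (t / mdist x y));
  exact: stewart_geodesic_segment.
Qed.

Lemma geodesic_segment_pt x y (c : R -> X) s : geodesic_segment mdist x y c ->
  0 <= s <= 1 -> c (s * mdist x y) = geo_pt x y s.
Proof.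
move=> [c0 c1 cd] s01; have /andP[s0 s1] := s01.
have sl : 0 <= s * mdist x y <= mdist x y by rewrite mulr_ge0// ler_piMl.
apply: geo_pt_unique => //.
  by rewrite -{1}c0 cd ?lexx ?d0// sub0r normrN ger0_norm// mulr_ge0.
rewrite -{2}c1 cd ?lexx ?d0// ler0_norm; first by lra.
by rewrite subr_le0; case/andP: sl.
Qed.

(** For adjacent sides, Stewart's inequality goes from a point of the first side to the second side,
    then from the far vertex to the first side; both steps are equalities in the plane. On a single
    side, geodesics are unique. *)
Lemma stewart_cat0_inequality : cat0_inequality X.
Proof.
move=> v c v' c' tri tri' vv i j s t.
pose l i := mdist (v i) (v (ordS i)).
have frac (k : 'I_3) (r : R) : 0 <= r <= l k -> exists2 a, 0 <= a <= 1 & r = a * l k.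
  move=> /andP[r0 r1]; have [e|l0] := eqVneq (l k) 0.
    exists 0; first by rewrite lexx ler01.
    by rewrite mul0r; apply/eqP; rewrite eq_le r0 -e r1.
  exists (r / l k); last by rewrite divfK.
  have lp : 0 < l k by rewrite lt_neqAle eq_sym l0 d0.
  by apply/andP; split; [rewrite divr_ge0// ltW|rewrite ler_pdivrMr// mul1r].
move=> /frac[a a01 ->] /frac[b b01 ->] {s t}.
have cE (k : 'I_3) (r : R) : 0 <= r <= 1 -> c k (r * l k) = geo_pt (v k) (v (ordS k)) r.
  exact: geodesic_segment_pt.
have cE' (k : 'I_3) (r : R) : 0 <= r <= 1 ->
  c' k (r * l k) = plane_pt (v' k) (v' (ordS k)) r.
  move=> /andP[r0 r1]; rewrite (plane_segment_unique (tri' k)); last first.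
    by rewrite vv -/(l k) mulr_ge0//= ?ler_piMl// d0.
  rewrite vv -/(l k); have [e|l0] := eqVneq (l k) 0; last by rewrite mulfK.
  have -> : v' (ordS k) = v' k by apply/esym/plane_dist_eq0; rewrite vv -/(l k) e.
  by rewrite /plane_pt !subrr !mulr0.
rewrite !cE// !cE'//.
have o3 (k : 'I_3) : ordS (ordS (ordS k)) = k.
  by case: k => [[|[|[|//]]] hk]; apply: val_inj.
have adj (k : 'I_3) (r r' : R) : 0 <= r <= 1 -> 0 <= r' <= 1 ->
  mdist (geo_pt (v k) (v (ordS k)) r) (geo_pt (v (ordS k)) (v (ordS (ordS k))) r') <=
  plane_dist (plane_pt (v' k) (v' (ordS k)) r) (plane_pt (v' (ordS k)) (v' (ordS (ordS k))) r').
  move=> r01 r'01; have /andP[r0 r1] := r01; have /andP[r0' r1'] := r'01.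
  apply: sqr_le; first exact: plane_dist_ge0.
  set m := geo_pt (v k) _ r; set m' := plane_pt (v' k) _ r.
  have e1 : plane_dist (v' k) (v' (ordS k)) = mdist (v k) (v (ordS k)) by exact: vv.
  have e2 : plane_dist (v' (ordS k)) (v' (ordS (ordS k))) =
    mdist (v (ordS k)) (v (ordS (ordS k))) by exact: vv.
  have e3 : plane_dist (v' (ordS (ordS k))) (v' k) =
    mdist (v (ordS (ordS k))) (v k) by have := vv (ordS (ordS k)); rewrite o3.
  have h1 := geo_ptP (v (ordS k)) (v (ordS (ordS k))) r'01 m.
  have h1' := plane_stewart m' (v' (ordS k)) (v' (ordS (ordS k))) r'.
  have h2 := geo_ptP (v k) (v (ordS k)) r01 (v (ordS (ordS k))).
  have h2' := plane_stewart (v' (ordS (ordS k))) (v' k) (v' (ordS k)) r.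
  rewrite h1'; apply: (le_trans h1).
  have -> : mdist m (v (ordS k)) = plane_dist m' (v' (ordS k)).
    rewrite geo_pt_distr//.
    have {1}-> : v' (ordS k) = plane_pt (v' k) (v' (ordS k)) 1.
      by rewrite /plane_pt !mul1r !subrKC -surjective_pairing.
    by rewrite plane_dist_pt e1 distrC ger0_norm// subr_ge0.
  rewrite e2 lerB// lerD2l ler_wpM2l// [mdist m _]metric_sym [plane_dist m' _]plane_distC.
  apply: (le_trans h2); rewrite h2' e3 e1.
  by rewrite [plane_dist _ (v' (ordS k))]plane_distC e2 [mdist _ (v (ordS k))]metric_sym.
have [->|[->|ij]] : j = i \/ j = ordS i \/ i = ordS j.
  case: i {cE cE'} => [[|[|[|//]]] hi]; case: j => [[|[|[|//]]] hj];
  by [left; apply: val_inj|right; left; apply: val_inj|right; right; apply/val_inj].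
- rewrite geo_pt_dist// plane_dist_pt; rewrite vv//.
- exact: adj.
- by rewrite ij metric_sym plane_distC; exact: adj.
Qed.

End StewartSpace.

(** * Rays and the cone topology *)

Section Rays.
Variables (R : realType) (X : metricType R).
Implicit Types (x y : X) (s t T : R) (c : geodesic_ray X).
Hypothesis stX : stewart_space X.

Lemma ray_dist0 c t : 0 <= t -> mdist (c 0) (c t) = t.
Proof. by move=> t0; rewrite ray_isometry// sub0r normrN ger0_norm. Qed.

Lemma ray_pt c s T : 0 <= s <= 1 -> 0 <= T -> c (s * T) = geo_pt (c 0) (c T) s.
Proof.
move=> s01 T0; have /andP[s0 s1] := s01.
have sT : 0 <= s * T by rewrite mulr_ge0.
apply: geo_pt_unique => //; rewrite !ray_dist0// ray_isometry//.
by rewrite ler0_norm ?subr_le0 ?ler_piMl//; lra.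
Qed.

Lemma ray_convex c c' s T : 0 <= s <= 1 -> 0 <= T ->
  mdist (c (s * T)) (c' (s * T)) <= (1 - s) * mdist (c 0) (c' 0) + s * mdist (c T) (c' T).
Proof. by move=> s01 T0; rewrite !ray_pt//; exact: geo_pt_convex. Qed.

Lemma ray_fan c c' t T : c 0 = c' 0 -> 0 <= t <= T -> 0 < T ->
  mdist (c t) (c' t) <= t / T * mdist (c T) (c' T).
Proof.
move=> cc' /andP[t0 tT] T0.
have s01 : 0 <= t / T <= 1 by rewrite divr_ge0 ?(ltW T0)//= ler_pdivrMr ?mul1r.
have := ray_convex c c' s01 (ltW T0).
by rewrite divfK ?gt_eqF// cc' mdistxx mulr0 add0r.
Qed.

Lemma bounded_linear_le (a b K : R) : 0 <= b ->
  (forall T, 0 < T -> a <= b + K / T) -> a <= b.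
Proof.
move=> b0 h; rewrite leNgt; apply/negP => ba.
pose T := (`|K| + 1) / ((a - b) / 2).
have T0 : 0 < T by rewrite divr_gt0 ?ltr_pwDr ?divr_gt0 ?subr_gt0.
have := h T T0; have : K / T <= (a - b) / 2.
  rewrite ler_pdivrMr// /T mulrC divfK; last by rewrite gt_eqF// divr_gt0// subr_gt0.
  by have := ler_norm K; lra.
by lra.
Qed.

(** The distance of two rays is convex in time, and a bounded convex function on a half-line does
    not increase. *)
Lemma asymptotic_le c c' t : asymptotic c c' -> 0 <= t ->
  mdist (c t) (c' t) <= mdist (c 0) (c' 0).
Proof.
move=> [K hK] t0; apply: (@bounded_linear_le _ _ (t * K)) => [|T T0].
  exact: mdist_ge0.
have [tT|Tt] := leP t T.
  have s01 : 0 <= t / T <= 1 by rewrite divr_ge0 ?(ltW T0)//= ler_pdivrMr ?mul1r.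
  have := ray_convex c c' s01 (ltW T0).
  rewrite divfK ?gt_eqF// => /le_trans; apply; rewrite lerD//.
    by rewrite ler_piMl ?mdist_ge0//; lra.
  rewrite (mulrAC t K) ler_wpM2l//; first by case/andP: s01.
  by apply: hK; exact: ltW.
(* For [T < t] the bound [K] suffices, because [t / T] exceeds 1. *)
have K0 : 0 <= K by apply: le_trans (hK _ t0); exact: mdist_ge0.
apply: (le_trans (hK _ t0)); rewrite -[leLHS]add0r lerD ?mdist_ge0//.
by rewrite ler_pdivlMr// mulrC ler_wpM2r// ltW.
Qed.

Lemma ultra_cvg_compact (I : Type) (U : set_system I) (f : I -> X) (K : set X) :
  UltraFilter U -> compact K -> U (f @^-1` K) ->
  exists p, forall e, 0 < e -> U [set i | mdist p (f i) < e].
Proof.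
move=> UU cK UK; have [p [_ pcl]] := cK (f @ U) _ UK.
exists p => e e0; have [//|UC] := in_ultra_setVsetC [set i | mdist p (f i) < e] UU.
have bp : nbhs p [set y | mdist p y < e].
  by apply/metricType_numDomainType.nbhs_mdistP; exists e.
have [y [h1 h2]] := pcl (~` [set y | mdist p y < e]) _ UC bp.
by case: h1.
Qed.

Hypothesis prX : proper_space X.

(** An ultrafilter on the indices gives the limits at all times at once, in place of a diagonal
    subsequence; each limit exists because balls are compact. *)
Lemma segment_limit x (y : nat -> X) :
  (forall B, exists N, forall n, (N <= n)%N -> B <= mdist x (y n)) ->
  exists2 c : geodesic_ray X, c 0 = x & forall t e N, 0 <= t -> 0 < e ->
    exists n, [/\ (N <= n)%N, 0 < mdist x (y n), t <= mdist x (y n) &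
      mdist (c t) (geo_pt x (y n) (t / mdist x (y n))) < e].
Proof.
move=> hy; pose P n t := geo_pt x (y n) (t / mdist x (y n)).
have [U [UU Uoo]] := ultraFilterLemma eventually_filter.
have PU : ProperFilter U by exact: ultra_proper.
have UI (A B : set nat) : U A -> U B -> exists n, A n /\ B n.
  by move=> UA UB; apply: (@filter_ex _ U _ (A `&` B)); exact: filterI.
have UI2 (A B : set nat) : U A -> U B -> U (A `&` B) by move=> UA UB; exact: filterI.
have Ufar B N : U [set n | [/\ (N <= n)%N, 0 < mdist x (y n) & B <= mdist x (y n)]].
  have [N' hN'] := hy (`|B| + 1).
  apply: Uoo; exists (maxn N N') => // n /=; rewrite geq_max => /andP[Nn /hN' h].
  have := ler_norm B; have := normr_ge0 B; move: h => h h1 h2.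
  by split=> //; [apply: lt_le_trans h; lra|apply: le_trans h; lra].
have in01 n t : 0 <= t -> 0 < mdist x (y n) -> t <= mdist x (y n) ->
    0 <= t / mdist x (y n) <= 1.
  by move=> t0 d0 td; rewrite divr_ge0 ?(ltW d0)//= ler_pdivrMr ?mul1r.
have lim t : exists p, 0 <= t -> forall e, 0 < e -> U [set n | mdist p (P n t) < e].
  have [t0|] := boolP (0 <= t); last by exists x.
  have [|p hp] := @ultra_cvg_compact _ U (P ^~ t) [set y | mdist x y <= t] UU (@prX x t).
    apply: filterS (Ufar t 0%N) => n /= [_ d0 td].
    rewrite geo_pt_distl//; last exact: in01.
    by rewrite divfK// gt_eqF.
  by exists p.
have [c0 hc0] := choice lim.
have iso s t : 0 <= s -> 0 <= t -> mdist (c0 s) (c0 t) = `|s - t|.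
  move=> s0 t0; apply/eqP; rewrite -subr_eq0 -normr_le0; apply/ler_addgt0Pl => e e0.
  have e20 : 0 < e / 2 by rewrite divr_gt0.
  have := UI _ _ (UI2 _ _ (hc0 s s0 _ e20) (hc0 t t0 _ e20)) (Ufar (Num.max s t) 0%N).
  move=> [n [/= [h1 h2] [_ d0]]]; rewrite ge_max => /andP[sd td].
  have h : mdist (P n s) (P n t) = `|s - t|.
    rewrite geo_pt_dist//; [|exact: in01..].
    rewrite -mulrBl normrM normfV [`|mdist _ _|]ger0_norm ?(ltW d0)//.
    by rewrite divfK// gt_eqF.
  rewrite addr0 -h.
  have t1 := metric_triangle (c0 s) (P n s) (c0 t).
  have t2 := metric_triangle (P n s) (P n t) (c0 t).
  have t3 := metric_triangle (P n s) (c0 s) (P n t).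
  have t4 := metric_triangle (c0 s) (c0 t) (P n t).
  rewrite [mdist (P n t) (c0 t)]metric_sym in t2.
  rewrite [mdist (P n s) (c0 s)]metric_sym in t3.
  by rewrite ler_norml; lra.
have lim0 : c0 0 = x.
  apply: mdist_positivity; apply/eqP; rewrite eq_le mdist_ge0 andbT.
  apply/ler_addgt0Pl => e e0.
  have /filter_ex[n /= h] := hc0 0 (lexx _) e e0.
  by move: h; rewrite /P mul0r geo_pt0// addr0 => /ltW.
exists (@GeodesicRay R X c0 iso) => // t e N t0 e0.
have := UI _ _ (hc0 t t0 e e0) (Ufar t N).
by move=> [n [/= h1 [h2 h3 h4]]]; exists n.
Qed.

Lemma ray_from c x : exists2 c' : geodesic_ray X, c' 0 = x & asymptotic c c'.
Proof.
pose D := mdist x (c 0).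
have dn n : `|mdist x (c n%:R) - n%:R| <= D.
  have := metric_triangle x (c 0) (c n%:R); have := metric_triangle (c 0) x (c n%:R).
  rewrite ray_dist0// [mdist (c 0) x]metric_sym -/D.
  by rewrite ler_norml; lra.
have D0 : 0 <= D by exact: mdist_ge0.
have [|c' c'0 hc'] := @segment_limit x (fun n => c n%:R).
  move=> B; have [N hN] := nat_above (B + D); exists N => n /hN h.
  by have := dn n; rewrite ler_norml => /andP[h' _]; lra.
(* One [D] bounds the gap between the two segments that end at [c n%:R], the other the shift between
   their parametrizations, and 1 is the error of the limit. *)
exists c' => //; exists (D + D + 1) => t t0.
have [n /= [_ d0 td h]] := hc' t 1 0%N t0 ltr01.
set d := mdist x (c n%:R) in d0 td h.
set s := t / d in h.
have s01 : 0 <= s <= 1 by rewrite divr_ge0 ?(ltW d0)//= ler_pdivrMr ?mul1r.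
have /andP[s0 s1] := s01.
have h1 : mdist (geo_pt x (c n%:R) s) (c (s * n%:R)) <= D.
  rewrite ray_pt//; apply: (le_trans (geo_pt_convex stX _ _ _ _ s01)).
  rewrite mdistxx mulr0 addr0 -/D; nra.
have h2 : mdist (c (s * n%:R)) (c t) <= D.
  rewrite ray_isometry//; last exact: (mulr_ge0 s0 (ler0n _ _)).
  have -> : s * n%:R - t = s * (n%:R - d) by rewrite mulrBr divfK// gt_eqF.
  rewrite normrM ger0_norm// distrC.
  by have := dn n; rewrite -/d; have := normr_ge0 (d - n%:R); nra.
have := metric_triangle (c t) (c (s * n%:R)) (c' t).
have := metric_triangle (c (s * n%:R)) (geo_pt x (c n%:R) s) (c' t).
have := metric_sym (c t) (c (s * n%:R)); have := metric_sym (c' t) (geo_pt x (c n%:R) s).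
by have := metric_sym (c (s * n%:R)) (geo_pt x (c n%:R) s); lra.
Qed.

End Rays.

(** * Neighbourhoods in the cone topology and change of base point *)

Section ConeTopology.
Variables (R : realType) (X : metricType R) (b : X).
Implicit Types (c : geodesic_ray X) (xi : visual_boundary b).

Lemma endpointP c c' : endpoint b c = endpoint b c' <-> asymptotic c c'.
Proof.
rewrite /endpoint; split.
  by move/eqP; rewrite eqmodE => /asboolP.
by move=> cc'; apply/eqP; rewrite eqmodE; apply/asboolP.
Qed.

Lemma endpoint_surj xi : exists c, endpoint b c = xi.
Proof. by exists (repr (xi : {eq_quot (asymptotic_equiv X)})); exact: reprK. Qed.

Lemma asymptotic_sym c c' : asymptotic c c' -> asymptotic c' c.
Proof. by move=> /endpointP e; apply/endpointP. Qed.

Lemma cone_subbase_nbhs xi V : cone_subbase b V -> V xi -> nbhs xi V.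
Proof.
move=> sV Vxi; rewrite nbhsE /=; exists V => //; split=> //.
exists [set V].
  by move=> _ ->; exact: finI_from1.
by rewrite bigcup_set1.
Qed.

Lemma nbhs_cone xi (F : set_system (visual_boundary b)) : Filter F ->
  (forall V, cone_subbase b V -> V xi -> F V) -> F `=>` nbhs xi.
Proof.
move=> FF hF U; rewrite nbhsE /= => -[V [[D sD <-] [W DW Wxi]] VU].
have [I sI WI] := sD W DW.
apply: (@filterS _ _ _ W).
  by apply: subset_trans VU => y Wy; exists W.
rewrite -WI; apply: filter_bigI => V' IV'.
apply: hF; first by have := sI V' IV'; rewrite inE.
by move: Wxi; rewrite -WI; exact.
Qed.

End ConeTopology.

Section ChangeOfBasepoint.
Variables (R : realType) (X : metricType R).
Hypotheses (stX : stewart_space X) (prX : proper_space X).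
Implicit Types (c : geodesic_ray X).

Lemma endpoint_from (b x : X) (xi : visual_boundary b) :
  exists2 c : geodesic_ray X, c 0 = x & endpoint b c = xi.
Proof.
have [c <-] := endpoint_surj xi; have [c' c'x cc'] := ray_from stX prX c x.
by exists c' => //; apply/endpointP; exact: (asymptotic_sym b cc').
Qed.

Lemma rebase_le (c c' d d' : geodesic_ray X) (r t : R) : asymptotic c d ->
  asymptotic c' d' ->
  c 0 = c' 0 -> d 0 = d' 0 -> 0 <= r <= t -> 0 < t ->
  mdist (d r) (d' r) <= r / t * (2 * mdist (c 0) (d 0) + mdist (c t) (c' t)).
Proof.
move=> cd cd' c0 d0 rt t0; have /andP[r0 _] := rt.
apply: (le_trans (ray_fan stX d0 rt t0)).
apply: ler_wpM2l; first by apply: divr_ge0 => //; exact: ltW.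
have h1 := asymptotic_le stX cd (ltW t0); have h2 := asymptotic_le stX cd' (ltW t0).
rewrite -c0 -d0 in h2.
have := metric_triangle (d t) (c t) (d' t); have := metric_triangle (c t) (c' t) (d' t).
by rewrite [mdist (d t) (c t)]metric_sym; lra.
Qed.

(** A quantitative form of the independence of the cone topology from the base point. Asymptotic
    rays from [x] and [y] stay within [mdist x y], and the fan inequality from [y] gives a factor
    [r / t], small for late [t]. *)
Lemma rebase_time (x y : X) (r e : R) : 0 <= r -> 0 < e -> exists2 t, 0 < t &
  forall c c' d d' : geodesic_ray X, asymptotic c d -> asymptotic c' d' ->
  c 0 = x -> c' 0 = x -> d 0 = y -> d' 0 = y ->
  mdist (c t) (c' t) < 1 -> mdist (d r) (d' r) < e.
Proof.
move=> r0 e0; pose K := 2 * mdist x y + 1.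
have K0 : 0 <= K by rewrite /K; have := mdist_ge0 x y; lra.
have rKe : 0 <= r * K / e by apply: divr_ge0; [exact: mulr_ge0|exact: ltW].
have t0 : 0 < r + r * K / e + 1 by lra.
exists (r + r * K / e + 1) => // c c' d d' cd cd' cx cx' dy dy' h.
have rt : 0 <= r <= r + r * K / e + 1 by lra.
have := rebase_le cd cd' (etrans cx (esym cx')) (etrans dy (esym dy')) rt t0.
move=> /le_lt_trans; apply.
apply: (@le_lt_trans _ _ (r / (r + r * K / e + 1) * K)).
  apply: ler_wpM2l; first by apply: divr_ge0 => //; exact: ltW.
  by rewrite cx dy /K; lra.
rewrite mulrAC ltr_pdivrMr//.
have -> : e * (r + r * K / e + 1) = e * r + r * K + e by field; rewrite gt_eqF.
by have : 0 <= e * r; [apply: mulr_ge0 => //; exact: ltW|lra].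
Qed.

End ChangeOfBasepoint.

(** * Topological spaces determined by codes *)

Section CodedSpaces.
Variables (R : realType) (S : Type).
Implicit Types (s : R) (e : nat -> seq S).

(* A point of the suspension of a space of ends: the height [s] in [-1, 1] and,
   away from the two poles, an end [e] given by its finite prefixes. *)
Record coding (T : topologicalType) (valid : R -> (nat -> seq S) -> Prop)
    (code : T -> R -> (nat -> seq S) -> Prop) : Prop := Coding {
  coding_total : forall x, exists s e, code x s e ;
  coding_valid : forall x s e, code x s e -> valid s e ;
  coding_surj : forall s e, valid s e -> exists x, code x s e ;
  coding_inj : forall x x' s e e', code x s e -> code x' s e' ->
    (`|s| < 1 -> e = e') -> x = x' ;
  coding_out : forall x s e N d, code x s e -> 0 < d -> \forall y \near x,
    forall s' e', code y s' e' -> `|s - s'| < d /\ (`|s| < 1 -> e N = e' N) ;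
  coding_in : forall x s e (U : set T), code x s e -> nbhs x U ->
    exists N, exists2 d, 0 < d & forall y s' e', code y s' e' -> `|s - s'| < d ->
    (`|s| < 1 -> forall n, (n <= N)%N -> e n = e' n) -> U y }.

Lemma coding_unique (T : topologicalType) valid (code : T -> R -> (nat -> seq S) ->
  Prop) :
  coding valid code -> forall x s e s' e', code x s e -> code x s' e' ->
  s = s' /\ (`|s| < 1 -> e = e').
Proof.
move=> h x s e s' e' xse xse'.
have H N d : 0 < d -> `|s - s'| < d /\ (`|s| < 1 -> e N = e' N).
  by move=> d0; have /nbhs_singleton := coding_out h N xse d0; exact.
split; last by move=> s1; apply/funext => N; have [_] := H N 1 ltr01; exact.
apply/eqP; rewrite -subr_eq0 -normr_le0; apply/ler_addgt0Pl => d d0; rewrite addr0.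
by have [/ltW] := H 0%N d d0.
Qed.

(** A neighbourhood of [f x] is described by a slope tolerance and finitely many prefixes, and
    [coding_out] controls each of these near [x]. *)
Lemma coding_continuous (T1 T2 : topologicalType) valid code1 code2 (f : T1 -> T2) :
  coding valid code1 -> coding valid code2 ->
  (forall x, exists s e, code1 x s e /\ code2 (f x) s e) -> continuous f.
Proof.
move=> h1 h2 hf x U.
have [s [e [xse fxse]]] := hf x.
move=> /(coding_in h2 fxse)[N [d d0 hU]].
have hN : \forall y \near x, forall s' e', code1 y s' e' ->
    `|s - s'| < d /\ (`|s| < 1 -> forall n, (n <= N)%N -> e n = e' n).
  elim: N {hU} => [|N IHN].
    apply: filterS (coding_out h1 0%N xse d0) => y hy s' e' /hy[a b].
    by split=> // /b ? n; rewrite leqn0 => /eqP ->.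
  apply: filterS2 IHN (coding_out h1 N.+1 xse d0) => y hy hy' s' e' yc.
  have [a b] := hy _ _ yc; have [_ c] := hy' _ _ yc.
  split=> // s1 n; rewrite leq_eqVlt => /orP[/eqP ->|]; first exact: c.
  exact: b.
apply: filterS hN => y hy.
have [s' [e' [yc fyc]]] := hf y.
by have [a b] := hy _ _ yc; exact: hU fyc a b.
Qed.

Lemma coding_homeomorphic (T1 T2 : topologicalType) valid code1 code2 :
  @coding T1 valid code1 -> @coding T2 valid code2 -> homeomorphic T1 T2.
Proof.
have H (U1 U2 : topologicalType) c1 c2 : @coding U1 valid c1 -> @coding U2 valid c2 ->
    exists f : U1 -> U2, forall x, exists s e, c1 x s e /\ c2 (f x) s e.
  move=> h1 h2.
  suff /choice[f hf] : forall x : U1, exists y : U2, exists s e, c1 x s e /\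
    c2 y s e by exists f.
  move=> x.
  have [s [e xc]] := coding_total h1 x.
  by have [y yc] := coding_surj h2 (coding_valid h1 xc); exists y, s, e.
have K (U1 U2 : topologicalType) c1 c2 (f : U1 -> U2) (g : U2 -> U1) :
    @coding U1 valid c1 -> @coding U2 valid c2 ->
    (forall x, exists s e, c1 x s e /\ c2 (f x) s e) ->
    (forall x, exists s e, c2 x s e /\ c1 (g x) s e) -> cancel f g.
  move=> h1 h2 hf hg x; have [s [e [xc fxc]]] := hf x.
  have [s' [e' [fxc' gc]]] := hg (f x).
  have [ss' ee'] := coding_unique h2 fxc fxc'.
  by rewrite -ss' in gc; apply/esym; exact: (coding_inj h1 xc gc ee').
move=> h1 h2; have [f hf] := H _ _ _ _ h1 h2; have [g hg] := H _ _ _ _ h2 h1.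
exists f, g; split.
- exact: (K _ _ _ _ _ _ h1 h2 hf hg).
- exact: (K _ _ _ _ _ _ h2 h1 hg hf).
- exact: (coding_continuous h1 h2 hf).
- exact: (coding_continuous h2 h1 hg).
Qed.

End CodedSpaces.

(** * The minimal set of a hyperbolic isometry *)

Section Axis.
Variables (R : realType) (X : metricType R) (f : X -> X) (tau : R).
Implicit Types (x y w : X) (s t r : R) (c : geodesic_ray X) (n m k : nat).
Hypotheses (stX : stewart_space X) (tau_gt0 : 0 < tau).
Hypothesis f_iso : forall x y, mdist (f x) (f y) = mdist x y.
Hypothesis tau_min : forall y, tau <= mdist y (f y).

Lemma linear_bounded_le0 (a K : R) : (forall n, n%:R * a <= K) -> a <= 0.
Proof.
move=> h; rewrite leNgt; apply/negP => a0.
have [N /(_ N (leqnn _))] := nat_above (K / a).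
by rewrite ltr_pdivrMr// ltNge h.
Qed.

Definition minset x := mdist x (f x) = tau.

Let iter_iso n x y : mdist (iter n f x) (iter n f y) = mdist x y.
Proof. by elim: n => //= n <-. Qed.

Lemma minset_iter n x : minset x -> minset (iter n f x).
Proof. by move=> Mx; rewrite /minset -iterS iterSr iter_iso. Qed.

Lemma minset_f x : minset x -> minset (f x).
Proof. exact: (@minset_iter 1). Qed.

Lemma minset_geo_pt x y s : minset x -> minset y -> 0 <= s <= 1 ->
  minset (geo_pt x y s).
Proof.
move=> Mx My s01; apply/eqP; rewrite eq_le tau_min andbT.
rewrite (geo_pt_isometry stX _ _ s01 f_iso).
apply: (le_trans (geo_pt_convex stX _ _ _ _ s01)).
by rewrite Mx My; lra.
Qed.

(* The midpoints of [x, f x] and [f x, f (f x)] are moved one to the other. *)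
Lemma minset_f2 x : minset x -> mdist x (f (f x)) = 2 * tau.
Proof.
move=> Mx; have h01 : 0 <= (2^-1 : R) <= 1 by lra.
have Mfx := minset_f Mx.
apply/eqP; rewrite eq_le; apply/andP; split.
  by apply: (le_trans (metric_triangle _ (f x) _)); rewrite Mfx Mx; lra.
have := tau_min (geo_pt (f x) x 2^-1).
rewrite (geo_pt_isometry stX _ _ h01 f_iso) [geo_pt (f (f x)) _ _]geo_pt_sym//.
have -> : 1 - 2^-1 = 2^-1 :> R by lra.
by have := geo_pt_fan stX (f x) x (f (f x)) h01; lra.
Qed.

(* One inequality is the quadrilateral inequality for [x, f x, f y, y], the other
   the median inequality for [f x] and the midpoint [f y] of [y, f (f y)]. *)
Lemma minset_parallelogram x y : minset x -> minset y ->
  mdist x (f y) ^+ 2 + mdist (f x) y ^+ 2 = 2 * tau ^+ 2 + 2 * mdist x y ^+ 2.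
Proof.
move=> Mx My; apply/eqP; rewrite eq_le; apply/andP; split.
  have := quadrilateral_ineq stX x (f x) (f y) y.
  by rewrite f_iso Mx [mdist (f y) y]metric_sym My; lra.
have := @midpoint_ineq _ _ stX (f x) (f y) y (f (f y)) tau My (minset_f My) (minset_f2 My).
by rewrite !f_iso; lra.
Qed.

(* The limit of [mdist x (iter n f y) - n%:R * tau]; that it is given by the value
   at [n = 1] follows from [dist_iter]. *)
Definition busemann x y := (mdist x (f y) ^+ 2 - mdist x y ^+ 2 - tau ^+ 2) / (2 * tau).

Let busE x y : mdist x (f y) ^+ 2 = mdist x y ^+ 2 + tau ^+ 2 + 2 * tau * busemann x y.
Proof. by rewrite /busemann; field; rewrite gt_eqF. Qed.

Let cancel_tau a b : 2 * tau * a = 2 * tau * b -> a = b.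
Proof. by apply: mulfI; rewrite mulf_neq0 ?gt_eqF. Qed.

Lemma busemann_anti x y : minset x -> minset y -> busemann y x = - busemann x y.
Proof.
move=> Mx My; apply: cancel_tau.
have := minset_parallelogram Mx My.
rewrite [mdist (f x) y]metric_sym !busE [mdist y x]metric_sym; lra.
Qed.

(** The parallelogram identity for [x] and [f y] says that the squared distances from [x] to [y],
    [f y], [f (f y)] have second difference [2 * tau ^ 2]. *)
Lemma busemann_f x y : minset x -> minset y -> busemann x (f y) = busemann x y + tau.
Proof.
move=> Mx My; apply: cancel_tau.
have := minset_parallelogram Mx (minset_f My).
by rewrite f_iso (busE x (f y)) (busE x y); lra.
Qed.

Lemma busemann_iter n x y : minset x -> minset y ->
  busemann x (iter n f y) = busemann x y + n%:R * tau.
Proof.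
move=> Mx My; elim: n => [|n IHn]; first by rewrite mul0r addr0.
by rewrite iterS busemann_f ?IHn//; [rewrite -natr1; ring|exact: minset_iter].
Qed.

Lemma dist_iter n x y : minset x -> minset y -> mdist x (iter n f y) ^+ 2 =
  (busemann x y + n%:R * tau) ^+ 2 + (mdist x y ^+ 2 - busemann x y ^+ 2).
Proof.
move=> Mx My; elim: n => [|n IHn]; first by rewrite mul0r addr0 subrKC.
rewrite iterS busE IHn busemann_iter// -natr1; ring.
Qed.

(** The triangle inequality for [v], [u] and an iterate of [v] is squared; [n] is taken large enough
    that the squared quantity is nonnegative, and the terms linear in [n] remain. *)
Lemma busemann_le x y : minset x -> minset y -> `|busemann x y| <= mdist x y.
Proof.
move=> Mx My.
have H u v : minset u -> minset v -> - busemann u v <= mdist u v.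
  move=> Mu Mv; have d0 := mdist_ge0 u v.
  have [n /(_ _ (leqnn n))] := nat_above (mdist u v / tau).
  rewrite ltr_pdivrMr// => hn.
  have e1 : mdist v (iter n f v) = n%:R * tau.
    apply: sqr_inj; [exact: mdist_ge0|exact: mulr_ge0 (ler0n _ _) (ltW tau_gt0)|].
    have b0 : busemann v v = 0 by have := busemann_anti Mv Mv; lra.
    by rewrite dist_iter// b0 mdistxx; ring.
  have t1 := metric_triangle v u (iter n f v).
  rewrite e1 [mdist v u]metric_sym in t1.
  have e := dist_iter n Mu Mv.
  have : (n%:R * tau - mdist u v) ^+ 2 <= mdist u (iter n f v) ^+ 2.
    by rewrite ler_pXn2r ?nnegrE ?mdist_ge0//; lra.
  rewrite e => h; have {}h :
    (n%:R * tau) * - busemann u v <= (n%:R * tau) * mdist u v by lra.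
  by rewrite -(ler_pM2l (_ : 0 < n%:R * tau))//; lra.
rewrite ler_norml; apply/andP; split.
  by have := H x y Mx My; lra.
by have := H y x My Mx; rewrite busemann_anti// metric_sym opprK.
Qed.

(** On the path through [iter n f y] to [iter (n + n) f w], the doubled iterate makes the terms
    quadratic in [n] cancel in [(a + b) ^ 2 <= 2 * a ^ 2 + 2 * b ^ 2]; the linear terms give the
    claim. *)
Let busemann_subadd x y w : minset x -> minset y -> minset w ->
  busemann x w <= busemann x y + busemann y w.
Proof.
move=> Mx My Mw; rewrite -subr_le0.
apply: (@linear_bounded_le0 _ ((2 * mdist x y ^+ 2 + 2 * mdist y w ^+2 - mdist x w ^+ 2) / (4 * tau))) => n.
have e := dist_iter (n + n) Mx Mw; have e1 := dist_iter n Mx My.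
have e2 := dist_iter n My Mw.
have t := metric_triangle x (iter n f y) (iter (n + n) f w).
rewrite [iter (n + n) f w in X in _ <= _ + X]iterD iter_iso in t.
rewrite ler_pdivlMr ?mulr_gt0//.
have : mdist x (iter (n + n) f w) ^+ 2 <=
  (mdist x (iter n f y) + mdist y (iter n f w)) ^+ 2.
  by rewrite ler_pXn2r ?nnegrE ?addr_ge0 ?mdist_ge0.
have := sqr_ge0 (mdist x (iter n f y) - mdist y (iter n f w)).
by rewrite natrD in e; lra.
Qed.

Lemma busemann_cocycle x y w : minset x -> minset y -> minset w ->
  busemann x w = busemann x y + busemann y w.
Proof.
move=> Mx My Mw; apply/eqP; rewrite eq_le busemann_subadd//=.
have := busemann_subadd Mw My Mx.
by rewrite (busemann_anti Mx Mw) (busemann_anti My Mw) (busemann_anti Mx My); lra.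
Qed.

(** Stewart's inequality is read from the far points [iter n f w], then from [w] to the segment
    translated by [iter n f]. The quadratic terms cancel, and the linear ones give opposite
    inequalities. *)
Lemma busemann_geo_pt w x y s : minset w -> minset x -> minset y -> 0 <= s <= 1 ->
  busemann w (geo_pt x y s) = (1 - s) * busemann w x + s * busemann w y.
Proof.
move=> Mw Mx My s01; set m := geo_pt x y s.
have Mm : minset m by exact: minset_geo_pt.
have H n : n%:R * (busemann m w - (1 - s) * busemann x w - s * busemann y w) <=
    ((1 - s) * mdist x w ^+ 2 + s * mdist y w ^+ 2 - mdist m w ^+ 2
      - s * (1 - s) * mdist x y ^+ 2) / (2 * tau).
  rewrite ler_pdivlMr ?mulr_gt0//.
  have := geo_ptP stX x y s01 (iter n f w); rewrite -/m.
  rewrite ![mdist (iter n f w) _]metric_sym !dist_iter//; lra.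
have H' n : n%:R * (- busemann m w + (1 - s) * busemann x w + s * busemann y w) <=
    ((1 - s) * mdist x w ^+ 2 + s * mdist y w ^+ 2 - mdist m w ^+ 2
      - s * (1 - s) * mdist x y ^+ 2) / (2 * tau).
  rewrite ler_pdivlMr ?mulr_gt0//.
  have Mi v : minset v -> minset (iter n f v) by exact: minset_iter.
  have := geo_ptP stX (iter n f x) (iter n f y) s01 w.
  have := @geo_pt_isometry _ _ stX (iter n f) x y s s01 (@iter_iso n); rewrite -/m => <-.
  rewrite iter_iso !dist_iter// (busemann_anti Mm Mw) (busemann_anti Mx Mw) (busemann_anti My Mw).
  by rewrite ![mdist w _]metric_sym; lra.
have := linear_bounded_le0 H; have := linear_bounded_le0 H'.
by rewrite !(busemann_anti Mw)//; lra.
Qed.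

(* The minimal set is the product of a line, along which [f] translates, and a
   space [Y]; [rho] is the distance of the projections to [Y], and [near r] bounds
   the distance in the quotient by [f]. *)
Definition rho x y := Num.sqrt (mdist x y ^+ 2 - busemann x y ^+ 2).

Lemma rho_ge0 x y : 0 <= rho x y. Proof. exact: sqrtr_ge0. Qed.

Lemma rho_sqr x y : minset x -> minset y ->
  rho x y ^+ 2 = mdist x y ^+ 2 - busemann x y ^+ 2.
Proof.
move=> Mx My; rewrite sqr_sqrtr// subr_ge0 -[_ ^+ 2]real_normK ?num_real//.
by rewrite ler_pXn2r ?nnegrE ?mdist_ge0// busemann_le.
Qed.

Lemma dist_rho x y : minset x -> minset y ->
  mdist x y ^+ 2 = rho x y ^+ 2 + busemann x y ^+ 2.
Proof. by move=> Mx My; rewrite rho_sqr// subrK. Qed.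

Lemma dist_le_rho x y : minset x -> minset y ->
  mdist x y <= rho x y + `|busemann x y|.
Proof.
move=> Mx My; have r0 := rho_ge0 x y.
apply: sqr_le; first by rewrite addr_ge0.
rewrite dist_rho// -(real_normK (num_real (busemann x y))).
by have := normr_ge0 (busemann x y); nra.
Qed.

Lemma rhoC x y : minset x -> minset y -> rho y x = rho x y.
Proof.
by move=> Mx My; rewrite /rho metric_sym (busemann_anti Mx My) sqrrN.
Qed.

Lemma rho_iter m k x y : minset x -> minset y ->
  rho (iter m f x) (iter k f y) = rho x y.
Proof.
have H n u v : minset u -> minset v -> rho u (iter n f v) = rho u v.
  by move=> Mu Mv; rewrite /rho dist_iter// busemann_iter//; congr Num.sqrt; ring.
move=> Mx My; have Mmx := minset_iter m Mx.
by rewrite H// rhoC// H// rhoC.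
Qed.

Definition near r x y := exists m k : nat, mdist (iter m f x) (iter k f y) <= r.

Lemma near_dist r x y : mdist x y <= r -> near r x y.
Proof. by exists 0%N, 0%N. Qed.

Lemma near_sym r x y : near r x y -> near r y x.
Proof. by move=> [m [k h]]; exists k, m; rewrite metric_sym. Qed.

Lemma near_le r r' x y : r <= r' -> near r x y -> near r' x y.
Proof. by move=> rr' [m [k h]]; exists m, k; exact: le_trans rr'. Qed.

Lemma near_trans r r' x y w : near r x y -> near r' y w -> near (r + r') x w.
Proof.
move=> [m [k h]] [m' [k' h']]; exists (m' + m)%N, (k + k')%N.
apply: (le_trans (metric_triangle _ (iter (m' + k) f y) _)); rewrite lerD//.
  by rewrite !iterD iter_iso.
by rewrite addnC !iterD iter_iso.
Qed.

Lemma near_rho r x y : minset x -> minset y -> near r x y -> rho x y <= r.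
Proof.
move=> Mx My [m [k h]]; rewrite -(rho_iter m k Mx My).
apply: le_trans h; apply: sqr_le; first exact: mdist_ge0.
by rewrite rho_sqr; [rewrite gerBl sqr_ge0|exact: minset_iter..].
Qed.

(** Iterates of [f] shift the height by [tau] and keep [rho]. With forward iterates only, the sign
    of the height decides which point is moved. *)
Lemma rho_near x y : minset x -> minset y -> near (rho x y + tau) x y.
Proof.
move=> Mx My.
have H u v : minset u -> minset v -> busemann u v <= 0 ->
  exists k : nat, `|busemann u v + k%:R * tau| <= tau.
  move=> Mu Mv b0; exists (Num.truncn (- busemann u v / tau)).
  have q0 : 0 <= - busemann u v / tau by apply: divr_ge0; [rewrite oppr_ge0|exact: ltW].
  have /andP[] := truncn_itv q0; set k := Num.truncn _.
  by rewrite ler_pdivlMr// ltr_pdivrMr// -natr1 ler_norml; lra.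
have [b0|b0] := leP (busemann x y) 0.
  have [k hk] := H _ _ Mx My b0; exists 0%N, k.
  apply: (le_trans (dist_le_rho _ _)) => /=; [by []|exact: minset_iter|].
  by rewrite (@rho_iter 0)// busemann_iter// lerD2l.
have [|k hk] := H _ _ My Mx; first by rewrite (busemann_anti Mx My); lra.
exists k, 0%N; rewrite metric_sym.
apply: (le_trans (dist_le_rho _ _)) => /=; [by []|exact: minset_iter|].
by rewrite (@rho_iter 0)// busemann_iter// rhoC// lerD2l.
Qed.

Lemma rho_triangle x y w : minset x -> minset y -> minset w ->
  rho x w <= rho x y + rho y w + 2 * tau.
Proof.
move=> Mx My Mw.
have h := near_rho Mx Mw (near_trans (rho_near Mx My) (rho_near My Mw)).
by apply: (le_trans h); lra.
Qed.

(* The displacement of [f] is convex and bounded along a ray. *)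
Lemma minset_ray c K t : (forall y, mdist y (f y) <= K) -> minset (c 0) -> 0 <= t ->
  minset (c t).
Proof.
move=> hK M0 t0.
have fc_iso s u : 0 <= s -> 0 <= u -> mdist (f (c s)) (f (c u)) = `|s - u|.
  by move=> s0 u0; rewrite f_iso ray_isometry.
pose fc := @GeodesicRay R X (f \o c) fc_iso.
have cfc : asymptotic c fc by exists K => u _; exact: hK.
apply/eqP; rewrite eq_le tau_min andbT -[leRHS]M0.
exact: (asymptotic_le stX cfc t0).
Qed.

Definition slope c := busemann (c 0) (c 1).

Section Slope.
Variables (c : geodesic_ray X).
Hypothesis Mc : forall t, 0 <= t -> minset (c t).

Lemma busemann_ray t : 0 <= t -> busemann (c 0) (c t) = t * slope c.
Proof.
have M0 : minset (c 0) by exact: Mc.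
have b00 : busemann (c 0) (c 0) = 0 by have := busemann_anti M0 M0; lra.
have H s T : 0 <= s <= 1 -> 0 <= T ->
  busemann (c 0) (c (s * T)) = s * busemann (c 0) (c T).
  by move=> s01 T0; rewrite ray_pt// busemann_geo_pt// ?b00 ?mulr0 ?add0r//; exact: Mc.
move=> t0; have [t1|t1] := leP t 1.
  by rewrite -[t in LHS]mulr1 H ?t0//.
have tp : 0 < t by exact: lt_trans t1.
have := H t^-1 t; rewrite mulVf ?gt_eqF// => h.
rewrite /slope h ?mulrA ?divff ?gt_eqF ?mul1r// invr_ge0 t0 invf_le1//.
exact: ltW.
Qed.

Lemma slope_le1 : `|slope c| <= 1.
Proof.
have := busemann_le (Mc (lexx 0)) (Mc ler01).
by rewrite ray_dist0.
Qed.

(** The speed of the projection to [Y]; slope and coslope are the sine and cosine of the angle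
    between the ray and [Y]. *)
Definition coslope := Num.sqrt (1 - slope c ^+ 2).

Lemma coslope_ge0 : 0 <= coslope. Proof. exact: sqrtr_ge0. Qed.

Lemma coslope_sqr : coslope ^+ 2 = 1 - slope c ^+ 2.
Proof.
rewrite sqr_sqrtr// subr_ge0 -[_ ^+ 2]real_normK ?num_real//.
by rewrite expr_le1// slope_le1.
Qed.

Lemma rho_ray t : 0 <= t -> rho (c 0) (c t) = t * coslope.
Proof.
move=> t0; have M0 := Mc (lexx 0); apply: sqr_inj;
  rewrite ?rho_ge0 ?mulr_ge0 ?coslope_ge0//.
by rewrite rho_sqr//;
  [rewrite busemann_ray// ray_dist0// exprMn [RHS]exprMn coslope_sqr; ring|exact: Mc].
Qed.

End Slope.

End Axis.

(** * Slopes and ends of rays *)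

Section GeometricAction.
Variables (R : realType) (G : groupType) (S : Type) (z : G) (nf : G -> seq S).
Variables (X : metricType R) (act : G -> X -> X).
Implicit Types (x y : X) (g h : G) (r : R) (N : nat).
Hypotheses (sg : stack_group z nf) (stX : stewart_space X).
Hypotheses (geoX : geometric_action act) (prX : proper_space X).

Lemma action1 x : act 1%g x = x.
Proof. by case: geoX => [[h _] _ _ _]. Qed.

Lemma actionM g h x : act (g * h)%g x = act g (act h x).
Proof. by case: geoX => [[_ h'] _ _ _]. Qed.

Lemma action_iso g x y : mdist (act g x) (act g y) = mdist x y.
Proof. by case: geoX. Qed.

Lemma actionV g x y : mdist (act g x) y = mdist x (act g^-1%g y).
Proof. by rewrite -(action_iso g x) -actionM mulgV action1. Qed.

Lemma iter_action n x : iter n (act z) x = act (z ^+ n)%g x.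
Proof. by elim: n x => [|n IHn] x; rewrite ?action1//= IHn -actionM expgS. Qed.

Lemma z_powers_inj (m n : nat) : (z ^+ m = z ^+ n)%g -> m = n.
Proof.
wlog mn : m n / (m <= n)%N => [H e|e].
  by have [/H->//|/ltnW/H h] := leqP m n; rewrite h.
apply/eqP; rewrite eqn_leq mn /= leqNgt; apply/negP => lt.
have := sg_infinite sg (n - m).-1; rewrite prednK ?subn_gt0// expgnFr// e.
by rewrite mulgV eqxx.
Qed.

Lemma orbit_finite x0 r : finite_set [set g | mdist x0 (act g x0) <= r].
Proof.
case: geoX => [_ _ pd _].
apply: sub_finite_set (pd _ (@prX x0 (Num.max r 0))).
move=> g /= hg; exists (act g x0); split.
  by exists x0 => //=; rewrite mdistxx le_max lexx orbT.
by rewrite /= le_max hg.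
Qed.

Lemma orbit_bound x0 r (phi : G -> nat) : exists L, forall g,
  mdist x0 (act g x0) <= r -> (phi g <= L)%N.
Proof.
have /finite_seqP[s hs] := orbit_finite x0 r.
exists (\sum_(g <- s) phi g)%N => g hg.
have gs : g \in s by have : [set` s] g by rewrite -hs.
by rewrite (big_rem g)//= leq_addr.
Qed.

Lemma z_displacement_gt0 x : 0 < mdist x (act z x).
Proof.
rewrite mdist_gt0; apply/eqP => e.
have fixn n : act (z ^+ n)%g x = x.
  by rewrite -iter_action; elim: n => //= n ->.
(* If [z] fixed [x], so would all its powers; here [phi] reads off the exponent of a power, which
   would have to be bounded. *)
have [L hL] := orbit_bound x 0 (fun g => if pselect (exists n :
  nat, g = (z ^+ n)%g) is left h
   then projT1 (cid h) else 0%N).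
have := hL (z ^+ L.+1)%g; rewrite fixn mdistxx lexx => /(_ isT).
case: pselect => [h|[]]; last by exists L.+1.
by case: cid => n /= /z_powers_inj <-; rewrite ltnn.
Qed.

Lemma action_central g x : act z (act g x) = act g (act z x).
Proof. by rewrite -!actionM (sg_central sg). Qed.

Hypothesis neX : [set: X] !=set0.

(** As [z] is central, its displacement is invariant under [G]; so a minimum over a compact set
    whose translates cover [X] is global. *)
Lemma axis_exists : exists x0, exists2 tau, 0 < tau &
  (forall y, tau <= mdist y (act z y)) /\ minset (act z) tau x0.
Proof.
have [x _] := neX; case: geoX => [_ _ _ [K cK KX]].
have K0 : K !=set0.
  by have : [set: X] x by []; rewrite -KX => -[g _ [y Ky _]]; exists y.
have cphi : continuous (fun y => mdist y (act z y)).
  apply: (@lipschitz_continuous _ _ _ 2) => u v.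
  have := metric_triangle u v (act z u); have := metric_triangle v u (act z v).
  have := metric_triangle v (act z v) (act z u); have :=
    metric_triangle u (act z u) (act z v).
  rewrite !action_iso [mdist v u]metric_sym ler_norml; lra.
have [x0 _ hx0] := compact_EVT_min K0 cK (continuous_subspaceT cphi).
exists x0, (mdist x0 (act z x0)); first exact: z_displacement_gt0.
split=> // y; have : [set: X] y by [].
rewrite -KX => -[g _ [k Kk <-]].
by rewrite action_central action_iso; apply: hx0; rewrite inE.
Qed.

Lemma orbit_cobounded x0 : exists2 D, 0 <= D &
  forall x, exists g, mdist x (act g x0) <= D.
Proof.
case: geoX => [_ _ _ [K cK KX]].
have [x _] := neX.
have K0 : K !=set0.
  by have : [set: X] x by []; rewrite -KX => -[g _ [y Ky _]]; exists y.
have cphi : continuous (fun y => mdist y x0).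
  apply: (@lipschitz_continuous _ _ _ 1) => u v.
  have := metric_triangle u v x0; have := metric_triangle v u x0.
  by rewrite [mdist v u]metric_sym ler_norml; lra.
have [k _ hk] := compact_EVT_max K0 cK (continuous_subspaceT cphi).
exists (mdist k x0) => [|y]; first exact: mdist_ge0.
have : [set: X] y by []; rewrite -KX => -[g _ [u Ku <-]].
by exists g; rewrite action_iso; apply: hk; rewrite inE.
Qed.

(** * Normal forms of orbit points that follow a ray *)

Section Orbit.
Variables (x0 : X) (tau : R).
Hypothesis tau_gt0 : 0 < tau.
Hypothesis tau_min : forall y, tau <= mdist y (act z y).
Hypothesis Mx0 : minset (act z) tau x0.

Local Notation M := (minset (act z) tau).
Local Notation near := (near (act z)).
Let z_iso x y : mdist (act z x) (act z y) = mdist x y := action_iso z x y.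

Lemma minset_action g x : M x -> M (act g x).
Proof. by rewrite /minset action_central action_iso. Qed.

Lemma nf_z_powers m k g : nf ((z ^+ m)^-1 * (z ^+ k * g))%g = nf g.
Proof.
have H n h : nf (z ^+ n * h)%g = nf h.
  by elim: n => [|n IHn]; rewrite ?mul1g// expgS -mulgA (sg_nfz sg).
by rewrite -(H m) mulgA mulgV mul1g H.
Qed.

Lemma zeq_near g h : zeq z g h -> near 0 (act g x0) (act h x0).
Proof.
by move=> [m [k e]]; exists m, k; rewrite !iter_action -!actionM e mdistxx.
Qed.

Lemma pop_near : exists2 C, 0 <= C & forall g u w, nf g = u ++ w ->
  exists2 g', nf g' = w & mdist (act g x0) (act g' x0) <= (size u)%:R * C.
Proof.
have [E hE] := sg_pop sg.
exists (\sum_(f <- E) mdist x0 (act f x0)); first by apply: sumr_ge0 => f _;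
  exact: mdist_ge0.
move=> g u; elim: u g => [|s u IHu] g w e.
  by exists g => //; rewrite mdistxx mul0r.
have [f fE /IHu[g' g'w hg']] := hE _ _ _ e.
exists g' => //; apply: (le_trans (metric_triangle _ (act (g * f)%g x0) _)).
rewrite /= -natr1 mulrDl mul1r addrC lerD// actionM action_iso (big_rem f)//=.
by rewrite lerDl; apply: sumr_ge0 => h _; exact: mdist_ge0.
Qed.

(** Popping [u] and [u'] leads to elements with equal normal forms, whose orbit points agree modulo
    [z]. *)
Lemma same_bottom_near : exists2 C, 0 <= C & forall g g' u u' w,
  nf g = u ++ w -> nf g' = u' ++ w ->
  near ((size u + size u')%:R * C) (act g x0) (act g' x0).
Proof.
have [C C0 hC] := pop_near; exists C => // g g' u u' w e e'.
have [h ew hd] := hC _ _ _ e; have [h' ew' hd'] := hC _ _ _ e'.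
have n0 : near 0 (act h x0) (act h' x0).
  by apply: zeq_near; apply: (sg_zeq sg); rewrite ew.
have := near_trans z_iso (near_trans z_iso (near_dist _ hd) n0) (near_sym (near_dist _ hd')).
by apply: near_le; rewrite addr0 natrD mulrDl.
Qed.

Lemma near_orbit r g g' : near r (act g x0) (act g' x0) ->
  exists2 h, nf (g * h)%g = nf g' & mdist x0 (act h x0) <= r.
Proof.
move=> [m [k hd]]; exists (g^-1 * ((z ^+ m)^-1 * (z ^+ k * g')))%g.
  by rewrite mulgA mulgV mul1g nf_z_powers.
by move: hd; rewrite !iter_action -!actionM actionV -actionM invgM -mulgA.
Qed.

Lemma near_size r : exists N, forall g, near r x0 (act g x0) -> (size (nf g) <= N)%N.
Proof.
have [N hN] := orbit_bound x0 r (fun g => size (nf g)).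
exists N => g; rewrite -{1}(action1 x0) => /near_orbit[h].
by rewrite mul1g => <-; exact: hN.
Qed.

Lemma bot_stable r : exists L, forall h, mdist x0 (act h x0) <= r ->
  forall g N, (N + L <= size (nf g))%N -> bot N (nf (g * h)%g) = bot N (nf g).
Proof.
have [l hl] := choice (sg_bot sg).
have [L hL] := orbit_bound x0 r l.
exists L => h /hL lL g N NL; apply: hl; apply: leq_trans NL.
by rewrite leq_add2l.
Qed.

(** A short normal form would put the orbit point near [x0], by comparison with the element 1; a
    long one keeps its bottom under the finitely many right multiplications that move [x0] by at
    most [r]. *)
Lemma bot_near r N : exists2 A, 0 <= A & forall g g',
  near r (act g x0) (act g' x0) -> ~ near A x0 (act g x0) ->
  (N <= size (nf g))%N /\ bot N (nf g) = bot N (nf g').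
Proof.
have [L hL] := bot_stable r; have [C C0 hC] := same_bottom_near.
exists ((N + L)%:R * C); first by rewrite mulr_ge0.
move=> g g' gg' far.
have NL : (N + L <= size (nf g))%N.
  rewrite leqNgt; apply/negP => lt; apply: far.
  have := @hC 1%g g [::] (nf g) [::] (sg_nf1 sg) (esym (cats0 _)).
  rewrite action1 add0n; apply: near_le.
  by rewrite ler_wpM2r// ler_nat ltnW.
split; first by rewrite (leq_trans _ NL)// leq_addr.
have [h <- hr] := near_orbit gg'.
by rewrite hL.
Qed.

Variable D : R.
Hypotheses (D_ge0 : 0 <= D) (D_cover : forall x, exists g, mdist x (act g x0) <= D).

Local Notation bus := (busemann (act z) tau).
Local Notation rho := (rho (act z) tau).
Local Notation slope := (slope (act z) tau).
Local Notation coslope := (coslope (act z) tau).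

Let bus_cocycle x y w : M x -> M y -> M w -> bus x w = bus x y + bus y w.
Proof. exact: busemann_cocycle. Qed.

Let bus_le x y : M x -> M y -> `|bus x y| <= mdist x y.
Proof. exact: busemann_le. Qed.

Let bus_pt x y s : M x -> M y -> 0 <= s <= 1 ->
  bus x (geo_pt x y s) = s * bus x y.
Proof.
move=> Mx My s01.
rewrite (@busemann_geo_pt _ _ _ _ stX tau_gt0 z_iso tau_min x x y s)//.
suff -> : bus x x = 0 by rewrite mulr0 add0r.
by have := busemann_anti stX tau_gt0 z_iso tau_min Mx Mx; lra.
Qed.

Let near_rhoX r x y : M x -> M y -> near r x y -> rho x y <= r.
Proof. exact: near_rho. Qed.

Let dist_rhoX x y : M x -> M y -> mdist x y ^+ 2 = rho x y ^+ 2 + bus x y ^+ 2.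
Proof. exact: dist_rho. Qed.

Let dist_le_rhoX x y : M x -> M y -> mdist x y <= rho x y + `|bus x y|.
Proof. exact: dist_le_rho. Qed.

Let rhoCX x y : M x -> M y -> rho y x = rho x y.
Proof. exact: rhoC. Qed.

Let rho_triangleX x y w : M x -> M y -> M w -> rho x w <= rho x y + rho y w + 2 * tau.
Proof. exact: rho_triangle. Qed.

Let nearT r r' x y w : near r x y -> near r' y w -> near (r + r') x w.
Proof. exact: near_trans. Qed.

Let Mact g : M (act g x0).
Proof. exact: minset_action. Qed.

Let displacement_le y : mdist y (act z y) <= 2 * D + tau.
Proof.
have [g hg] := D_cover y.
have := metric_triangle y (act g x0) (act z y).
have := metric_triangle (act g x0) (act z (act g x0)) (act z y).
by rewrite z_iso (Mact g) [mdist _ y]metric_sym; lra.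
Qed.

Let Mray (c : geodesic_ray X) t : c 0 = x0 -> 0 <= t -> M (c t).
Proof. by move=> c0; apply: (minset_ray stX z_iso tau_min displacement_le);
  rewrite c0. Qed.

Let bus_ray (c : geodesic_ray X) t : c 0 = x0 -> 0 <= t -> bus x0 (c t) = t * slope c.
Proof.
move=> c0 t0; rewrite -{1}c0; apply: busemann_ray => // u.
exact: Mray.
Qed.

Let rho_rayX (c : geodesic_ray X) t : c 0 = x0 -> 0 <= t -> rho x0 (c t) = t * coslope c.
Proof.
move=> c0 t0; rewrite -{1}c0; apply: rho_ray => // u.
exact: Mray.
Qed.

Let slope_le (c : geodesic_ray X) : c 0 = x0 -> `|slope c| <= 1.
Proof. by move=> c0; apply: slope_le1 => // u; exact: Mray. Qed.

Let coslopeE (c : geodesic_ray X) : c 0 = x0 -> coslope c ^+ 2 = 1 - slope c ^+ 2.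
Proof. by move=> c0; apply: coslope_sqr => // u; exact: Mray. Qed.

Let coslope_ge0X (c : geodesic_ray X) : 0 <= coslope c.
Proof. exact: coslope_ge0. Qed.

Lemma near_far r A x y : mdist x y <= r -> ~ near (A + r) x0 x -> ~ near A x0 y.
Proof. by move=> xy far h; apply: far; apply: nearT h _; apply: near_dist;
  rewrite metric_sym. Qed.

(** Along the path, orbit points followed at steps of length at most 1 are within [2 * D + 1] of
    each other, so [bot_near] applies to every step. The constant depends on [N] but not on the
    path. *)
Lemma path_bot N : exists2 A, 0 <= A & forall (P : R -> X) a b, a <= b ->
  (forall s t, a <= s <= b -> a <= t <= b -> mdist (P s) (P t) = `|s - t|) ->
  (forall t, a <= t <= b -> ~ near A x0 (P t)) ->
  forall g g', mdist (P a) (act g x0) <= D -> mdist (P b) (act g' x0) <= D ->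
  (N <= size (nf g))%N /\ bot N (nf g) = bot N (nf g').
Proof.
have [A A0 hA] := bot_near (2 * D + 1) N.
exists (A + D); first by rewrite addr_ge0.
move=> P a b ab iso far g g' gD g'D.
suff H n : forall b' g', a <= b' -> b' <= b -> b' <= a + n%:R ->
    mdist (P b') (act g' x0) <= D ->
    (N <= size (nf g))%N /\ bot N (nf g) = bot N (nf g').
  have [n hn] := nat_above (b - a).
  apply: (H n b) => //; have := hn n (leqnn n); lra.
elim: n => [|n IHn] {g'D}b' g'' ab' bb' b'n g'D.
  have e : b' = a by apply/eqP; rewrite eq_le ab' andbT; move: b'n; rewrite addr0.
  apply: hA; last by apply: (near_far gD); apply: far; rewrite lexx.
  apply: near_dist; rewrite e in g'D.
  by have := metric_triangle (act g x0) (P a) (act g'' x0);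
    rewrite [mdist _ (P a)]metric_sym; lra.
pose b1 := Num.max a (b' - 1).
have ab1 : a <= b1 by rewrite le_max lexx.
have b1b' : b1 <= b' by rewrite ge_max ab' gerBl ler01.
have b1n : b1 <= a + n%:R.
  by rewrite ge_max lerDl ler0n/=; move: b'n; rewrite -natr1; lra.
have b1d : b' - b1 <= 1 by have : b' - 1 <= b1 by [rewrite le_max lexx orbT]; lra.
have [h hh] := D_cover (P b1).
have [Ng ->] := IHn b1 h ab1 (le_trans b1b' bb') b1n hh; split=> //.
have in1 : a <= b1 <= b by rewrite ab1 (le_trans b1b').
have [_ ->//] : (N <= size (nf h))%N /\ bot N (nf h) = bot N (nf g'').
apply: hA; last by apply: (near_far hh); exact: far.
apply: near_dist.
have := metric_triangle (act h x0) (P b1) (act g'' x0).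
have := metric_triangle (P b1) (P b') (act g'' x0).
rewrite iso ?ab'// [mdist (act h x0) (P b1)]metric_sym ler0_norm;
  last by rewrite subr_le0.
by lra.
Qed.

Lemma ray_far (c : geodesic_ray X) t A : c 0 = x0 -> 0 <= t -> A < t * coslope c ->
  ~ near A x0 (c t).
Proof.
move=> c0 t0; rewrite -rho_rayX// => lt /(near_rhoX Mx0 (Mray c0 t0)).
by rewrite leNgt lt.
Qed.

(* The orbit points that follow the ray [c] have normal forms with bottom [e N]. *)
Definition has_end (c : geodesic_ray X) (e : nat -> seq S) := forall N, exists T,
  forall t g, T <= t -> 0 <= t -> mdist (c t) (act g x0) <= D ->
  (N <= size (nf g))%N /\ bot N (nf g) = e N.

Lemma end_at N : exists2 A, 0 <= A & forall (c : geodesic_ray X) e t g, c 0 = x0 ->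
  has_end c e -> 0 <= t -> A < t * coslope c -> mdist (c t) (act g x0) <= D ->
  (N <= size (nf g))%N /\ bot N (nf g) = e N.
Proof.
have [A A0 hA] := path_bot N; exists A => // c e t g c0 ce t0 At gD.
have [T hT] := ce N; pose b := Num.max t T.
have [g' hg'] := D_cover (c b).
have tb : t <= b by rewrite le_max lexx.
have Tb : T <= b by rewrite le_max lexx orbT.
have [_ <-] := hT b g' Tb (le_trans t0 tb) hg'.
apply: (hA c t b) => // [s u /andP[s1 _] /andP[u1 _]|s /andP[s1 _]].
  by rewrite ray_isometry//; exact: le_trans t0 _.
apply: ray_far => //; first exact: le_trans s1.
by apply: lt_le_trans At _; rewrite ler_wpM2r.
Qed.

Lemma end_exists (c : geodesic_ray X) : c 0 = x0 -> 0 < coslope c ->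
  exists e, has_end c e.
Proof.
move=> c0 k0.
suff H N : exists w, exists T, forall t g, T <= t -> 0 <= t ->
  mdist (c t) (act g x0) <= D ->
    (N <= size (nf g))%N /\ bot N (nf g) = w.
  by have [e he] := choice H; exists e.
have [A A0 hA] := path_bot N; pose T := (A + 1) / coslope c.
have T0 : 0 <= T by apply: divr_ge0; [lra|exact: coslope_ge0X].
have TA : A < T * coslope c by rewrite divfK ?gt_eqF//; lra.
have [g0 hg0] := D_cover (c T).
have H a b g g' : T <= a -> a <= b -> mdist (c a) (act g x0) <= D ->
   mdist (c b) (act g' x0) <= D -> (N <= size (nf g))%N /\ bot N (nf g) = bot N (nf g').
  move=> Ta ab; apply: hA => // [s u /andP[s1 _] /andP[u1 _]|s /andP[s1 _]].
    by rewrite ray_isometry//; apply: le_trans T0 _; exact: le_trans Ta _.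
  have Ts : T <= s by exact: le_trans s1.
  apply: ray_far => //; first exact: le_trans Ts.
  by apply: lt_le_trans TA _; rewrite ler_wpM2r.
exists (bot N (nf g0)), T => t g Tt t0 gD; split.
  by have [] := H t t g g Tt (lexx _) gD gD.
by have [_ ->] := H T t g0 g (lexx _) Tt hg0 gD.
Qed.

(** The space does not occur here, so any two spaces on which [G] acts have the same valid ends. *)
Definition valid_end (e : nat -> seq S) := exists gn : nat -> G,
  forall N, exists n0, forall n, (n0 <= n)%N ->
    (N <= size (nf (gn n)))%N /\ bot N (nf (gn n)) = e N.

Lemma end_valid (c : geodesic_ray X) e : has_end c e -> valid_end e.
Proof.
move=> ce; have [gn hgn] := choice (fun n : nat => D_cover (c n%:R)).
exists gn => N; have [T hT] := ce N; have [n0 hn0] := nat_above T.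
by exists n0 => n /hn0 Tn; apply: (hT n%:R) => //; exact: ltW.
Qed.

Lemma size_bot N (w : seq S) : size (bot N w) = minn N (size w).
Proof. by rewrite size_drop; lia. Qed.

(* At the first integer time when the bottom [e N] appears in the normal form of a
   nearby orbit point, few entries lie above it. *)
Lemma bottleneck : exists B : nat, forall (c : geodesic_ray X) e N, (0 < N)%N ->
  c 0 = x0 -> has_end c e ->
  exists t g u, [/\ 0 <= t, mdist (c t) (act g x0) <= D, nf g = u ++ e N &
    (size u <= B)%N].
Proof.
have [L hL] := bot_stable (2 * D + 1).
exists L => c e N N0 c0 ce.
(* The element 1 at time 0, with its empty normal form, excludes 0 as the first time because
   [0 < N]. *)
have ex (n : nat) : exists g, mdist (c n%:R) (act g x0) <= D /\ (n = 0%N -> g = 1%g).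
  case: n => [|n]; first by exists 1%g; rewrite c0 action1 mdistxx.
  by have [g hg] := D_cover (c n.+1%:R); exists g.
have [gn hgn] := choice ex.
pose Q n := (N <= size (nf (gn n)))%N && `[< bot N (nf (gn n)) = e N >].
have exQ : exists n, Q n.
  have [T hT] := ce N; have [n0 /(_ n0 (leqnn _)) hn0] := nat_above T.
  exists n0; have [g1 _] := hgn n0.
  have [h1 h2] := hT n0%:R (gn n0) (ltW hn0) (ler0n _ _) g1.
  by rewrite /Q h1; apply/asboolP.
case: (ex_minnP exQ) => n /andP[Nn /asboolP en] minn.
case: n => [|n] in Nn en minn *.
  have [_ /(_ erefl) g1] := hgn 0%N.
  by move: Nn; rewrite g1 (sg_nf1 sg) leqn0 => /eqP e0; rewrite e0 in N0.
have [hn1 _] := hgn n.+1; have [hn _] := hgn n.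
exists n.+1%:R, (gn n.+1), (take (size (nf (gn n.+1)) - N) (nf (gn n.+1))).
split=> //; first by rewrite -en /bot cat_take_drop.
(* With more than [L] entries above it, the bottom would be present one time unit earlier, against
   minimality. *)
rewrite size_take_min geq_min; apply/orP; left; rewrite leqNgt; apply/negP => lt.
have hd : mdist x0 (act ((gn n.+1)^-1 * gn n)%g x0) <= 2 * D + 1.
  rewrite actionM -actionV.
  have := metric_triangle (act (gn n.+1) x0) (c n.+1%:R) (act (gn n) x0).
  have := metric_triangle (c n.+1%:R) (c n%:R) (act (gn n) x0).
  rewrite ray_isometry// -natr1 addrAC subrr add0r normr1.
  by rewrite [mdist (act _ x0) (c _)]metric_sym natr1; lra.
have := hL _ hd (gn n.+1) N.
rewrite mulgA mulgV mul1g => hb.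
have {hb}hb : bot N (nf (gn n)) = bot N (nf (gn n.+1)) by apply: hb; lia.
have : Q n.
  rewrite /Q; apply/andP; split; last by apply/asboolP; rewrite hb.
  by have := size_bot N (nf (gn n)); rewrite hb size_bot; lia.
by move/minn; rewrite ltnn.
Qed.

(** Subtract the identities [coslope ^ 2 + slope ^ 2 = 1] and factor. The factor [coslope c]
    compensates that the coslope is not Lipschitz in the slope near the poles. *)
Lemma slope_diff (c c' : geodesic_ray X) : c 0 = x0 -> c' 0 = x0 ->
  `|coslope c - coslope c'| * coslope c <= 2 * `|slope c - slope c'|.
Proof.
move=> c0 c'0; have k0 := coslope_ge0X c; have k0' := coslope_ge0X c'.
have e := coslopeE c0; have e' := coslopeE c'0.
apply: (le_trans (y := `|coslope c - coslope c'| * `|coslope c + coslope c'|)).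
  by rewrite ler_wpM2l// ger0_norm ?addr_ge0// lerDl.
have -> : `|coslope c - coslope c'| * `|coslope c + coslope c'| =
    `|slope c + slope c'| * `|slope c - slope c'|.
  by rewrite -!normrM -normrN; congr (`| _ |); rewrite -!subr_sqr; lra.
rewrite ler_wpM2r//; apply: (le_trans (ler_normD _ _)).
by have := slope_le c0; have := slope_le c'0; lra.
Qed.

Lemma bus_rays (c c' : geodesic_ray X) t t' : c 0 = x0 -> c' 0 = x0 -> 0 <= t ->
  0 <= t' ->
  bus (c t) (c' t') = t' * slope c' - t * slope c.
Proof.
move=> c0 c'0 t0 t'0.
have := bus_cocycle Mx0 (Mray c0 t0) (Mray c'0 t'0).
by rewrite !bus_ray//; lra.
Qed.

Lemma same_base_fan (c c' : geodesic_ray X) r t K e : c 0 = x0 -> c' 0 = x0 -> 0 <= r ->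
  0 < e -> 0 <= K -> r < t -> r * K < t * e -> mdist (c t) (c' t) <= K ->
  mdist (c r) (c' r) < e.
Proof.
move=> c0 c'0 r0 e0 K0 rt rKt ct.
have t0 : 0 < t by exact: le_lt_trans rt.
have h : mdist (c r) (c' r) <= r / t * mdist (c t) (c' t).
  by apply: ray_fan => //; [rewrite c0|rewrite r0 ltW].
apply: (le_lt_trans h); apply: (@le_lt_trans _ _ (r / t * K)).
  by rewrite ler_wpM2l// divr_ge0// ltW.
by rewrite mulrAC ltr_pdivrMr// [e * t]mulrC.
Qed.

Lemma code_in_pole (c : geodesic_ray X) r e : c 0 = x0 -> 0 <= r -> 0 < e ->
  coslope c = 0 -> exists2 d, 0 < d & forall c' : geodesic_ray X, c' 0 = x0 ->
  `|slope c - slope c'| < d -> mdist (c r) (c' r) < e.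
Proof.
(* 1 for the difference of heights, 1 for [rho x0 (c' t)], and [2 * tau] for the triangle inequality
   of [rho]. *)
move=> c0 r0 e0 k0; pose K := 2 + 2 * tau.
have K0 : 0 <= K by rewrite /K; have := tau_gt0; lra.
pose t := r + r * K / e + 1.
have rKe : 0 <= r * K / e by rewrite divr_ge0 ?mulr_ge0// ltW.
have rt : r < t by rewrite /t; lra.
have t1 : 1 <= t by rewrite /t; lra.
have tt : 0 < t * t by rewrite mulr_gt0//; lra.
have tt2 : 0 < 2 * (t * t) by lra.
exists ((2 * (t * t))^-1); first by rewrite invr_gt0.
move=> c' c'0; rewrite -[_^-1]mul1r ltr_pdivlMr// => hd.
have t0 : 0 <= t by lra.
apply: (same_base_fan c0 c'0 r0 e0 K0 rt).
  have -> : t * e = r * e + r * K + e by rewrite /t; field; rewrite gt_eqF.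
  have : 0 <= r * e by rewrite mulr_ge0// ltW.
  by lra.
apply: (le_trans (dist_le_rhoX (Mray c0 t0) (Mray c'0 t0))).
rewrite bus_rays// -mulrBr normrM (ger0_norm t0) distrC.
have hs := normr_ge0 (slope c - slope c').
have b1 : t * `|slope c - slope c'| <= 1 by nra.
have := rho_triangleX (Mray c0 t0) Mx0 (Mray c'0 t0).
rewrite (rhoCX Mx0 (Mray c0 t0)) !rho_rayX// k0 mulr0.
suff : t * coslope c' <= 1 by rewrite /K; lra.
apply: sqr_le => //; rewrite exprMn expr1n coslopeE//.
have e1 : slope c ^+ 2 = 1 by have := coslopeE c0; rewrite k0 expr0n/=; lra.
have h2 : 1 - slope c' ^+ 2 <= 2 * `|slope c - slope c'|.
  rewrite -e1 subr_sqr; apply: (le_trans (ler_norm _)); rewrite normrM mulrC ler_wpM2r//.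
  apply: (le_trans (ler_normD _ _)).
  by have := slope_le c0; have := slope_le c'0; lra.
have : t ^+ 2 * (1 - slope c' ^+ 2) <= t ^+ 2 * (2 * `|slope c - slope c'|).
  by rewrite ler_wpM2l// sqr_ge0.
by lra.
Qed.

(** By [bottleneck] both rays pass, at times [t] and [t'], near orbit points with a common bottom
    and few entries above it, hence near each other modulo [z]. The coslopes then compare the times,
    the slopes compare the heights, and the fan inequality returns to time [r]. *)
Lemma code_in (c : geodesic_ray X) en r e : c 0 = x0 -> 0 <= r -> 0 < e ->
  0 < coslope c -> has_end c en -> exists N, exists2 d, 0 < d &
  forall (c' : geodesic_ray X) en', c' 0 = x0 ->
  `|slope c - slope c'| < d -> has_end c' en' -> en N = en' N -> mdist (c r) (c' r) < e.
Proof.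
move=> c0 r0 e0 k0 ce; set k := coslope c in k0 *.
have [B hB] := bottleneck; have [C C0 hC] := same_bottom_near.
(* [R1] bounds the distance of [c t] and [c' t'] modulo [z], [R3] the difference of their [rho] from
   [x0], [B1] that of the times, and [K] the distance of [c t] and [c' t]; [T] is late enough for
   the fan inequality. *)
pose BC : R := (B + B)%:R * C; have BC0 : 0 <= BC by exact: mulr_ge0.
pose R1 := BC + 2 * D; pose R3 := R1 + 2 * tau.
have tau0 := ltW tau_gt0; have D0 := D_ge0; have R30 : 0 <= R3 by rewrite /R3 /R1; lra.
pose B1 := 2 * (R3 + 1) / k.
have B10 : 0 <= B1 by rewrite /B1; apply: divr_ge0; [lra|exact: ltW].
pose K := R1 + B1 + 1 + B1.
have K0 : 0 <= K by rewrite /K /R1; lra.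
pose T := r + r * K / e + 1.
have rKe : 0 <= r * K / e by rewrite divr_ge0 ?mulr_ge0// ltW.
(* Up to time [T], orbit points near the ray have normal forms of size at most [N]; a bottom of
   length [N.+1] therefore forces [T < t]. *)
have [N hN] := near_size (T + D).
have [t [g [u [t0 gD gu uB]]]] := hB c en N.+1 isT c0 ce.
have tT : T < t.
  rewrite ltNge; apply/negP => tT.
  have := hN g; rewrite leqNgt => H; apply: (negP (H _)).
    apply: near_dist; have := metric_triangle x0 (c t) (act g x0).
    have -> : mdist x0 (c t) = t by rewrite -[in LHS]c0 ray_dist0.
    by lra.
  have [T1 hT1] := ce N.+1; have [g1 hg1] := D_cover (c (Num.max T1 0)).
  have [] := hT1 (Num.max T1 0) g1 _ _ hg1; rewrite ?le_max ?lexx ?orbT// => h1 h2.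
  have e1 : size (en N.+1) = N.+1 by rewrite -h2 size_bot; exact/minn_idPl.
  by rewrite gu size_cat e1 leq_addl.
have tp : 0 < t by apply: le_lt_trans tT; rewrite /T; lra.
exists N.+1.
(* In this order, the bounds keep the coslope of [c'] above [k / 2], the difference of coslopes
   times [t] below 1, and the difference of slopes times [t'] below 1. *)
exists (Num.min (k ^+ 2 / 4) (Num.min (k / (2 * t)) ((t + B1)^-1))).
  rewrite !lt_min !divr_gt0 ?exprn_gt0 ?mulr_gt0//= invr_gt0.
  by rewrite ltr_wpDr.
move=> c' en' c'0; rewrite !lt_min => /and3P[d1 d2 d3] ce' ee.
have [t' [g' [u' [t'0 g'D gu' uB']]]] := hB c' en' N.+1 isT c'0 ce'.
have Mt := Mray c0 t0; have Mt' := Mray c'0 t'0.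
have nr : near R1 (c t) (c' t').
  rewrite -ee in gu'.
  have h1 := hC g g' u u' _ gu gu'.
  have h2 := nearT (near_dist _ gD) h1.
  rewrite metric_sym in g'D.
  have h3 := nearT h2 (near_dist _ g'D).
  apply: near_le h3; rewrite /R1.
  have : (size u + size u')%:R * C <= BC.
    by rewrite ler_wpM2r// ler_nat leq_add.
  by lra.
have rr := near_rhoX Mt Mt' nr.
have s1 := slope_le c0; have s1' := slope_le c'0.
set k' := coslope c'; have k0' : 0 <= k' := coslope_ge0X c'.
have sd := slope_diff c0 c'0; rewrite -/k -/k' in sd.
set ds := `|slope c - slope c'| in d1 d2 d3 sd.
have ds0 : 0 <= ds := normr_ge0 _.
move: d1 d2 d3; rewrite !ltr_pdivlMr ?mulr_gt0// -[(t + B1)^-1]mul1r ltr_pdivlMr;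
  last by rewrite ltr_wpDr.
move=> d1 d2 d3.
have dk : t * `|k - k'| <= 1.
  rewrite -(ler_pM2r k0) mul1r; apply: (@le_trans _ _ (t * (2 * ds))).
    by rewrite -mulrA ler_wpM2l.
  by lra.
have k'k : k / 2 <= k'.
  have : `|k - k'| <= k / 2 by rewrite -(ler_pM2r k0); lra.
  by rewrite ler_norml; lra.
have rc : `|t * k - t' * k'| <= R3.
  have a1 := rho_triangleX Mx0 Mt Mt'; have a2 := rho_triangleX Mx0 Mt' Mt.
  rewrite !rho_rayX// -/k -/k' in a1 a2; rewrite (rhoCX Mt Mt') in a2.
  by rewrite ler_norml /R3; lra.
have tt : `|t - t'| <= B1.
  rewrite /B1 ler_pdivlMr//.
  have : `|t - t'| * k' <= R3 + 1.
    rewrite -[k']ger0_norm// -normrM.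
    have -> : (t - t') * k' = (t * k - t' * k') - t * (k - k') by ring.
    apply: (le_trans (ler_normB _ _)); rewrite lerD//.
    by rewrite normrM ger0_norm.
  by have := normr_ge0 (t - t'); nra.
have hbus : `|bus (c t) (c' t')| <= B1 + 1.
  rewrite bus_rays//.
  have -> : t' * slope c' - t * slope c =
    (t' - t) * slope c - t' * (slope c - slope c') by ring.
  apply: (le_trans (ler_normB _ _)); rewrite lerD//.
    rewrite normrM distrC; apply: (le_trans _ tt).
    by rewrite ler_piMr.
  rewrite normrM ger0_norm// -/ds.
  have : t' <= t + B1 by move: tt; rewrite ler_norml; lra.
  by move=> h; apply: (@le_trans _ _ ((t + B1) * ds)); [rewrite ler_wpM2r|lra].
apply: (same_base_fan c0 c'0 r0 e0 K0 (_ : r < t)).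
- by apply: le_lt_trans tT; rewrite /T; lra.
- apply: (@lt_le_trans _ _ (T * e)); last by rewrite ler_wpM2r// ltW.
  have -> : T * e = r * e + r * K + e by rewrite /T; field; rewrite gt_eqF.
  have : 0 <= r * e by rewrite mulr_ge0// ltW.
  by lra.
- apply: (le_trans (metric_triangle _ (c' t') _)).
  rewrite ray_isometry// distrC.
  have := dist_le_rhoX Mt Mt'.
  by rewrite /K; lra.
Qed.

(** Heights at time [r] control the slopes. For the ends, [r] is so late that orbit points near
    [c r] and [c' r] already show the prefixes, which [bot_near] compares. *)
Lemma code_out (c : geodesic_ray X) N e : c 0 = x0 -> 0 < e ->
  exists r, exists2 d, 0 < r /\ 0 < d & forall c' : geodesic_ray X, c' 0 = x0 ->
  mdist (c r) (c' r) < d -> `|slope c - slope c'| < e /\ (0 < coslope c ->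
    forall en en', has_end c en -> has_end c' en' -> en N = en' N).
Proof.
move=> c0 e0.
have sl (c' : geodesic_ray X) r : c' 0 = x0 -> 0 <= r ->
    r * `|slope c - slope c'| <= mdist (c r) (c' r).
  move=> c'0 r0; apply: le_trans (bus_le (Mray c0 r0) (Mray c'0 r0)).
  by rewrite bus_rays// -mulrBr normrM (ger0_norm r0) distrC.
have D0 := D_ge0; have [k0|k0] := ltP 0 (coslope c); last first.
  exists 1, e => // c' c'0 cd; split=> //.
  by have := sl c' 1 c'0 ler01; rewrite mul1r => /le_lt_trans; apply.
set k := coslope c in k0 *.
have [A A0 hA] := end_at N; have [A2 A20 hA2] := bot_near (2 * D + 1) N.
(* The factor 2 is there because the coslope of [c'] is only known to be at least [k / 2]. *)
pose r := (A + A2 + D + 1) * 2 / k + 1.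
have r1 : 1 <= r.
  by rewrite /r lerDr; apply: divr_ge0; [lra|exact: ltW].
have r0 : 0 <= r by lra.
exists r, (Num.min e (Num.min (k ^+ 2 / 4) 1)).
  by rewrite !lt_min e0 divr_gt0 ?exprn_gt0//=; split=> //; lra.
move=> c' c'0; rewrite !lt_min => /and3P[d1 d2 d3].
have hs := sl c' r c'0 r0.
have hs1 : `|slope c - slope c'| <= mdist (c r) (c' r).
  by apply: le_trans hs; rewrite ler_peMl.
split; first exact: le_lt_trans d1.
move=> _ en en' ce ce'.
have sd := slope_diff c0 c'0; rewrite -/k in sd.
have k'k : k / 2 <= coslope c'.
  have : `|k - coslope c'| <= k / 2 by rewrite -(ler_pM2r k0); lra.
  by rewrite ler_norml; lra.
have rk : A + A2 + D < r * (k / 2).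
  have -> : r * (k / 2) = A + A2 + D + 1 + k / 2 by rewrite /r; field; rewrite gt_eqF.
  by lra.
have rkk : r * (k / 2) <= r * k by rewrite ler_wpM2l//; lra.
have rkk' : r * (k / 2) <= r * coslope c' by rewrite ler_wpM2l.
have [g hg] := D_cover (c r); have [g' hg'] := D_cover (c' r).
have [_ <-] := hA c en r g c0 ce r0 ltac:(rewrite -/k; lra) hg.
have [_ <-] := hA c' en' r g' c'0 ce' r0 ltac:(lra) hg'.
suff [_ ->//] : (N <= size (nf g))%N /\ bot N (nf g) = bot N (nf g').
apply: hA2.
  apply: near_dist.
  have := metric_triangle (act g x0) (c r) (act g' x0).
  have := metric_triangle (c r) (c' r) (act g' x0).
  by rewrite [mdist _ (c r)]metric_sym; lra.
apply: (near_far hg); apply: ray_far => //.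
by rewrite -/k; lra.
Qed.

(** Heights are linear along the segments to [y n], so an error [K] at distance [d] shrinks to
    [K / d] at distance 1 and vanishes in the limit. *)
Lemma limit_slope (y : nat -> X) s K : (forall n, M (y n)) ->
  (forall B, exists N, forall n, (N <= n)%N -> B <= mdist x0 (y n)) ->
  (forall n, `|bus x0 (y n) - s * mdist x0 (y n)| <= K) ->
  exists c : geodesic_ray X, [/\ c 0 = x0, slope c = s &
    forall t N, 0 <= t -> exists n, [/\ (N <= n)%N, 0 < mdist x0 (y n),
      t <= mdist x0 (y n) & mdist (c t) (geo_pt x0 (y n) (t / mdist x0 (y n))) < 1]].
Proof.
move=> My far hK; have [c c0 hc] := segment_limit stX prX far.
exists c; split=> // [|t N t0]; last by have [n []] := hc t 1 N t0 ltr01; exists n.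
have K0 : 0 <= K by exact: le_trans (hK 0%N).
apply/eqP; rewrite -subr_eq0 -normr_le0; apply/ler_addgt0Pl => e e0; rewrite addr0.
have e20 : 0 < e / 2 by rewrite divr_gt0.
have [N hN] := far (K / (e / 2) + 1).
have [n [Nn d0 d1 hd]] := hc 1 (e / 2) N ler01 e20.
have dK := hN n Nn; set d := mdist x0 (y n) in d0 d1 hd dK.
have s01 : 0 <= 1 / d <= 1 by rewrite divr_ge0 ?(ltW d0)//= ler_pdivrMr ?mul1r.
have M1 : M (c 1) by exact: Mray.
have bp := bus_pt Mx0 (My n) s01.
have Mp : M (geo_pt x0 (y n) (1 / d)) by exact: (minset_geo_pt stX z_iso tau_min).
set pt := geo_pt x0 (y n) (1 / d) in hd bp Mp.
have h1 := bus_cocycle Mx0 Mp M1.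
have h2 := bus_le Mp M1; rewrite metric_sym in h2.
rewrite bp bus_ray// !mul1r in h1.
have h3 : `|d^-1 * bus x0 (y n) - s| <= e / 2.
  rewrite -(ler_pM2l d0) -{1}(gtr0_norm d0) -normrM mulrBr mulVKf ?gt_eqF// [d * s]mulrC.
  apply: (le_trans (hK n)); rewrite -ler_pdivrMr//; lra.
have -> : slope c - s = (d^-1 * bus x0 (y n) - s) + bus pt (c 1).
  by rewrite h1; ring.
apply: (le_trans (ler_normD _ _)); lra.
Qed.

(** Powers of [z] move along the line factor in steps of [tau] and change neither [rho] nor [nf]. *)
Lemma adjust_height x H : M x -> exists h, [/\ forall g, nf (h * g)%g = nf g,
  `|bus x0 (act h x) - H| <= tau & rho x0 (act h x) = rho x0 x].
Proof.
move=> Mx; have tau0 := tau_gt0.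
have hk r : 0 <= r -> exists k : nat, 0 <= r - k%:R * tau <= tau.
  move=> r0; exists (Num.truncn (r / tau)).
  have /andP[] := truncn_itv (divr_ge0 r0 (ltW tau0)).
  by rewrite ler_pdivlMr// ltr_pdivrMr// -natr1; lra.
have [b0|b0] := leP (bus x0 x) H.
  have [k hkk] := hk (H - bus x0 x) ltac:(lra).
  exists (z ^+ k)%g; rewrite -iter_action; split.
  - by move=> g; have := nf_z_powers 0 k g; rewrite expg0 invg1 mul1g.
  - by rewrite (busemann_iter stX tau0 z_iso tau_min)// ler_norml; lra.
  - exact: (rho_iter stX tau0 z_iso tau_min 0 k).
have [k hkk] := hk (bus x0 x - H) ltac:(lra).
have My : M (act (z ^+ k)^-1%g x) by exact: minset_action.
have e : iter k (act z) (act (z ^+ k)^-1%g x) = x.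
  by rewrite iter_action -actionM mulgV action1.
exists (z ^+ k)^-1%g; split.
- by move=> g; have := nf_z_powers k 0 g; rewrite expg0 mul1g.
- have := busemann_iter stX tau0 z_iso tau_min k Mx0 My; rewrite e => e'.
  by rewrite ler_norml; lra.
- by have := rho_iter stX tau0 z_iso tau_min 0 k Mx0 My; rewrite e /= => ->.
Qed.

(** The poles are the two ends of the axis of [z]: limits of its positive and negative powers at
    [x0]. *)
Lemma pole_exists s : s ^+ 2 = 1 -> exists c : geodesic_ray X, c 0 = x0 /\ slope c = s.
Proof.
move=> s1; have tau0 := tau_gt0.
have b0 : bus x0 x0 = 0 by have := busemann_anti stX tau0 z_iso tau_min Mx0 Mx0; lra.
have dn x n : M x -> mdist x (iter n (act z) x) = n%:R * tau.
  move=> Mx; apply: sqr_inj; [exact: mdist_ge0|exact: mulr_ge0 (ler0n _ _) (ltW tau0)|].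
  have b1 : bus x x = 0 by have := busemann_anti stX tau0 z_iso tau_min Mx Mx; lra.
  by rewrite (dist_iter stX tau0 z_iso tau_min)// b1 mdistxx; ring.
have far B : exists N, forall n, (N <= n)%N -> B <= n%:R * tau.
  have [N hN] := nat_above (B / tau); exists N => n /hN.
  by rewrite ltr_pdivrMr// => /ltW.
have [->|s1'] := eqVneq s 1.
  have [||n|c [c0 cs _]] := @limit_slope (fun n => iter n (act z) x0) 1 0.
  - by move=> n; exact: minset_iter.
  - by move=> B; have [N hN] := far B; exists N => n; rewrite dn//; exact: hN.
  - by rewrite (busemann_iter stX tau0 z_iso tau_min)// dn// b0 mul1r add0r subrr normr0.
  - by exists c.
have -> : s = -1.
  have /eqP : (s - 1) * (s + 1) = 0 by rewrite -[RHS](subrr 1) -{3}s1; ring.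
  by rewrite mulf_eq0 subr_eq0 (negbTE s1') addr_eq0 => /eqP.
have My n : M (act (z ^+ n)^-1%g x0) by exact: minset_action.
have e n : iter n (act z) (act (z ^+ n)^-1%g x0) = x0.
  by rewrite iter_action -actionM mulgV action1.
have dy n : mdist x0 (act (z ^+ n)^-1%g x0) = n%:R * tau.
  by have := dn _ n (My n); rewrite e metric_sym.
have [||n|c [c0 cs _]] := @limit_slope (fun n => act (z ^+ n)^-1%g x0) (-1) 0.
- exact: My.
- by move=> B; have [N hN] := far B; exists N => n; rewrite dy; exact: hN.
- have := busemann_iter stX tau0 z_iso tau_min n Mx0 (My n).
  by rewrite e b0 dy => h; rewrite normr_le0; apply/eqP; lra.
- by exists c.
Qed.

(* A limit of geodesics to points of the orbits of [gn n] under [z], chosen at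
   height close to [r n * s]. *)
Lemma end_realized s e : `|s| < 1 -> valid_end e -> exists c : geodesic_ray X,
  [/\ c 0 = x0, slope c = s & has_end c e].
Proof.
move=> s1 [gn hgn]; have tau0 := tau_gt0; have D0 := D_ge0.
have s2 : 0 < 1 - s ^+ 2.
  rewrite subr_gt0 -(real_normK (num_real s)) -(expr1n _ 2) ltrXn2r//.
pose k := Num.sqrt (1 - s ^+ 2).
have k0 : 0 < k by rewrite sqrtr_gt0.
have kE : k ^+ 2 = 1 - s ^+ 2 by rewrite sqr_sqrtr// ltW.
(* [r n] is a hypotenuse: [rho] equal to [r n * k] and height close to [r n * s] give a distance
   close to [r n]. *)
pose x n := act (gn n) x0; pose r n := rho x0 (x n) / k.
have Mx n : M (x n) by exact: Mact.
have r0 n : 0 <= r n by apply: divr_ge0; [exact: rho_ge0|exact: ltW].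
have rk n : r n * k = rho x0 (x n) by rewrite divfK// gt_eqF.
have [h hh] := choice (fun n => adjust_height (r n * s) (Mx n)).
pose y n := act (h n) (x n).
have My n : M (y n) by exact: minset_action.
have rhoy n : rho x0 (y n) = r n * k by have [_ _ ->] := hh n; rewrite rk.
have busy n : `|bus x0 (y n) - r n * s| <= tau by have [_] := hh n.
have nfy n : nf (h n * gn n)%g = nf (gn n) by have [->] := hh n.
have dr n : `|mdist x0 (y n) - r n| <= tau.
  have d0 := mdist_ge0 x0 (y n).
  have e2 := dist_rhoX Mx0 (My n); rewrite rhoy exprMn kE in e2.
  set d := mdist x0 (y n) in d0 e2 *; set b := bus x0 (y n) in e2.
  have bd : `|b| <= d by exact: bus_le.
  have rs : `|r n * s| <= r n by rewrite normrM ger0_norm// ler_piMr// ltW.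
  have [dr0|dn0] := eqVneq (d + r n) 0.
    by have -> : d - r n = 0; [have := r0 n; lra|rewrite normr0 ltW].
  have dp : 0 < d + r n by rewrite lt_neqAle eq_sym dn0 addr_ge0.
  rewrite -(ler_pM2r dp) -{1}(gtr0_norm dp) -normrM -subr_sqr.
  have -> : d ^+ 2 - r n ^+ 2 = (b - r n * s) * (b + r n * s) by rewrite e2; ring.
  rewrite normrM; apply: ler_pM => //; first exact: busy.
  by apply: (le_trans (ler_normD _ _)); rewrite lerD.
have hslope n : `|bus x0 (y n) - s * mdist x0 (y n)| <= 2 * tau.
  have -> : bus x0 (y n) - s * mdist x0 (y n) =
    (bus x0 (y n) - r n * s) - s * (mdist x0 (y n) - r n) by ring.
  apply: (le_trans (ler_normB _ _)); rewrite normrM.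
  have := busy n; have := dr n; have := normr_ge0 (mdist x0 (y n) - r n).
  have := normr_ge0 s; nra.
have far B : exists N, forall n, (N <= n)%N -> B <= mdist x0 (y n).
  have [N0 hN0] := near_size B; have [n0 hn0] := hgn N0.+1.
  exists n0 => n /hn0[sz _]; rewrite leNgt; apply/negP => lt.
  have := hN0 (h n * gn n)%g; rewrite nfy => H.
  have := H _; rewrite leqNgt => /(_ _)/negP; apply=> //.
  by apply: near_dist; rewrite actionM ltW.
have [c [c0 cs hc]] := limit_slope My far hslope.
exists c; split=> // N.
have [A A0 hA] := path_bot N; have [A2 A20 hA2] := bot_near (2 * D + 1) N.
pose T := (A + A2 + D + 1) * 2 / k.
have Tk : T * (k / 2) = A + A2 + D + 1 by rewrite /T; field; rewrite gt_eqF.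
exists T => t g Tt t0 gD.
have ck : coslope c = k.
  by apply: sqr_inj; rewrite ?coslope_ge0X ?ltW// coslopeE// cs kE.
have tk : A + A2 + D + 1 <= t * (k / 2) by rewrite -Tk ler_wpM2r// divr_ge0// ltW.
have gfar : ~ near A2 x0 (act g x0).
  apply: (near_far gD); apply: ray_far => //; rewrite ck.
  by have : t * (k / 2) <= t * k; [rewrite ler_wpM2l//; lra|lra].
have [n0 hn0] := hgn N; have [N1 hN1] := far (2 * tau).
have [n [nn d0 td hd]] := hc t (maxn n0 N1) t0.
move: nn; rewrite geq_max => /andP[/hn0[sz eN] /hN1 d2].
set d := mdist x0 (y n) in d0 td hd d2.
have in01 u : 0 <= u <= d -> 0 <= u / d <= 1.
  by move=> /andP[u0 u1]; rewrite divr_ge0 ?(ltW d0)//= ler_pdivrMr ?mul1r.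
(* From time [t] on, [rho] from [x0] exceeds [A] along this segment, so [path_bot] carries the
   bottom at [y n] back to [P t], which is close to [c t]. *)
pose P u := geo_pt x0 (y n) (u / d).
have [g1 hg1] := D_cover (P t).
have Pd : P d = y n by rewrite /P divff ?gt_eqF// geo_pt1.
have [_ e1] : (N <= size (nf g1))%N /\ bot N (nf g1) = bot N (nf (h n * gn n)%g).
  apply: (hA P t d) => //; last by rewrite Pd actionM mdistxx.
    move=> u v /andP[u1 u2] /andP[v1 v2].
    rewrite /P geo_pt_dist//; [|by apply: in01; rewrite (le_trans t0)..].
    rewrite -mulrBl normrM normfV (gtr0_norm d0) -/d divfK// gt_eqF//.
  move=> u /andP[u1 u2]; have u0 := le_trans t0 u1.
  have u01 : 0 <= u / d <= 1 by apply: in01; rewrite u0.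
  have MP : M (P u) by exact: (minset_geo_pt stX z_iso tau_min).
  move=> /(near_rhoX Mx0 MP); apply/negP; rewrite -ltNge.
  have -> : rho x0 (P u) = u / d * (r n * k).
    have ud0 : 0 <= u / d by case/andP: u01.
    apply: sqr_inj; [exact: rho_ge0|by rewrite mulr_ge0// mulr_ge0// ltW|].
    have e2 := dist_rhoX Mx0 (My n); have e3 := dist_rhoX Mx0 MP.
    rewrite geo_pt_distl// bus_pt// in e3; rewrite -rhoy [RHS]exprMn.
    move: (u / d) e3 => a e3.
    have -> : rho x0 (P u) ^+ 2 =
        a ^+ 2 * mdist x0 (y n) ^+ 2 - (a * bus x0 (y n)) ^+ 2.
      by rewrite -exprMn e3; ring.
    by rewrite e2; ring.
  have h1 : d / 2 <= r n by have := dr n; rewrite -/d ler_norml; lra.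
  have h2 : u / d * (d / 2 * k) <= u / d * (r n * k).
    by apply: ler_wpM2l; [case/andP: u01|rewrite ler_wpM2r// ltW].
  have h3 : u / d * (d / 2 * k) = u * (k / 2) by field; rewrite gt_eqF.
  have h4 : t * (k / 2) <= u * (k / 2) by rewrite ler_wpM2r// divr_ge0// ltW.
  by lra.
have [sg' ->] : (N <= size (nf g))%N /\ bot N (nf g) = bot N (nf g1).
  apply: hA2 => //; apply: near_dist.
  have := metric_triangle (act g x0) (c t) (act g1 x0).
  have := metric_triangle (c t) (P t) (act g1 x0).
  by rewrite [mdist _ (c t)]metric_sym; move: hd; rewrite -/(P t); lra.
by split=> //; rewrite e1 nfy.
Qed.

Lemma sqr_norm1 (s : R) : (`|s| < 1) = (0 < 1 - s ^+ 2) :> bool.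
Proof.
rewrite subr_gt0 -(real_normK (num_real s)) -[X in _ = (_ < X)](expr1n _ 2).
by rewrite ltr_pXn2r// ?nnegrE.
Qed.

Lemma norm_lt1_near (s s' : R) : `|s - s'| < 1 - `|s| -> `|s'| < 1.
Proof. by have := lerB_dist s' s; rewrite distrC; lra. Qed.

Lemma coslope_gt0 (c : geodesic_ray X) : c 0 = x0 -> (0 < coslope c) = (`|slope c| < 1).
Proof.
move=> c0; rewrite sqr_norm1 -coslopeE//.
by rewrite exprn_even_gt0//= lt_neqAle coslope_ge0X andbT eq_sym.
Qed.

(** Rays start at [x0], in the minimal set, while [b] fixes the topology. At a pole [e] is
    arbitrary. *)
Definition ray_code b (xi : visual_boundary b) (s : R) e := exists c : geodesic_ray X,
  [/\ c 0 = x0, endpoint b c = xi, slope c = s & `|s| < 1 -> has_end c e].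

Definition valid_code (s : R) e := `|s| <= 1 /\ (`|s| < 1 -> valid_end e).

Lemma ray_code_close (c : geodesic_ray X) e r d : c 0 = x0 -> 0 <= r -> 0 < d ->
  (`|slope c| < 1 -> has_end c e) -> exists N, exists2 d', 0 < d' &
  forall (c' : geodesic_ray X) e', c' 0 = x0 -> `|slope c - slope c'| < d' ->
  (`|slope c'| < 1 -> has_end c' e') -> (`|slope c| < 1 -> e N = e' N) ->
  mdist (c r) (c' r) < d.
Proof.
move=> c0 r0 d0 ce.
have [k0|] := boolP (0 < coslope c); last first.
  rewrite lt_neqAle coslope_ge0X andbT negbK eq_sym => /eqP k0.
  have [d' d'0 h] := code_in_pole c0 r0 d0 k0.
  by exists 0%N, d' => // c' e' c'0 + _ _; exact: h.
have s1 : `|slope c| < 1 by rewrite -coslope_gt0.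
have [N [d' d'0 h]] := code_in c0 r0 d0 k0 (ce s1).
(* The second bound keeps [c'] away from the poles, so that [e'] is really its end. *)
exists N, (Num.min d' (1 - `|slope c|)); first by rewrite lt_min d'0 subr_gt0.
move=> c' e' c'0; rewrite lt_min => /andP[h1 h2] ce' ee'.
apply: (h c' e') => //; last exact: ee'.
by apply: ce'; exact: norm_lt1_near h2.
Qed.

Lemma ray_code_coding b : coding valid_code (@ray_code b).
Proof.
split.
- move=> xi; have [c c0 cxi] := endpoint_from stX prX x0 xi.
  have [k0|k0] := boolP (0 < coslope c).
    by have [e ce] := end_exists c0 k0; exists (slope c), e, c.
  exists (slope c), (fun=> [::]), c; split=> //.
  by rewrite -coslope_gt0// (negbTE k0).
- move=> xi s e [c [c0 _ <- ce]]; split; first exact: slope_le.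
  by move=> s1; apply: end_valid; exact: ce.
- move=> s e [s1 ve].
  have [s_lt1|s_ge1] := ltP `|s| 1.
    have [c [c0 cs ce]] := end_realized s_lt1 (ve s_lt1).
    by exists (endpoint b c), c.
  have e1 : `|s| = 1 by apply/eqP; rewrite eq_le s1.
  have [|c [c0 cs]] := @pole_exists s.
    by rewrite -(real_normK (num_real s)) e1 expr1n.
  exists (endpoint b c), c; split=> //.
  by rewrite e1 ltxx.
- move=> xi xi' s e e' [c [c0 <- cs ce]] [c' [c'0 <- cs' ce']] ee'.
  apply/endpointP; exists 0 => r r0; apply/ler_addgt0Pl => d d0; rewrite addr0.
  rewrite -cs in ce ce' ee'.
  have [N [d' d'0 h]] := ray_code_close c0 r0 d0 ce.
  apply/ltW/(h c' e'); rewrite ?cs' ?cs ?subrr ?normr0// => s1.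
    by apply: ce'; rewrite cs.
  by rewrite ee'// cs.
- move=> xi s e N d [c [c0 cxi cs ce]] d0.
  pose d1 := if `|s| < 1 then Num.min d (1 - `|s|) else d.
  have d10 : 0 < d1 by rewrite /d1; case: ifP => // s1; rewrite lt_min d0 subr_gt0.
  have [r [d' [r0 d'0] h]] := code_out N c0 d10.
  have [t t0 ht] := rebase_time stX b x0 (ltW r0) d'0.
  have [cb cb0 cbxi] := endpoint_from stX prX b xi.
  apply: (@filterS _ _ _ (cone_nbhd b cb t 1)); last first.
    apply: cone_subbase_nbhs; first by exists cb, t, 1.
    by exists cb => //=; split=> //; rewrite mdistxx.
  move=> xi' [cb' [cb'0 hcb']] cb'xi' s' e' [c' [c'0 c'xi' cs' ce']].
  have a1 : asymptotic cb c by apply/(endpointP b); rewrite cbxi.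
  have a2 : asymptotic cb' c' by apply/(endpointP b); rewrite cb'xi'.
  have [h1 h2] := h c' c'0 (ht _ _ _ _ a1 a2 cb0 cb'0 c0 c'0 hcb').
  rewrite cs cs' in h1; split.
    by apply: (lt_le_trans h1); rewrite /d1; case: ifP => // _; rewrite ge_min lexx.
  move=> s1; apply: h2; [by rewrite coslope_gt0// cs|exact: ce|apply: ce'].
  by apply: (@norm_lt1_near s); move: h1; rewrite /d1 s1 lt_min => /andP[].
- move=> xi s e U [c [c0 cxi cs ce]].
  (* The filter of sets that contain all points with codes close to [(s, e)]; by [nbhs_cone], only
     subbasic sets must be shown to belong to it. *)
  pose F : set_system (visual_boundary b) := [set V | exists N, exists2 d, 0 < d &
    forall eta s' e', ray_code eta s' e' -> `|s - s'| < d ->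
    (`|s| < 1 -> forall n, (n <= N)%N -> e n = e' n) -> V eta].
  have FF : Filter F.
    split.
    - by exists 0%N, 1.
    - move=> V W [N [d d0 hV]] [N' [d' d'0 hW]].
      exists (maxn N N'), (Num.min d d'); first by rewrite lt_min d0.
      move=> y s' e' yc; rewrite lt_min => /andP[h1 h2] h3; split.
        by apply: hV yc h1 _ => s1 n nN; apply: h3 => //; rewrite leq_max nN.
      by apply: hW yc h2 _ => s1 n nN; apply: h3 => //; rewrite leq_max nN orbT.
    - move=> V W VW [N [d d0 hV]]; exists N, d => // y s' e' yc h1 h2.
      by apply: VW; exact: hV yc h1 h2.
  move: U; apply: (@nbhs_cone _ _ _ xi F FF) => V [cb [r [d [cb0 r0 d0 ->]]]].
  move=> [c1 [c10 hc1]] c1xi.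
  (* The subbasic set is centred at [cb] rather than at [xi], which leaves this margin. *)
  have sl : 0 < d - mdist (cb r) (c1 r) by rewrite subr_gt0.
  have [t t0 ht] := rebase_time stX x0 b (ltW r0) sl.
  rewrite -cs in ce.
  have [N [d' d'0 h]] := ray_code_close c0 (ltW t0) ltr01 ce.
  exists N, d' => // xi' s' e' [c' [c'0 c'xi' cs' ce']] ss' ee'.
  have [c1' c1'0 c1'xi'] := endpoint_from stX prX b xi'.
  exists c1' => //=; split=> //.
  have a1 : asymptotic c c1 by apply/(endpointP b); rewrite cxi.
  have a2 : asymptotic c' c1' by apply/(endpointP b); rewrite c'xi'.
  have cc' : mdist (c t) (c' t) < 1.
    by apply: (h c' e') => //; rewrite ?cs ?cs'// => s1; exact: ee'.
  have := ht _ _ _ _ a1 a2 c0 c'0 c10 c1'0 cc'.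
  by have := metric_triangle (cb r) (c1 r) (c1' r); lra.
Qed.

End Orbit.

Lemma boundary_coding (b : X) : exists code : visual_boundary b -> R -> (nat ->
  seq S) -> Prop,
  coding valid_code code.
Proof.
have [x0 [tau tau0 [tau_min Mx0]]] := axis_exists.
have [D D0 D_cover] := orbit_cobounded x0.
by exists (ray_code x0 tau D (b := b)); exact: ray_code_coding.
Qed.

End GeometricAction.

(** * The Bass-Serre tree times a line *)

Section TreeDistance.
Variable R : realType.
Implicit Types (x y : bool) (i j : nat) (w v : seq (bool * nat)) (t u : R).

(* The edge [w] of the Bass-Serre tree of [Z/p * Z/q] is a copy of [0, 1] whose
   end [0] lies at the coset vertex of [gen true] and whose end [1] at the coset
   vertex of [gen false]. *)
Definition edge_pos x t : R := if x then t else 1 - t.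

(* Distance of the point [t] of the edge [w] to the end [x] of the edge [[::]]. *)
Fixpoint vdist x w t : R :=
  if w is (y, _) :: w' then (y != x)%:R + vdist y w' t else edge_pos x t.

Fixpoint tdist w t v u : R := match w, v with
  | [::], [::] => `|t - u|
  | [::], (x, _) :: v' => edge_pos x t + vdist x v' u
  | (x, _) :: w', [::] => edge_pos x u + vdist x w' t
  | (x, i) :: w', (y, j) :: v' =>
    if x == y then
      if i == j then tdist w' t v' u else vdist x w' t + vdist x v' u
    else vdist x w' t + 1 + vdist y v' u
  end.

Lemma edge_pos_itv x t : 0 <= t <= 1 -> 0 <= edge_pos x t <= 1.
Proof. by case: x => /=; lra. Qed.

Lemma vdist_ge0 x w t : 0 <= t <= 1 -> 0 <= vdist x w t.
Proof.
move=> t01; elim: w x => [|[y i] w IHw] x /=; first by case/andP: (edge_pos_itv x t01).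
by rewrite addr_ge0.
Qed.

Lemma tdistC w t v u : tdist w t v u = tdist v u w t.
Proof.
elim: w v => [|[x i] w IHw] [|[y j] v] //=; first by rewrite distrC.
rewrite eq_sym [j == i]eq_sym; case: eqP => [->|_]; last by ring.
by case: eqP => // _; rewrite addrC.
Qed.

Lemma tdistxx w t : tdist w t w t = 0.
Proof. by elim: w => [|[x i] w IHw] /=; rewrite ?subrr ?normr0// !eqxx. Qed.

Lemma tdist_le_vdist x w t v u : 0 <= t <= 1 -> 0 <= u <= 1 ->
  tdist w t v u <= vdist x w t + vdist x v u.
Proof.
move=> t01 u01; elim: w v x => [|[y i] w IHw] [|[y' j] v] x /=.
- by rewrite ler_norml /edge_pos; case: x; lra.
- by case: x; case: y' => /=; rewrite /edge_pos; lra.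
- by case: x; case: y => /=; rewrite /edge_pos; lra.
- have [<-|yy'] := eqVneq y y'.
    have [_|_] := eqVneq i j; first by have := IHw v y; case: (y != x) => /=; lra.
    by case: (y != x) => /=; lra.
  by case: x y y' yy' => [] [] [] //=; lra.
Qed.

Lemma vdist_le_tdist x w t v u : 0 <= t <= 1 -> 0 <= u <= 1 ->
  vdist x w t <= vdist x v u + tdist w t v u.
Proof.
move=> t01 u01; elim: w v x => [|[y i] w IHw] [|[y' j] v] x /=.
- have h1 := ler_norm (t - u); have h2 := ler_norm (u - t); rewrite distrC in h2.
  by rewrite /edge_pos; case: x; lra.
- by have := vdist_ge0 y' v u01; case: x; case: y' => /=; rewrite /edge_pos; lra.
- by have := vdist_ge0 y w t01; case: x; case: y => /=; rewrite /edge_pos; lra.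
- have hv := vdist_ge0 y' v u01; have hw := vdist_ge0 y w t01.
  have [e|yy'] := eqVneq y y'.
    rewrite -e in hv *.
    have [_|_] := eqVneq i j; first by have := IHw v y; case: (y != x) => /=; lra.
    by case: (y != x) => /=; lra.
  by case: x y y' yy' hv hw => [] [] [] //=; lra.
Qed.

(** Twice the Gromov product at the end [x] of the edge [[::]], that is, twice the length shared by
    the two geodesics from there. *)
Definition gromov x w t v u := vdist x w t + vdist x v u - tdist w t v u.

Lemma gromov_ge0 x w t v u : 0 <= t <= 1 -> 0 <= u <= 1 -> 0 <= gromov x w t v u.
Proof. by move=> t01 u01; rewrite subr_ge0 tdist_le_vdist. Qed.

Lemma gromov_cons x y i w t v u :
  gromov x ((y, i) :: w) t ((y, i) :: v) u = 2 * (y != x)%:R + gromov y w t v u.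
Proof. by rewrite /gromov /= !eqxx; ring. Qed.

Lemma gromov_head_neq x y i y' j w t v u : (y, i) != (y', j) ->
  gromov x ((y, i) :: w) t ((y', j) :: v) u = 2 * ((y != x) && (y' != x))%:R.
Proof.
rewrite xpair_eqE /gromov /=; case: eqP => [<-|/eqP yy'] /=.
  by move=> /negbTE ->; case: eqP => //= _; ring.
by move=> _; case: x y y' yy' => [] [] [] //= _; ring.
Qed.

Lemma gromov_nil_cons x y i t v u :
  gromov x [::] t ((y, i) :: v) u = 2 * (y != x)%:R * edge_pos x t.
Proof. by rewrite /gromov /=; case: x; case: y => /=; ring. Qed.

Lemma gromovC x w t v u : gromov x w t v u = gromov x v u w t.
Proof. by rewrite /gromov tdistC; ring. Qed.

Definition same_head w v :=
  if w is l :: _ then if v is l' :: _ then l == l' else false else false.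

(** The length of the edge [[::]] covered by the geodesic from its end [x] to the point. *)
Definition first_step x w t : R := if w is (y, _) :: _ then (y != x)%:R else edge_pos x t.

Lemma gromov_diverging x w t v u : 0 <= t <= 1 -> 0 <= u <= 1 -> ~~ same_head w v ->
  gromov x w t v u = 2 * Num.min (first_step x w t) (first_step x v u).
Proof.
move=> t01 u01.
have H z r (b : bool) : 0 <= r <= 1 -> Num.min (edge_pos z r) b%:R = b%:R * edge_pos z r.
  move=> r01; have /andP[e0 e1] := edge_pos_itv z r01.
  by case: b; rewrite ?mul1r ?mul0r; [rewrite min_l|rewrite min_r].
case: w v => [|[y i] w] [|[y' j] v] /= hd.
- rewrite /gromov /=; have [tu|/ltW tu] := leP t u.
    rewrite ler0_norm ?subr_le0//; case: x => /=; first by rewrite min_l//; lra.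
    by rewrite min_r; lra.
  rewrite ger0_norm ?subr_ge0//; case: x => /=; first by rewrite min_r//; lra.
  by rewrite min_l; lra.
- by rewrite gromov_nil_cons H//; ring.
- by rewrite gromovC gromov_nil_cons minC H//; ring.
- rewrite gromov_head_neq//; congr (2 * _).
  by case: (y != x); case: (y' != x); rewrite /= ?minxx// /Num.min ?ltr01 ?ltr10.
Qed.

Lemma first_step_same_head x w t v u : same_head w v ->
  first_step x w t = first_step x v u.
Proof. by case: w v => [|[y i] w] [|[y' j] v] //= /eqP[-> _]. Qed.

Lemma same_head_trans w v r : same_head w v -> same_head w r = same_head v r.
Proof. by case: w v => [|l w] [|l' v] //= /eqP ->. Qed.

(** Common head letters are stripped by induction; for diverging words the product is a minimum of
    first steps, and minima are ultrametric. *)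
Lemma gromov_ultra x w1 t1 w2 t2 w3 t3 :
  0 <= t1 <= 1 -> 0 <= t2 <= 1 -> 0 <= t3 <= 1 ->
  Num.min (gromov x w1 t1 w2 t2) (gromov x w2 t2 w3 t3) <= gromov x w1 t1 w3 t3.
Proof.
move=> h1 h2 h3; elim: w1 w2 w3 x => [|[y i] w1 IHw] w2 w3 x.
  rewrite [leRHS]gromov_diverging// [gromov _ [::] _ _ _]gromov_diverging//.
  have [s23|n23] := boolP (same_head w2 w3).
    by rewrite (first_step_same_head x t2 t3 s23) ge_min lexx.
  rewrite [gromov x w2 _ _ _]gromov_diverging// -minr_pMr//.
  by rewrite ler_pM2l// le_min !ge_min !lexx ?orbT.
have [s13|n13] := boolP (same_head ((y, i) :: w1) w3); last first.
  rewrite [leRHS]gromov_diverging//.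
  have [s12|n12] := boolP (same_head ((y, i) :: w1) w2).
    rewrite [X in Num.min _ X]gromov_diverging//;
      last by rewrite -(same_head_trans _ s12).
    by rewrite (first_step_same_head x t1 t2 s12) ge_min lexx orbT.
  rewrite [X in Num.min X _]gromov_diverging//.
  have [s23|n23] := boolP (same_head w2 w3).
    by rewrite (first_step_same_head x t2 t3 s23) ge_min lexx.
  rewrite [gromov x w2 _ _ _]gromov_diverging// -minr_pMr//.
  by rewrite ler_pM2l// le_min !ge_min !lexx ?orbT.
have [s12|n12] := boolP (same_head ((y, i) :: w1) w2).
  case: w3 s13 => [//|l w3] /eqP <-; case: w2 s12 => [//|l' w2] /eqP <-.
  by rewrite !gromov_cons -addr_minr lerD2l; exact: IHw.
rewrite [X in Num.min X _]gromov_diverging// ge_min; apply/orP; left.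
case: w3 s13 => [//|l w3] /eqP <-; rewrite gromov_cons /=.
apply: (@le_trans _ _ (2 * (y != x)%:R)); last by rewrite lerDl gromov_ge0.
by rewrite ler_pM2l// ge_min lexx.
Qed.

End TreeDistance.

(** * Geodesics and Stewart's inequality in the tree *)

Section TreePoint.
Variable R : realType.
Implicit Types (x y : bool) (w v m : seq (bool * nat)) (t u s r : R).

Lemma gromov_ultra_or x w1 t1 w2 t2 w3 t3 :
  0 <= t1 <= 1 -> 0 <= t2 <= 1 -> 0 <= t3 <= 1 ->
  gromov x w1 t1 w2 t2 <= gromov x w1 t1 w3 t3 \/
  gromov x w2 t2 w3 t3 <= gromov x w1 t1 w3 t3 :> R.
Proof.
move=> h1 h2 h3; have := gromov_ultra x w1 w2 w3 h1 h2 h3.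
by rewrite ge_min => /orP.
Qed.

Lemma tdist_triangle w1 t1 w2 t2 w3 t3 :
  0 <= t1 <= 1 -> 0 <= t2 <= 1 -> 0 <= t3 <= 1 ->
  tdist w1 t1 w3 t3 <= tdist w1 t1 w2 t2 + tdist w2 t2 w3 t3.
Proof.
move=> h1 h2 h3; have := gromov_ultra_or true w1 w2 w3 h1 h2 h3; rewrite /gromov.
have := vdist_le_tdist true w3 w2 h3 h2; have := vdist_le_tdist true w1 w2 h1 h2.
by rewrite [tdist w3 _ _ _]tdistC => a b [] c; lra.
Qed.

Lemma tdist_ge0 w t v u : 0 <= t <= 1 -> 0 <= u <= 1 -> 0 <= tdist w t v u.
Proof.
move=> h1 h2; have := tdist_triangle w v w h1 h2 h1.
by rewrite tdistxx [tdist v _ _ _]tdistC; lra.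
Qed.

(** The geodesic to the vertex [x] only crosses edges named by prefixes of [w], which are again
    reduced. *)
Lemma descend x w t s : 0 <= t <= 1 -> 0 <= s <= vdist x w t -> exists k r,
  [/\ 0 <= r <= 1, vdist x (take k w) r = s & tdist w t (take k w) r = vdist x w t - s].
Proof.
move=> t01; elim: w x s => [|[y i] w IHw] x s /= hs.
  have hx := edge_pos_itv x t01.
  have [r [r01 rs]] : exists r, 0 <= r <= 1 /\ edge_pos x r = s.
    by case: x hs hx => /= hs hx; [exists s|exists (1 - s)]; lra.
  exists 0%N, r; split=> //=; rewrite -rs.
  case: x hs hx rs => /= hs hx rs; first by rewrite ger0_norm//; lra.
  by rewrite ler0_norm//; lra.
have [hs'|hs'] := leP (y != x)%:R s.
  have [|k [r [r01 e1 e2]]] := IHw y (s - (y != x)%:R); first by lra.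
  exists k.+1, r; split=> //=; first by rewrite e1; ring.
  by rewrite !eqxx e2; ring.
have yx : y != x by move: hs'; case: (y != x) => //=; lra.
rewrite yx /= in hs hs' *.
exists 0%N, (if x then s else 1 - s); rewrite /=; split.
- by case: (x); lra.
- by case: x yx {hs} => yx /=; lra.
- by case: x y yx {hs} => [] [] //= _; lra.
Qed.

(** The last clause says that from any point the geodesic to one of the two ends passes through
    [(m, r)]. *)
Definition on_segment w t v u s m r := [/\ 0 <= r <= 1,
  (exists k, m = take k w \/ m = take k v),
  tdist w t m r = s, tdist m r v u = tdist w t v u - s & forall v' u', 0 <= u' <= 1 ->
  tdist v' u' m r <= tdist v' u' w t - s \/
  tdist v' u' m r <= tdist v' u' v u - (tdist w t v u - s)].

Lemma tree_point w t v u s : 0 <= t <= 1 -> 0 <= u <= 1 ->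
  0 <= s <= tdist w t v u -> exists m r, on_segment w t v u s m r.
Proof.
move=> t01 u01 hs.
(* [H] treats the points between the first end and the place where the geodesics to the vertex
   [true] meet; the others are reached from the second end. *)
have H w' t' v' u' s' : 0 <= t' <= 1 -> 0 <= u' <= 1 -> 0 <= s' ->
    gromov true w' t' v' u' <= 2 * (vdist true w' t' - s') ->
    exists m r, on_segment w' t' v' u' s' m r.
  move=> {s hs}t01' u01' s0 hg.
  have g0 := gromov_ge0 true w' v' t01' u01'.
  have [|k [r [r01 e1 e2]]] := @descend true w' t' (vdist true w' t' - s') t01';
    first by lra.
  set m := take k w' in e1 e2.
  have gPM : gromov true w' t' m r = 2 * (vdist true w' t' - s').
    by rewrite /gromov e1 e2; ring.
  have gMQ : gromov true m r v' u' = gromov true w' t' v' u'.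
    apply/eqP; rewrite eq_le; apply/andP; split.
      have [h|//] := gromov_ultra_or true w' m v' t01' r01 u01'.
      have := vdist_le_tdist true m v' r01 u01'; have :=
        vdist_le_tdist true v' m u01' r01.
      by rewrite [tdist v' _ _ _]tdistC gPM /gromov e1 in h * => *; lra.
    have [h|h] := gromov_ultra_or true m w' v' r01 t01' u01' => //.
    by move: h; rewrite [gromov true m _ w' _]gromovC gPM => /(le_trans hg).
  exists m, r; split=> //.
  - by exists k; left.
  - by rewrite e2; ring.
  - by move: gMQ; rewrite /gromov e1; lra.
  - move=> n q q01.
    have [a|/ltW a] := leP (2 * (vdist true w' t' - s')) (gromov true n q w' t').
      have h1 : 2 * (vdist true w' t' - s') <= gromov true n q m r.
        by have := gromov_ultra_or true n w' m q01 t01' r01; rewrite gPM => -[] h; lra.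
      have := gromov_ultra_or true w' n v' t01' q01 u01'.
      rewrite [gromov true w' _ n _]gromovC => -[] h; [left|right].
        by move: h1 h a hg; rewrite /gromov e1; lra.
      by move: h1 h; rewrite /gromov e1; lra.
    left; have h1 : gromov true n q w' t' <= gromov true n q m r.
      by have := gromov_ultra_or true n w' m q01 t01' r01; rewrite gPM => -[] h; lra.
    by move: h1; rewrite /gromov e1; lra.
have [hg|hg] := leP (gromov true w t v u) (2 * (vdist true w t - s)).
  by apply: H => //; case/andP: hs.
have [||m [r [r01 [k mk] d1 d2 d3]]] := H v u w t (tdist w t v u - s) u01 t01.
- by lra.
- by rewrite gromovC; move: hg; rewrite /gromov; lra.
exists m, r; split=> //.
- by exists k; case: mk => ->; [right|left].
- by rewrite tdistC d2 [tdist v _ _ _]tdistC; ring.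
- by rewrite tdistC d1.
- move=> v' u' u'01; have := d3 v' u' u'01; rewrite [tdist v u w t]tdistC => -[] h;
  [right|left] => //.
  by lra.
Qed.

(** When [d <= A - s * l], the gap is at least [s * (B ^ 2 - (A - l) ^ 2)], nonnegative by the
    triangle inequality; the other case is symmetric. *)
Lemma tree_stewart w t v u s m r v' u' : 0 <= t <= 1 -> 0 <= u <= 1 -> 0 <= u' <= 1 ->
  0 <= s <= 1 -> on_segment w t v u (s * tdist w t v u) m r ->
  tdist v' u' m r ^+ 2 <= (1 - s) * tdist v' u' w t ^+ 2 + s * tdist v' u' v u ^+ 2
    - s * (1 - s) * tdist w t v u ^+ 2.
Proof.
move=> t01 u01 u'01 /andP[s0 s1] [r01 _ _ _ /(_ v' u' u'01)].
have a1 := tdist_triangle w v' v t01 u'01 u01.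
have a2 := tdist_triangle v' w v u'01 t01 u01.
have a3 := tdist_triangle v' v w u'01 u01 t01.
rewrite [tdist w t v' u']tdistC in a1; rewrite [tdist v u w t]tdistC in a3.
have b0 := tdist_ge0 v' m u'01 r01.
have b1 := tdist_ge0 v' w u'01 t01; have b2 := tdist_ge0 v' v u'01 u01.
have b3 := tdist_ge0 w v t01 u01.
set d := tdist v' u' m r in b0 *; set A := tdist v' u' w t in a1 a2 a3 b1 *.
set B := tdist v' u' v u in a1 a2 a3 b2 *; set l := tdist w t v u in a1 a2 a3 b3 *.
move=> h; have sq (a b : R) : 0 <= a -> a <= b -> a ^+ 2 <= b ^+ 2.
  by move=> a0 ab; rewrite ler_pXn2r ?nnegrE//; exact: le_trans ab.
have p1 : 0 <= (B - (A - l)) * (B + (A - l)) by rewrite mulr_ge0; lra.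
have p2 : 0 <= (A - (B - l)) * (A + (B - l)) by rewrite mulr_ge0; lra.
case: h => h; apply: (le_trans (sq _ _ b0 h)).
  by have := mulr_ge0 s0 p1; lra.
have : 0 <= 1 - s by lra.
by move=> s0'; have := mulr_ge0 s0' p2; lra.
Qed.

End TreePoint.

(** * The group acts on the tree by isometries *)

Section TreeAction.
Variables (R : realType) (p q : nat).
Hypotheses (p_gt0 : (0 < p)%N) (q_gt0 : (0 < q)%N).
Implicit Types (x y : bool) (w v : seq (bool * nat)) (t u : R).
Local Notation reduced := (reduced p q).

Lemma reduced_take k w : reduced w -> reduced (take k w).
Proof.
elim: w k => [|[x i] w IHw] [|k] //= /and3P[-> sw /IHw ->]; rewrite andbT.
by case: w k sw {IHw} => [|[y j] w] [|k].
Qed.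

(** At the vertex [x] the top exponent of [x] names the branch, with 0 for words not starting with
    [x]. In this form a turn visibly permutes the branches. *)
Lemma tdist_untop x w t v u : reduced w -> reduced v -> tdist w t v u =
  if top_exp x w == top_exp x v then tdist (untop x w) t (untop x v) u
  else vdist x (untop x w) t + vdist x (untop x v) u.
Proof.
have ex (w' : seq (bool * nat)) (y : bool) i : reduced ((y, i) :: w') -> i != 0%N.
  by move=> /= /and3P[/andP[i0 _] _ _]; rewrite -lt0n.
case: w => [|[y i] w]; case: v => [|[y' j] v] //=.
- by move=> _ /ex j0; have [->|_] := eqVneq y' x; rewrite //= eq_sym (negbTE j0).
- by move=> /ex i0 _; have [->|_] := eqVneq y x; rewrite //= (negbTE i0) addrC.
- move=> /ex i0 /ex j0.
  case: x; case: y; case: y' => //=;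
    rewrite ?(negbTE i0) ?[0%N == j]eq_sym ?(negbTE j0) /= ?eqxx //; ring.
Qed.

Lemma tdist_turn x k w t v u : reduced w -> reduced v ->
  tdist (turn p q x k w) t (turn p q x k v) u = tdist w t v u.
Proof.
move=> rw rv; have rtw := reduced_turn p_gt0 q_gt0 x k rw.
have rtv := reduced_turn p_gt0 q_gt0 x k rv.
rewrite (tdist_untop x t u rtw rtv) (tdist_untop x t u rw rv).
rewrite (untop_turn x k rw) (untop_turn x k rv).
rewrite (top_exp_turn x k rw) (top_exp_turn x k rv).
rewrite eqn_modDr !modn_small//; exact: top_exp_lt.
Qed.

Lemma tdist_stack_act g w t v u : reduced w -> reduced v ->
  tdist (stack_act (q := q) (p := p) g w) t (stack_act g v) u = tdist w t v u.
Proof.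
elim/knot_ind: g w v => [|x g IHg|x g IHg] w v rw rv.
- by rewrite !stack_act1.
- rewrite !stack_actM// -[gen p q x]expg1 !stack_act_gen//; [|exact: stack_act_reduced..].
  by rewrite tdist_turn ?IHg//; exact: stack_act_reduced.
- rewrite !stack_actM// -[RHS]IHg//.
  have ra := stack_act_reduced p_gt0 q_gt0 g rw; have rb :=
    stack_act_reduced p_gt0 q_gt0 g rv.
  have rc := stack_act_reduced p_gt0 q_gt0 (gen p q x)^-1%g ra.
  have rd := stack_act_reduced p_gt0 q_gt0 (gen p q x)^-1%g rb.
  rewrite -(tdist_turn x 1 t u rc rd) -!(stack_act_gen p_gt0 q_gt0)// expg1.
  by rewrite -!stack_actM// mulgV !mul1g.
Qed.

Lemma size_le_vdist x w t : 0 <= t <= 1 -> reduced w -> ~~ starts x w ->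
  (size w)%:R <= vdist x w t.
Proof.
move=> t01; elim: w x => [|[y i] w IHw] x /=; first by case/andP: (edge_pos_itv x t01).
move=> /and3P[_ sw rw] ->.
by have := IHw y rw sw; rewrite -[(size w).+1%:R]natr1 /=; lra.
Qed.

Lemma size_le_tdist t w u : 0 <= t <= 1 -> 0 <= u <= 1 -> reduced w ->
  (size w)%:R <= tdist [::] t w u + 1.
Proof.
move=> t01 u01; case: w => [|[x i] w] /= => [_|/and3P[_ sw rw]].
  by rewrite addr_ge0.
have := size_le_vdist u01 rw sw; have /andP[] := edge_pos_itv x t01.
by rewrite -[(size w).+1%:R]natr1; lra.
Qed.

End TreeAction.

(** * Identifying points at distance zero, as for the several edge names of one vertex *)

Section MetricQuotient.
Variables (R : realType) (T : choiceType) (d : T -> T -> R).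
Hypotheses (d_refl : forall x, d x x = 0) (d_sym : forall x y, d x y = d y x).
Hypothesis d_tri : forall x y z, d x z <= d x y + d y z.

Let d_ge0 x y : 0 <= d x y.
Proof. by have := d_tri x y x; rewrite d_refl [d y x]d_sym; lra. Qed.

Let null_dist x y := d x y == 0.

Let null_dist_refl : reflexive null_dist.
Proof. by move=> x; rewrite /null_dist d_refl. Qed.

Let null_dist_sym : symmetric null_dist.
Proof. by move=> x y; rewrite /null_dist d_sym. Qed.

Let null_dist_trans : transitive null_dist.
Proof.
move=> y x z /eqP xy /eqP yz; apply/eqP/le_anti; rewrite d_ge0 andbT.
by have := d_tri x y z; rewrite xy yz addr0.
Qed.

Definition null_dist_rel :=
  EquivRel null_dist null_dist_refl null_dist_sym null_dist_trans.

Definition metric_quotient : Type := {eq_quot null_dist_rel}.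

HB.instance Definition _ := Choice.copy metric_quotient {eq_quot null_dist_rel}.

Definition quotient_class (x : T) : metric_quotient := \pi_{eq_quot null_dist_rel} x.

Let quotient_repr (a : metric_quotient) : T := repr (a : {eq_quot null_dist_rel}).

Let quotient_reprK a : quotient_class (quotient_repr a) = a.
Proof. exact: reprK. Qed.

Let quotient_classP x y : quotient_class x = quotient_class y <-> d x y = 0.
Proof.
rewrite /quotient_class; split; first by move/eqP; rewrite eqmodE => /eqP.
by move=> xy; apply/eqP; rewrite eqmodE; apply/eqP.
Qed.

Lemma quotient_class_surj a : exists x, a = quotient_class x.
Proof. by exists (quotient_repr a); rewrite quotient_reprK. Qed.

Let quotient_dist (a b : metric_quotient) := d (quotient_repr a) (quotient_repr b).

Let quotient_distE x y : quotient_dist (quotient_class x) (quotient_class y) = d x y.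
Proof.
have e u : d (quotient_repr (quotient_class u)) u = 0 by apply/quotient_classP.
rewrite /quotient_dist; set x' := quotient_repr _; set y' := quotient_repr _.
have ex : d x' x = 0 := e x; have ey : d y' y = 0 := e y.
have := d_tri x' x y'; have := d_tri x y y'; have := d_tri x x' y; have := d_tri x' y' y.
by rewrite [d x x']d_sym [d y y']d_sym ex ey => *; apply/le_anti; lra.
Qed.

Let quotient_distxx a : quotient_dist a a = 0.
Proof. exact: d_refl. Qed.

Let quotient_dist_pos a b : quotient_dist a b = 0 -> a = b.
Proof. by move=> /quotient_classP; rewrite !quotient_reprK. Qed.

Let quotient_dist_sym a b : quotient_dist a b = quotient_dist b a.
Proof. exact: d_sym. Qed.

Let quotient_dist_tri b a c : quotient_dist a c <= quotient_dist a b + quotient_dist b c.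
Proof. exact: d_tri. Qed.

HB.instance Definition _ := isMetric.Build R metric_quotient
  quotient_distxx quotient_dist_pos quotient_dist_sym quotient_dist_tri.

Lemma mdist_quotient_class x y : mdist (quotient_class x) (quotient_class y) = d x y.
Proof. exact: quotient_distE. Qed.

End MetricQuotient.

(** * The product of the tree with a line *)

Section TreeLine.
Variables (R : realType) (p q : nat).

Definition tree_line_point : Type :=
  {x : seq (bool * nat) * R * R | reduced p q x.1.1 && (0 <= x.1.2 <= 1)}.

HB.instance Definition _ := Choice.on tree_line_point.

Implicit Types (a b c : tree_line_point).

Definition tdist_point a b := tdist (val a).1.1 (val a).1.2 (val b).1.1 (val b).1.2.

Definition tree_line_dist a b :=
  Num.sqrt (tdist_point a b ^+ 2 + ((val a).2 - (val b).2) ^+ 2).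

Let itv a : 0 <= (val a).1.2 <= 1.
Proof. by case/andP: (valP a). Qed.

Lemma tdist_point_ge0 a b : 0 <= tdist_point a b.
Proof. exact: tdist_ge0. Qed.

Lemma tree_line_dist_ge0 a b : 0 <= tree_line_dist a b.
Proof. exact: sqrtr_ge0. Qed.

Lemma tree_line_dist_sqr a b :
  tree_line_dist a b ^+ 2 = tdist_point a b ^+ 2 + ((val a).2 - (val b).2) ^+ 2.
Proof. by rewrite sqr_sqrtr// addr_ge0// sqr_ge0. Qed.

Lemma tree_line_dist_refl a : tree_line_dist a a = 0.
Proof. by rewrite /tree_line_dist /tdist_point tdistxx subrr expr0n addr0 sqrtr0. Qed.

Lemma tree_line_dist_sym a b : tree_line_dist a b = tree_line_dist b a.
Proof. by rewrite /tree_line_dist /tdist_point tdistC -(sqrrN (_ - _)) opprB. Qed.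

Lemma tree_line_dist_tri a b c :
  tree_line_dist a c <= tree_line_dist a b + tree_line_dist b c.
Proof.
apply: sqr_le; first by rewrite addr_ge0 ?tree_line_dist_ge0.
rewrite [leLHS]tree_line_dist_sqr.
have := tree_line_dist_sqr a b; have := tree_line_dist_sqr b c.
have -> : (val a).2 - (val c).2 =
  ((val a).2 - (val b).2) + ((val b).2 - (val c).2) by ring.
have t : tdist_point a c <= tdist_point a b + tdist_point b c by exact: tdist_triangle.
have := tdist_point_ge0 a b; have := tdist_point_ge0 b c; have := tdist_point_ge0 a c.
have := tree_line_dist_ge0 a b; have := tree_line_dist_ge0 b c.
move: (tree_line_dist a b) (tree_line_dist b c) (tdist_point a b) (tdist_point b c) (tdist_point a c) t ((val a).2 - (val b).2) ((val b).2 - (val c).2).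
move=> A B x y z xyz u v B0 A0 z0 y0 x0 eB eA.
have cs : x * y + u * v <= A * B.
  apply: sqr_le; first exact: mulr_ge0.
  rewrite [(A * B) ^+ 2]exprMn eA eB; have := sqr_ge0 (x * v - y * u); lra.
have : z ^+ 2 <= (x + y) ^+ 2 by rewrite ler_pXn2r ?nnegrE// addr_ge0.
lra.
Qed.

Definition tree_line := metric_quotient tree_line_dist_refl tree_line_dist_sym
  tree_line_dist_tri.

HB.instance Definition _ := Metric.on tree_line.

Definition tree_line_class (a : tree_line_point) : tree_line :=
  quotient_class tree_line_dist_refl tree_line_dist_sym tree_line_dist_tri a.

Lemma mdist_tree_line_class a b :
  mdist (tree_line_class a) (tree_line_class b) = tree_line_dist a b.
Proof. exact: mdist_quotient_class. Qed.

Lemma tree_line_class_surj (x : tree_line) : exists a, x = tree_line_class a.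
Proof. exact: quotient_class_surj. Qed.

(** Squared distances add: the tree contributes [tree_stewart], the line an identity. *)
Lemma tree_line_stewart : stewart_space tree_line.
Proof.
move=> x y s s01; have /andP[s0 s1] := s01.
have [a ->] := tree_line_class_surj x; have [b ->] := tree_line_class_surj y.
have [|m [r seg]] := @tree_point R (val a).1.1 (val a).1.2 (val b).1.1 (val b).1.2
    (s * tdist_point a b) (itv a) (itv b).
  by rewrite mulr_ge0 ?tdist_point_ge0//= ler_piMl ?tdist_point_ge0.
have mr : reduced p q m && (0 <= r <= 1).
  case: seg => r01 [k mk] _ _ _; rewrite r01 andbT.
  by case: mk => ->; apply: reduced_take; [case/andP: (valP a)|case/andP: (valP b)].
pose M : tree_line_point :=
  exist _ (m, r, (1 - s) * (val a).2 + s * (val b).2) mr.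
exists (tree_line_class M) => z; have [c ->] := tree_line_class_surj z.
rewrite !mdist_tree_line_class !tree_line_dist_sqr.
have h := @tree_stewart R _ _ _ _ s m r (val c).1.1 (val c).1.2 (itv a) (itv b) (itv c) s01 seg.
rewrite -/(tdist_point a b) -/(tdist_point c a) -/(tdist_point c b) in h.
have -> : tdist_point c M = tdist (val c).1.1 (val c).1.2 m r by [].
by rewrite /=; lra.
Qed.

Definition clamp (t : R) := Num.max 0 (Num.min 1 t).

Lemma clamp_itv t : 0 <= clamp t <= 1.
Proof. by rewrite /clamp le_max lexx /= ge_max ler01 ge_min lexx. Qed.

Lemma clamp_id t : 0 <= t <= 1 -> clamp t = t.
Proof. by move=> /andP[t0 t1]; rewrite /clamp min_r// max_r. Qed.

Lemma clamp_lip t u : `|clamp t - clamp u| <= `|t - u|.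
Proof.
rewrite /clamp; have [a|/ltW a] := leP 1 t; have [b|/ltW b] := leP 1 u.
all: have [c|/ltW c] := leP 0 t; have [e|/ltW e] := leP 0 u;
  rewrite ?(max_r ler01) ?(max_r c) ?(max_l c) ?(max_r e) ?(max_l e).
all: rewrite ?subrr ?normr0 ?normr_ge0//.
all: rewrite ler_norml; have := ler_norm (t - u); have := ler_norm (u - t);
  rewrite [`|u - t|]distrC; lra.
Qed.

End TreeLine.

Section TreeLineAction.
Variables (R : realType) (p q : nat).
Hypotheses (p_gt0 : (0 < p)%N) (q_gt0 : (0 < q)%N).
Local Notation reduced := (reduced p q).
Local Notation point := (tree_line_point R p q).
Local Notation space := (tree_line R p q).
Local Notation G := (torus_knot_group p q).
Local Notation stack_act := (stack_act (p := p) (q := q)).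
Implicit Types (w : seq (bool * nat)) (a b : point) (g h : G).

Let origin_proof : reduced ([::], 0 : R, 0 : R).1.1 && (0 <= ([::] :
  seq (bool * nat), 0 : R, 0 : R).1.2 <= 1).
Proof. by rewrite /= lexx ler01. Qed.

Definition origin : point := exist _ ([::], 0, 0) origin_proof.

(** [clamp] extends the strip over the edge [w] to a map of the whole plane, so that its continuity
    needs no subspace. *)
Definition cell w (x : R * R) : space :=
  tree_line_class (insubd origin (w, clamp x.1, x.2)).

Let val_cell w (x : R * R) : reduced w ->
  val (insubd origin (w, clamp x.1, x.2)) = (w, clamp x.1, x.2).
Proof. by move=> rw; rewrite val_insubd /= rw clamp_itv. Qed.

Let cell_surj (y : space) : exists w (t u : R), [/\ reduced w, 0 <= t <= 1 &
  y = cell w (t, u)].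
Proof.
have [[[[w t] h] ah] ->] := tree_line_class_surj y; have /andP[/= rw t01] := ah.
exists w, t, h; split=> //; congr tree_line_class; apply/val_inj.
by rewrite val_cell//= clamp_id.
Qed.

Lemma tdist_same_edge w (t u : R) : tdist w t w u = `|t - u|.
Proof. by elim: w => //= -[x i] w IHw; rewrite !eqxx. Qed.

Let cell_lip w (x y : R * R) : reduced w ->
  mdist (cell w x) (cell w y) <= `|x.1 - y.1| + `|x.2 - y.2|.
Proof.
move=> rw; rewrite mdist_tree_line_class; apply: sqr_le; first by rewrite addr_ge0.
rewrite tree_line_dist_sqr /tdist_point !val_cell//= tdist_same_edge.
have := clamp_lip x.1 y.1; have := normr_ge0 (clamp x.1 - clamp y.1).
move: `|clamp _ - _| => e e0 ee; rewrite -(real_normK (num_real (x.2 - y.2))).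
have := normr_ge0 (x.2 - y.2); have := normr_ge0 (x.1 - y.1).
move: `|x.1 - y.1| ee `|x.2 - y.2| => A eA B A0 B0; nra.
Qed.

Lemma cell_continuous w : reduced w -> continuous (cell w).
Proof.
move=> rw x; apply/metricType_numDomainType.cvgrPdist_lt => e e0.
apply/(@nbhs_ballP R (R * R)%type); exists (e / 2) => /=; first by rewrite divr_gt0.
move=> y [/= h1 h2].
have {}h1 : `|x.1 - y.1| < e / 2 by move: h1; rewrite -ball_normE.
have {}h2 : `|x.2 - y.2| < e / 2 by move: h2; rewrite -ball_normE.
by apply: (le_lt_trans (cell_lip x y rw)); lra.
Qed.

Lemma cell_compact w (r : R) : reduced w ->
  compact (cell w @` (`[0, 1] `*` `[- r, r])).
Proof.
move=> rw; apply: continuous_compact.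
  exact/continuous_subspaceT/cell_continuous.
by apply: compact_setX; exact: segment_compact.
Qed.

Definition all_letters := [seq (x, i) | x <- [:: true; false], i <- iota 0 (p + q)].

Fixpoint all_words n : seq (seq (bool * nat)) :=
  if n is m.+1 then [::] :: [seq l :: w | l <- all_letters, w <- all_words m]
  else [:: [::]].

Lemma mem_all_words n w : reduced w -> (size w <= n)%N -> w \in all_words n.
Proof.
elim: n w => [|n IHn] [|[x i] w] //= /and3P[/andP[i0 ix] _ rw] wn.
rewrite inE /=; apply/allpairsP; exists ((x, i), w); split=> //=; last exact: IHn.
apply/allpairsP; exists (x, i); split=> //=; first by case: (x); rewrite !inE.
by rewrite mem_iota /= add0n; case: (x) ix => /= /leq_trans; apply;
  rewrite ?leq_addr ?leq_addl.
Qed.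

Let tdist_le_dist a b : tdist_point a b <= tree_line_dist a b.
Proof.
apply: sqr_le; first exact: tree_line_dist_ge0.
by rewrite tree_line_dist_sqr lerDl sqr_ge0.
Qed.

Let height_le_dist a b : `|(val a).2 - (val b).2| <= tree_line_dist a b.
Proof.
apply: sqr_le; first exact: tree_line_dist_ge0.
by rewrite tree_line_dist_sqr real_normK ?num_real// lerDr sqr_ge0.
Qed.

Lemma dist_continuous (X : metricType R) (x : X) : continuous (mdist x).
Proof.
apply: (@lipschitz_continuous _ _ _ 1) => u v; rewrite mul1r.
have := metric_triangle x u v; have := metric_triangle x v u.
by rewrite [mdist v u]metric_sym ler_norml; lra.
Qed.

(** A ball is a closed subset of finitely many compact strips, since the distance bounds the length
    of the edge words. *)
Lemma tree_line_proper : proper_space space.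
Proof.
move=> x r; pose B := r + mdist (tree_line_class origin) x.
have [n /(_ n (leqnn n)) hn] := nat_above (B + 1).
pose s := [seq w <- all_words n | reduced w].
apply: (@subclosed_compact _ _ (\big[setU/set0]_(w <- s) (cell w @` (`[0, 1] `*` `[- B,
  B])))).
- have -> : [set y | mdist x y <= r] = mdist x @^-1` [set y | y <= r] by [].
  apply: preimage_closed; last exact: closed_le.
  by move=> y _; exact: dist_continuous.
- by rewrite big_filter; apply: bigsetU_compact => w rw; exact: cell_compact.
- move=> y /= xy; rewrite -bigcup_seq /=.
  have [w [t [h [rw t01 e]]]] := cell_surj y.
  have dy : mdist (tree_line_class origin) y <= B.
    by apply: (le_trans (metric_triangle _ x _)); rewrite /B; lra.
  rewrite e mdist_tree_line_class in dy.
  have d1 := le_trans (tdist_le_dist _ _) dy; have d2 := le_trans (height_le_dist _ _) dy.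
  rewrite /tdist_point val_cell//= in d1 d2.
  rewrite sub0r normrN in d2.
  exists w; last by exists (t, h) => //=; split; rewrite /= in_itv/= // -ler_norml.
  rewrite /= mem_filter rw; apply: mem_all_words => //.
  have t0 : 0 <= (0 : R) <= 1 by rewrite lexx ler01.
  have sw := size_le_tdist t0 (clamp_itv t) rw.
  by rewrite -(ler_nat R); move: d1; rewrite -/(tdist [::] 0 w (clamp t)); lra.
Qed.

Let act_proof g a : reduced (stack_act g (val a).1.1) && (0 <= (val a).1.2 <= 1).
Proof. by case/andP: (valP a) => rw ->; rewrite andbT stack_act_reduced. Qed.

Definition point_act g a : point :=
  exist _ (stack_act g (val a).1.1, (val a).1.2,
    (val a).2 + (height g)%:~R) (act_proof g a).

Let red a : reduced (val a).1.1.
Proof. by case/andP: (valP a). Qed.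

Lemma point_act_iso g a b :
  tree_line_dist (point_act g a) (point_act g b) = tree_line_dist a b.
Proof.
rewrite /tree_line_dist /tdist_point /= (tdist_stack_act p_gt0 q_gt0) ?red//.
by congr (Num.sqrt (_ + _ ^+ 2)); ring.
Qed.

Definition tree_line_act g (x : space) : space :=
  tree_line_class (point_act g (projT1 (cid (tree_line_class_surj x)))).

Lemma tree_line_actE g a :
  tree_line_act g (tree_line_class a) = tree_line_class (point_act g a).
Proof.
rewrite /tree_line_act; case: cid => b /= e; apply: mdist_positivity.
by rewrite mdist_tree_line_class point_act_iso -mdist_tree_line_class e mdistxx.
Qed.

Lemma tree_line_group_action : is_group_action tree_line_act.
Proof.
split=> [x|g h x]; have [a ->] := tree_line_class_surj x; rewrite !tree_line_actE;
  congr tree_line_class; apply/val_inj => /=.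
  by rewrite stack_act1 ?red// height1 addr0; case: (val a) => [[]].
by rewrite stack_actM ?red// heightM intrD addrA addrAC.
Qed.

Lemma tree_line_act_iso : acts_by_isometries tree_line_act.
Proof.
move=> g x y; have [a ->] := tree_line_class_surj x; have [b ->] :=
  tree_line_class_surj y.
by rewrite !tree_line_actE !mdist_tree_line_class point_act_iso.
Qed.

Lemma height_centerX (n : nat) : height (knot_center p q ^+ n)%g = ((p * q) * n)%N%:Z.
Proof. by rewrite heightX height_center -mulr_natr natz -PoszM. Qed.

(** The stack determines the element modulo the centre, and the height then determines the power of
    the centre. *)
Lemma stack_act_height_inj g h :
  stack_act g [::] = stack_act h [::] -> height g = height h -> g = h.
Proof.
move=> e hgt.
have [m [k mk]] : zeq (knot_center p q) g h.
  have [m1 [k1 e1]] := zeq_stack_act p_gt0 q_gt0 g.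
  have [m2 [k2 e2]] := zeq_stack_act p_gt0 q_gt0 h; rewrite -e in e2.
  exists (k2 + m1)%N, (k1 + m2)%N.
  by rewrite !expgnDr -!mulgA e1 e2 !mulgA -!expgnDr addnC.
have := congr1 (@height p q) mk; rewrite !heightM !height_centerX hgt => /addIr [] mk'.
have em : m = k.
  have pq0 : (0 < p * q)%N by rewrite muln_gt0 p_gt0.
  by apply/eqP; rewrite -(eqn_pmul2l pq0) mk'.
by move: mk; rewrite em => /mulgI.
Qed.

Lemma tree_line_properly_discontinuous : properly_discontinuous tree_line_act.
Proof.
move=> K cK.
have [->|/set0P K0] := eqVneq K set0.
  suff -> : [set g | tree_line_act g @` set0 `&` set0 !=set0] = set0 by exact:
    finite_set0.
  by apply/seteqP; split=> g //=; rewrite setI0 => -[].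
have [k _ hk] := compact_EVT_max K0 cK (continuous_subspaceT (@dist_continuous _ (tree_line_class origin))).
set B := mdist (tree_line_class origin) k in hk.
have [n /(_ n (leqnn n)) hn] := nat_above (2 * B + 1).
(* The candidates for stack and height of [g]: words of at most [n] syllables and heights from [- n]
   to [n]. *)
pose s := [seq (w, i%:Z - n%:Z) | w <- all_words n, i <- iota 0 (2 * n + 1)].
pose phi g := (stack_act g [::], height g).
apply: (@sub_finite_set _ _ (phi @^-1` [set` s])); last first.
  apply: finite_preimage; last exact: finite_seq.
  by move=> g h _ _ [] e e'; exact: stack_act_height_inj.
move=> g [_ [[y Ky <-] Kgy]] /=.
have hK z : K z -> mdist (tree_line_class origin) z <= B by move=> Kz; apply: hk;
  rewrite inE.
have d : mdist (tree_line_class origin) (tree_line_act g (tree_line_class origin)) <=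
  2 * B.
  apply: (le_trans (metric_triangle _ (tree_line_act g y) _)).
  by rewrite tree_line_act_iso [mdist y _]metric_sym; have := hK _ Ky; have :=
    hK _ Kgy; lra.
rewrite tree_line_actE mdist_tree_line_class in d.
have d1 := le_trans (tdist_le_dist _ _) d; have d2 := le_trans (height_le_dist _ _) d.
rewrite /tdist_point /= in d1 d2.
rewrite sub0r normrN add0r in d2.
have rg : reduced (stack_act g [::]) by exact: stack_act_reduced.
apply/allpairsP; exists (stack_act g [::], `|(height g + n%:Z)%R|%N); split=> /=.
- apply: mem_all_words => //.
  have t0 : 0 <= (0 : R) <= 1 by rewrite lexx ler01.
  have sw := size_le_tdist t0 t0 rg.
  by rewrite -(ler_nat R); move: d1; rewrite -/(tdist [::] 0 (stack_act g [::]) 0); lra.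
- have : `|height g| <= n%:Z.
    rewrite -(ler_int R) intr_norm; apply: (le_trans d2).
    by rewrite -pmulrn; lra.
  by rewrite mem_iota; lia.
- rewrite /phi; congr pair.
  have : `|height g| <= n%:Z.
    rewrite -(ler_int R) intr_norm; apply: (le_trans d2).
    by rewrite -pmulrn; lra.
  by lia.
Qed.

Lemma tree_line_cocompact : cocompact tree_line_act.
Proof.
pose c : R := (p * q)%:R.
have c0 : 0 < c by rewrite ltr0n muln_gt0 p_gt0.
exists (cell [::] @` (`[0, 1] `*` `[- c, c])); first exact: cell_compact.
apply/seteqP; split=> // y _.
have [w [t [h [rw t01 ->]]]] := cell_surj y.
(* [g] carries the edge [[::]] to [w]; a power [j] of the centre, which fixes every edge, then
   brings the height into the compact interval. *)
pose g := stack_eval p q w.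
have gw : stack_act g [::] = w by exact: stack_act_eval.
pose r := h - (height g)%:~R.
have zact (n : nat) : stack_act (knot_center p q ^+ n)%g [::] = [::].
  elim: n => [|n IHn]; first by rewrite stack_act1.
  by rewrite expgS stack_actM// IHn stack_act_center.
have hz (n : nat) : (height (knot_center p q ^+ n)%g)%:~R = n%:R * c :> R.
  by rewrite height_centerX -pmulrn natrM mulrC.
have [j [j0 jr]] : exists j : G, stack_act j [::] = [::] /\ `|r - (height j)%:~R| <= c.
  pose n := Num.truncn (`|r| / c).
  have /andP[n1 n2] := truncn_itv (divr_ge0 (normr_ge0 r) (ltW c0)).
  rewrite -/n ler_pdivlMr// in n1; rewrite -/n ltr_pdivrMr// -natr1 in n2.
  have [r0|/ltW r0] := leP 0 r.
    exists (knot_center p q ^+ n)%g; split=> //.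
    by rewrite hz ler_norml; rewrite ger0_norm// in n1 n2; lra.
  exists ((knot_center p q ^+ n)^-1)%g; split.
    by rewrite -{1}(zact n) -stack_actM// mulVg stack_act1.
  have -> : height ((knot_center p q ^+ n)^-1)%g = - height (knot_center p q ^+ n)%g.
    by apply/eqP; rewrite -addr_eq0 -heightM mulVg height1.
  rewrite mulrNz hz ler_norml; rewrite ler0_norm// in n1 n2; lra.
exists (g * j)%g => //; exists (cell [::] (t, r - (height j)%:~R)).
  by exists (t, r - (height j)%:~R) => //=; split; rewrite /= in_itv/= // -ler_norml.
have red0 : reduced [::] by [].
rewrite /cell tree_line_actE; congr tree_line_class; apply/val_inj.
rewrite [RHS]val_cell// /= (val_cell (t, r - (height j)%:~R) red0) /=.
rewrite stack_actM// j0 gw heightM intrD.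
by congr (_, _); rewrite /r; ring.
Qed.

Lemma torus_knot_group_acts : exists2 X : metricType R, cat0_space X &
  acts_geometrically G X.
Proof.
exists space; last first.
  exists tree_line_act; split.
  - exact: tree_line_group_action.
  - exact: tree_line_act_iso.
  - exact: tree_line_properly_discontinuous.
  - exact: tree_line_cocompact.
have st := @tree_line_stewart R p q.
split.
- by exists (tree_line_class origin).
- exact: tree_line_proper.
- exact: stewart_geodesic_space.
- exact: stewart_cat0_inequality.
Qed.

End TreeLineAction.

Theorem proposition4p11 (R : realType) (p q : nat) (hp : (0 < p)%N)
    (hq : (0 < q)%N) (hpq : coprime p q) :
  rigid R (torus_knot_group p q).
Proof.
split; first exact: torus_knot_group_acts.
have H (X : metricType R) : cat0_space X -> acts_geometrically (torus_knot_group p q) X ->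
    forall x : X, exists code,
      @coding R _ (visual_boundary x) (valid_code (knot_nf (p := p) (q := q))) code.
  move=> [ne pr geo cat] [act geoact] x.
  apply: (boundary_coding (knot_stack_group hp hq) _ geoact) => //.
  exact: geodesic_stewart.
move=> X1 X2 cat1 act1 cat2 act2 x1 x2.
have [code1 coding1] := H _ cat1 act1 x1; have [code2 coding2] := H _ cat2 act2 x2.
exact: coding_homeomorphic coding1 coding2.
Qed.
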